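(* For all $d\in\mathbb{N}$ and all $\mathbf{n}=(n_1,\ldots,n_d)\in\mathbb{N}^d$, with $\mathbf{z}=(z_1,\ldots,z_d)$, the function $$\operatorname{PLi}_{\mathbf{n}}(\mathbf{z})=\operatorname{Li}_{\mathbf{n}}(\mathbf{z})-(-1)^{|\mathbf{n}|-d}\operatorname{Li}_{\mathbf{n}}(1/z_1,\ldots,1/z_d)$$ lies in $\mathscr{L}^{d-1}_{|\mathbf{n}|}(\mathbf{z})$, where $|\mathbf{n}|=n_1+\cdots+n_d$.
   Context: Multiple polylogarithms $\operatorname{Li}_{\mathbf{n}}(\mathbf{y})=\sum_{0<k_1<\cdots<k_r}\frac{y_1^{k_1}\cdots y_r^{k_r}}{k_1^{n_1}\cdots k_r^{n_r}}$ ($\mathbf{n}\in\mathbb{N}^r$), analytically continued along straight paths from near the origin; functions of $\mathbf{z}$ are considered on the simply connected domain $\{\mathbf{z}\in\mathbb{C}^d: z_iz_{i+1}\cdots z_j\notin[0,\infty)\text{ for all }1\le i\le j\le d\}$. For $n\in\mathbb{N}_0$, $\beta_n(z)=\frac{(2\pi i)^n}{n!}B_n\!\left(\frac12+\frac{\log(-z)}{2\pi i}\right)$, with $\log$ the principal branch and $B_n(x)$ the Bernoulli polynomials. Write $z_{i,j}=\prod_{k=i}^j z_k$. $\mathscr{L}^D_w(\mathbf{z})$ is the $\mathbb{Z}$-linear span of all functions $\prod_{i=1}^d\beta_{k_i}(z_{i,d})\prod_{i=1}^s\operatorname{Li}_{\mathbf{n}^{(i)}}(\mathbf{z}^{(i)})$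 with $\mathbf{k}\in\mathbb{N}_0^d$, $s\in\mathbb{N}_0$, $\mathbf{n}^{(i)}\in\mathbb{N}^{d_i}$ with $d_i>0$, $d_1+\cdots+d_s\le D$, $k_1+\cdots+k_d+\sum_i|\mathbf{n}^{(i)}|=w$, and such that listing all arguments left to right gives $(\mathbf{z}^{(1)},\ldots,\mathbf{z}^{(s)})=(z_{i_1,j_1},\ldots,z_{i_r,j_r})$ with $1\le i_1\le j_1<i_2\le j_2<\cdots<i_r\le j_r\le d$. *)

(* Defs.v *)
From mathcomp Require Import all_boot.
From Stdlib Require Import Reals ClassicalEpsilon.
From Coquelicot Require Import Coquelicot.

Set Implicit Arguments.
Unset Strict Implicit.
Unset Printing Implicit Defensive.

Local Open Scope C_scope.

(* [:: B_0; ...; B_(n-1)], by  sum_(k <= m) C(m+1, k) B_k = [m = 0];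
   in particular B_1 = -1/2. *)
Fixpoint bernoulli_seq (n : nat) : seq R :=
  if n is m.+1 then
    let s := bernoulli_seq m in
    rcons s ((if m is 0%nat then 1 else 0)
             - / INR m.+1 * \big[Rplus/0]_(k < m) (INR 'C(m.+1, k) * nth 0 s k))%R
  else [::].

Definition bernoulli (n : nat) : R := nth 0%R (bernoulli_seq n.+1) n.

Definition bernoulli_poly (n : nat) (x : C) : C :=
  \big[Cplus/RtoC 0]_(k < n.+1)
     (RtoC (INR 'C(n, k) * bernoulli k) * Cpow x (n - k)).

(* The argument in ]-PI, PI]; it is only meaningful for z <> 0. *)
Definition principal_arg (z : C) : R :=
  if Rle_dec 0 (Im z) then acos (Re z / Cmod z) else (- acos (Re z / Cmod z))%R.

Definition Clog (z : C) : C := (ln (Cmod z), principal_arg z).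

Definition two_pi_i : C := RtoC (2 * PI) * Ci.

Definition beta (n : nat) (z : C) : C :=
  Cpow two_pi_i n / RtoC (INR n`!)
  * bernoulli_poly n (RtoC (/ 2) + Clog (- z) / two_pi_i).

Definition increasing_idx (r N : nat) (k : {ffun 'I_r -> 'I_N.+1}) : bool :=
  [forall i : 'I_r, (0 < k i)%nat]
  && [forall i : 'I_r, forall j : 'I_r, (i < j)%nat ==> (k i < k j)%nat].

(* The sum over 0 < k_1 < ... < k_r <= N. *)
Definition Li_partial (r : nat) (n : 'I_r -> nat) (y : 'I_r -> C) (N : nat) : C :=
  \big[Cplus/RtoC 0]_(k : {ffun 'I_r -> 'I_N.+1} | increasing_idx k)
    \big[Cmult/RtoC 1]_(i < r) (Cpow (y i) (k i) / Cpow (RtoC (INR (k i))) (n i)).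

Definition is_Li_series (r : nat) (n : 'I_r -> nat) (y : 'I_r -> C) (v : C) : Prop :=
  filterlim (Li_partial n y) eventually (locally v).

Definition set_coord (r : nat) (z : 'I_r -> C) (i : 'I_r) (w : C) : 'I_r -> C :=
  fun k => if k == i then w else z k.

(* Holomorphic in several variables: the complex partial derivatives exist and
   are (jointly) continuous on U, which is meant to be open. *)
Definition holomorphic_on (r : nat) (U : ('I_r -> C) -> Prop)
    (F : ('I_r -> C) -> C) : Prop :=
  exists dF : 'I_r -> ('I_r -> C) -> C,
    forall z, U z -> forall i,
      is_derive (K := C_AbsRing) (V := C_NormedModule)
        (fun w : C => F (set_coord z i w)) (z i) (dF i z)
      /\ continuous (dF i) z.

(* v is the value at z of the analytic continuation of the series Li_n, from
   near the origin, along the segment t |-> t z, 0 <= t <= 1. *)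
Definition is_Li (r : nat) (n : 'I_r -> nat) (z : 'I_r -> C) (v : C) : Prop :=
  exists (U : ('I_r -> C) -> Prop) (F : ('I_r -> C) -> C),
    [/\ open U,
        forall t : R, (0 <= t <= 1)%R -> U (fun i => RtoC t * z i),
        holomorphic_on U F,
        locally (fun _ : 'I_r => RtoC 0) (fun y => is_Li_series n y (F y))
      & F z = v].

(* Unspecified where the continuation does not exist. *)
Definition Li (r : nat) (n : 'I_r -> nat) (z : 'I_r -> C) : C :=
  epsilon (inhabits (RtoC 0)) (is_Li n z).

Definition PLi (d : nat) (n : 'I_d -> nat) (z : 'I_d -> C) : C :=
  Li n z - Cpow (RtoC (-1)) ((\sum_(i < d) n i) - d) * Li n (fun i => / z i).

(* z_{i,j}; indices start at 0, so that z_{i,d} is zprod z i d.-1. *)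
Definition zprod (d : nat) (z : 'I_d -> C) (i j : nat) : C :=
  \big[Cmult/RtoC 1]_(k < d | (i <= k <= j)%nat) z k.

Definition Li_domain (d : nat) (z : 'I_d -> C) : Prop :=
  forall i j : 'I_d, (i <= j)%nat ->
    ~ exists x : R, (0 <= x)%R /\ zprod z i j = RtoC x.

(* An index n of some Li together with the argument z_{i,j} in that place. *)
Record slot (d : nat) := Slot {
  slot_exp : nat;
  slot_fst : 'I_d;
  slot_lst : 'I_d }.

(* The data of prod_i beta_{k_i}(z_{i,d}) * prod_i Li_{n^(i)}(z^(i)). *)
Record term (d : nat) := Term {
  beta_idx : 'I_d -> nat;
  blocks : seq (seq (slot d)) }.

Definition block_exp (d : nat) (b : seq (slot d)) : 'I_(size b) -> nat :=
  fun k => slot_exp (tnth (in_tuple b) k).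

Definition block_arg (d : nat) (b : seq (slot d)) (z : 'I_d -> C) :
    'I_(size b) -> C :=
  fun k => let a := tnth (in_tuple b) k in zprod z (slot_fst a) (slot_lst a).

Definition term_val (d : nat) (t : term d) (z : 'I_d -> C) : C :=
  \big[Cmult/RtoC 1]_(i < d) beta (beta_idx t i) (zprod z i d.-1)
  * \big[Cmult/RtoC 1]_(b <- blocks t) Li (block_exp (b := b)) (block_arg (b := b) z).

Definition term_shape (d D w : nat) (t : term d) : Prop :=
  let args := flatten (blocks t) in
  [/\ all (fun b => 0 < size b)%nat (blocks t),
      (size args <= D)%nat,
      all (fun a => (0 < slot_exp a)%nat && (slot_fst a <= slot_lst a)%nat) args,
      path.sorted (fun a a' => slot_lst a < slot_fst a')%nat args
    & (\sum_(i < d) beta_idx t i + \sum_(a <- args) slot_exp a = w)%nat].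

(* The Li factors are functions on the whole domain. This excludes for example
   Li_{a,b}(z_1, z_3), which cannot be continued to z_1 z_3 = 1. *)
Definition term_defined (d : nat) (t : term d) : Prop :=
  forall b, List.In b (blocks t) -> forall z, Li_domain z ->
    exists v, is_Li (block_exp (b := b)) (block_arg (b := b) z) v.

(* f belongs to the Z-span L^D_w, as a function on the domain. *)
Definition in_Lspace (d D w : nat) (f : ('I_d -> C) -> C) : Prop :=
  exists l : seq (Z * term d),
    (forall c t, List.In (c, t) l -> term_shape D w t /\ term_defined t)
    /\ forall z, Li_domain z ->
         f z = \big[Cplus/RtoC 0]_(p <- l) (RtoC (IZR p.1) * term_val p.2 z).

(* Main.v *)
Require Import Defs.
From HB Require Import structures.
From mathcomp Require Import all_boot zify.
From Stdlib Require Import Reals Lra Psatz ClassicalEpsilon Classical FunctionalExtensionality.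
From Coquelicot Require Import Coquelicot.

(** Writing [w / (1 - s w)] for the kernels, multiple polylogarithms are iterated
    integrals, holomorphic wherever the partial products of the arguments avoid
    [[1, oo)]; an identity theorem along segments identifies them with the
    continuation of the series.

    Let [Dec B] be the polylogarithm of the arguments [B] listed in reversed
    order, and [N B = (-1)^|n| Li_n (1 / z)].  The sum
    [Z B = sum_i Dec (take i B) * N (drop i B)] is a regularised sum over all
    decreasing sequences of nonzero integers.  Differentiating with respect to the
    scale of the arguments and inducting on weight and depth, [Z B] equals minus a
    sum over the positions [i] in which the index at [i] turns into a Bernoulli
    function [beta_k (z_1 ... z_d)] and the remaining factors have total depth one
    less; this starts from the inversion formula in depth one.

    The antipode relation [sum_i (-1)^i F (rev (take i B)) * Dec (drop i B) = 0],
    with [F] the non-strict sums, i.e. sums of polylogarithms with merged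
    neighbouring arguments, telescopes to
    [N B = sum_i (-1)^i F (rev (take i B)) * Z (drop i B)].  Its term [i = d] is
    [(-1)^d] times [Li_n] plus terms of lower depth, and all other terms have
    depth at most [d - 1]. *)

Set Implicit Arguments.
Unset Strict Implicit.
Unset Printing Implicit Defensive.

Local Open Scope R_scope.
Local Open Scope C_scope.

(** Integrals run over [0, 1] with integrand [t ^ r * g (t * s)] instead of over [0, s]: the
    endpoints do not move, nothing is singular at [s = 0], and continuity in parameters follows from
    compactness of [0, 1]. Derivatives come from explicit slopes, i.e. continuous [g] with
    [f u - f t = (u - t) * g u].

    The full product [T] of the arguments and [/ T] never lie in the open unit disc together, so the
    identity for [Z B] cannot be obtained by rearranging series. It is proved by a differential
    equation instead: the first argument is multiplied by [t] and the last one by [1 / t]. This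
    keeps [T], hence the Bernoulli functions, fixed, and [t d/dt] multiplies a summand by
    [k_1 - k_r], which lowers one of the two end indices. An end index that has reached 0 is removed
    by a geometric sum; the reflection [k -> - k] exchanges the ends.

    The Bernoulli side has its shape because [1 / k ^ n] is replaced by [1 / (k + x) ^ n] and
    expanded in [x]: multiplication by [k = (k + x) - x] lowers the index or shifts the expansion,
    and the shifts cancel between the factors to the left and to the right of the position [i]. *)

Lemma In_cat (T : Type) (x : T) (l m : seq T) :
  List.In x (l ++ m) <-> List.In x l \/ List.In x m.
Proof. exact: List.in_app_iff. Qed.

(** * Continuity, integration and differentiation of complex-valued functions *)

Lemma C_ballP (x y : C) (e : posreal) :
  Cmod (y - x) < e -> @ball C_UniformSpace x e y.
Proof. exact (@C_NormedModule_mixin_compat1 x y e). Qed.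

(** Balls of [C] are squares, so the modulus may exceed the radius by a factor sqrt 2; the bound 2
    suffices everywhere. *)
Lemma C_ballW (x y : C) (e : posreal) :
  @ball C_UniformSpace x e y -> Cmod (y - x) < 2 * e.
Proof.
move=> /C_NormedModule_mixin_compat2 H.
apply: (Rlt_le_trans _ _ _ H); apply: Rmult_le_compat_r; first exact/Rlt_le/cond_pos.
apply: (Rle_trans _ (sqrt (2 * 2))); first by apply: sqrt_le_1_alt; lra.
by rewrite sqrt_square; lra.
Qed.

Lemma C_continuousP (X : UniformSpace) (f : X -> C) (x : X) :
  continuous f x <-> forall e, (0 < e)%R -> locally x (fun y => Cmod (f y - f x) < e).
Proof.
split=> [H e e0 | H].
  have e20 : (0 < e / 2)%R by lra.
  have /filterlim_locally/(_ (mkposreal _ e20)) H' := H.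
  apply: filter_imp H' => y /C_ballW /= Hy.
  by apply: Rlt_le_trans Hy _; lra.
apply/filterlim_locally => e.
by apply: filter_imp (H e (cond_pos e)) => y; apply: C_ballP.
Qed.

Lemma C_cont_const (X : UniformSpace) (c : C) (x : X) : continuous (fun _ => c) x.
Proof. exact: continuous_const. Qed.

Lemma C_cont_plus (X : UniformSpace) (f g : X -> C) (x : X) :
  continuous f x -> continuous g x -> continuous (fun y => f y + g y) x.
Proof.
move=> /C_continuousP Hf /C_continuousP Hg; apply/C_continuousP => e e0.
have e20 : (0 < e / 2)%R by lra.
apply: filter_imp (filter_and _ _ (Hf _ e20) (Hg _ e20)) => y [H1 H2].
replace (f y + g y - (f x + g x)) with ((f y - f x) + (g y - g x)) by ring.
by apply: Rle_lt_trans (Cmod_triangle _ _) _; lra.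
Qed.

Lemma C_cont_opp (X : UniformSpace) (f : X -> C) (x : X) :
  continuous f x -> continuous (fun y => - f y) x.
Proof.
move=> /C_continuousP Hf; apply/C_continuousP => e e0.
apply: filter_imp (Hf _ e0) => y H1.
by replace (- f y - - f x) with (- (f y - f x)) by ring; rewrite Cmod_opp.
Qed.

Lemma C_cont_minus (X : UniformSpace) (f g : X -> C) (x : X) :
  continuous f x -> continuous g x -> continuous (fun y => f y - g y) x.
Proof. by move=> Hf Hg; apply: C_cont_plus => //; apply: C_cont_opp. Qed.

Lemma C_cont_mult (X : UniformSpace) (f g : X -> C) (x : X) :
  continuous f x -> continuous g x -> continuous (fun y => f y * g y) x.
Proof.
move=> /C_continuousP Hf /C_continuousP Hg; apply/C_continuousP => e e0.
have a0 := Cmod_ge_0 (f x); have b0 := Cmod_ge_0 (g x).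
have [d [d0 [d1 dM]]] : exists d, (0 < d /\ d <= 1 /\ d * (1 + Cmod (f x) + Cmod (g x)) <= e / 2)%R.
  exists (Rmin 1 (e / (2 * (1 + Cmod (f x) + Cmod (g x))))).
  split; first by apply: Rmin_glb_lt; [lra | apply: Rdiv_lt_0_compat; lra].
  split; first exact: Rmin_l.
  apply: (Rle_trans _ (e / (2 * (1 + Cmod (f x) + Cmod (g x))) * (1 + Cmod (f x) + Cmod (g x)))%R).
    by apply: Rmult_le_compat_r; [lra | apply: Rmin_r].
  by right; field; lra.
apply: filter_imp (filter_and _ _ (Hf _ d0) (Hg _ d0)) => y [H1 H2].
replace (f y * g y - f x * g x)
  with ((f y - f x) * (g y - g x) + ((f y - f x) * g x + f x * (g y - g x))) by ring.
apply: Rle_lt_trans (Cmod_triangle _ _) _.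
have H3 := Cmod_triangle ((f y - f x) * g x) (f x * (g y - g x)).
rewrite !Cmod_mult in H3 *.
have u0 := Cmod_ge_0 (f y - f x); have v0 := Cmod_ge_0 (g y - g x).
have K1 : (Cmod (f y - f x) * Cmod (g y - g x) <= d * 1)%R by apply: Rmult_le_compat; lra.
have K2 : (Cmod (f y - f x) * Cmod (g x) <= d * Cmod (g x))%R by apply: Rmult_le_compat_r; lra.
have K3 : (Cmod (f x) * Cmod (g y - g x) <= Cmod (f x) * d)%R by apply: Rmult_le_compat_l; lra.
nra.
Qed.

Lemma C_cont_inv (X : UniformSpace) (f : X -> C) (x : X) :
  continuous f x -> f x <> 0 -> continuous (fun y => / f y) x.
Proof.
move=> /C_continuousP Hf /Cmod_gt_0 f0; apply/C_continuousP => e e0.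
set m := Cmod (f x) in f0.
have m20 : (0 < m / 2)%R by lra.
have d0 : (0 < e * (m * (m / 2)))%R by apply: Rmult_lt_0_compat => //; nra.
apply: filter_imp (filter_and _ _ (Hf _ m20) (Hf _ d0)) => y [H1 H2].
have H3 : (m / 2 < Cmod (f y))%R.
  have := Cmod_triangle (f y) (- (f y - f x)).
  replace (f y + - (f y - f x)) with (f x) by ring.
  by rewrite Cmod_opp -/m; lra.
have fy : f y <> 0 by apply/Cmod_gt_0; lra.
have fx : f x <> 0 by apply/Cmod_gt_0.
replace (/ f y - / f x) with (- (f y - f x) / (f x * f y)) by (by field; split).
rewrite Cmod_div; last exact: Cmult_neq_0.
rewrite Cmod_mult Cmod_opp -/m.
have mm : (0 < m * Cmod (f y))%R by nra.
apply: (Rmult_lt_reg_r (m * Cmod (f y))) => //.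
rewrite /Rdiv Rmult_assoc Rinv_l; last lra.
rewrite Rmult_1_r; apply: Rlt_le_trans H2 _.
by apply: Rmult_le_compat_l; [lra | apply: Rmult_le_compat_l; lra].
Qed.

Lemma C_cont_div (X : UniformSpace) (f g : X -> C) (x : X) :
  continuous f x -> continuous g x -> g x <> 0 -> continuous (fun y => f y / g y) x.
Proof. by move=> Hf Hg g0; apply: C_cont_mult => //; apply: C_cont_inv. Qed.

Lemma C_cont_RtoC (X : UniformSpace) (f : X -> R) (x : X) :
  continuous f x -> continuous (fun y => RtoC (f y)) x.
Proof.
move=> /filterlim_locally Hf; apply/C_continuousP => e e0.
apply: filter_imp (Hf (mkposreal e e0)) => y Hy.
by rewrite -RtoC_minus Cmod_R.
Qed.

Lemma C_cont_pow (X : UniformSpace) (f : X -> C) (x : X) (n : nat) :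
  continuous f x -> continuous (fun y => Cpow (f y) n) x.
Proof.
move=> Hf; elim: n => [|n IH]; first exact: C_cont_const.
by apply: (continuous_ext (fun y => f y * Cpow (f y) n)) => //; apply: C_cont_mult.
Qed.

Lemma R_cont_mult (X : UniformSpace) (f g : X -> R) (x : X) :
  continuous f x -> continuous g x -> continuous (fun y => (f y * g y)%R) x.
Proof.
by move=> Hf Hg; apply: (continuous_mult (K := R_AbsRing)).
Qed.

(** Compactness of [0, 1]: finitely many of the product neighbourhoods cover the segment, and the
    smallest of their radii works for all [t]. *)
Lemma tube (X : UniformSpace) (x0 : X) (Q : X -> R -> Prop) :
  (forall t, (0 <= t <= 1)%R -> locally (x0, t) (fun p => Q p.1 p.2)) ->
  locally x0 (fun x => forall t, (0 <= t <= 1)%R -> Q x t).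
Proof.
move=> H.
have K : forall t : R, exists d : posreal, (0 <= t <= 1)%R ->
    forall y : X * R, ball (x0, t) d y -> Q y.1 y.2.
  move=> t; case: (classic (0 <= t <= 1)%R) => [/H [d Hd]|H']; first by exists d.
  by exists (mkposreal _ Rlt_0_1) => /H'.
pose d t := proj1_sig (constructive_indefinite_description _ (K t)).
have Hd t : (0 <= t <= 1)%R -> forall y : X * R, ball (x0, t) (d t) y -> Q y.1 y.2.
  exact: (proj2_sig (constructive_indefinite_description _ (K t))).
have [e He] := compactness_value_1d 0 1 d.
exists e => x Hx t Ht; apply: NNPP => nQ.
apply: (He t Ht) => -[t' [Ht' [Htt' Hdt']]]; apply: nQ.
by apply: (Hd t' Ht' (x, t)); split => /=; [apply: ball_le Hx | ].
Qed.

Notation ex_CInt f := (@ex_RInt C_R_CompleteNormedModule f 0 1).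
Definition CInt (f : R -> C) : C := @RInt C_R_CompleteNormedModule f 0 1.

Lemma ex_CInt_cont (f : R -> C) :
  (forall t, (0 <= t <= 1)%R -> continuous f t) -> ex_CInt f.
Proof.
move=> H; apply: (@ex_RInt_continuous C_R_CompleteNormedModule) => t.
rewrite Rmin_left; last lra. by rewrite Rmax_right; [apply: H | lra].
Qed.

Lemma CInt_correct (f : R -> C) : ex_CInt f ->
  @is_RInt C_R_CompleteNormedModule f 0 1 (CInt f).
Proof. exact: (@RInt_correct C_R_CompleteNormedModule). Qed.

Lemma CInt_unique (f : R -> C) (l : C) :
  @is_RInt C_R_CompleteNormedModule f 0 1 l -> CInt f = l.
Proof. exact: (@is_RInt_unique C_R_CompleteNormedModule). Qed.

Lemma CInt_ext (f g : R -> C) :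
  (forall t, (0 <= t <= 1)%R -> f t = g t) -> CInt f = CInt g.
Proof.
move=> H; apply: (@RInt_ext C_R_CompleteNormedModule) => t.
rewrite Rmin_left; last lra. rewrite Rmax_right => [Ht|]; last lra. by apply: H; lra.
Qed.

Lemma CInt_plus (f g : R -> C) : ex_CInt f -> ex_CInt g ->
  CInt (fun t => f t + g t) = CInt f + CInt g.
Proof. exact: (@RInt_plus C_R_CompleteNormedModule). Qed.

Lemma CInt_mult (c : C) (f : R -> C) : ex_CInt f -> CInt (fun t => c * f t) = c * CInt f.
Proof.
move=> /CInt_correct Hf; apply: CInt_unique.
have H1 := is_RInt_fct_extend_fst _ _ _ _ Hf.
have H2 := is_RInt_fct_extend_snd _ _ _ _ Hf.
apply: is_RInt_fct_extend_pair => /=.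
  exact: (is_RInt_minus _ _ _ _ _ _ (is_RInt_scal _ _ _ c.1 _ H1) (is_RInt_scal _ _ _ c.2 _ H2)).
exact: (is_RInt_plus _ _ _ _ _ _ (is_RInt_scal _ _ _ c.1 _ H2) (is_RInt_scal _ _ _ c.2 _ H1)).
Qed.

Lemma CInt_const (c : C) : CInt (fun _ => c) = c.
Proof.
apply: CInt_unique.
have := @is_RInt_const C_R_CompleteNormedModule 0 1 c.
rewrite scal_R_Cmult; replace (RtoC (1 - 0) * c) with c => //.
by rewrite Rminus_0_r; ring.
Qed.

Lemma CInt_bound (f : R -> C) (M : R) : ex_CInt f ->
  (forall t, (0 <= t <= 1)%R -> (Cmod (f t) <= M)%R) -> (Cmod (CInt f) <= M)%R.
Proof.
move=> /CInt_correct Hf HM.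
have Hg := @is_RInt_const R_NormedModule 0 1 M.
have := @norm_RInt_le C_R_CompleteNormedModule f (fun _ => M) 0 1 _ _ Rle_0_1 _ Hf Hg.
rewrite /scal /= /mult /= Rminus_0_r Rmult_1_l -Cmod_norm; apply=> t Ht.
by rewrite -Cmod_norm; apply: HM.
Qed.

Lemma CInt_minus (f g : R -> C) : ex_CInt f -> ex_CInt g ->
  CInt (fun t => f t - g t) = CInt f - CInt g.
Proof. exact: (@RInt_minus C_R_CompleteNormedModule). Qed.

Lemma ex_CInt_minus (f g : R -> C) : ex_CInt f -> ex_CInt g ->
  ex_CInt (fun t => f t - g t).
Proof. exact: (@ex_RInt_minus C_R_CompleteNormedModule). Qed.

(** By [tube] the integrand is uniformly close, over all [t] in [0, 1], to its value at [x0]. *)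
Lemma CInt_cont (X : UniformSpace) (phi : X -> R -> C) (x0 : X) :
  (forall t, (0 <= t <= 1)%R -> continuous (fun p : X * R => phi p.1 p.2) (x0, t)) ->
  locally x0 (fun x => ex_CInt (phi x)) ->
  continuous (fun x => CInt (phi x)) x0.
Proof.
move=> H ex; apply/C_continuousP => e e0.
have e40 : (0 < e / 4)%R by lra.
have Q : locally x0 (fun x => forall t, (0 <= t <= 1)%R ->
    (Cmod (phi x t - phi x0 t) <= e / 2)%R).
  apply: tube => t Ht.
  have /C_continuousP/(_ _ e40) [d Hd] := H t Ht.
  exists d => -[x s] [/= Hx Hs].
  have H1 := Hd (x, s) (conj Hx Hs).
  have H2 := Hd (x0, s) (conj (ball_center _ _) Hs).
  rewrite /= in H1 H2.
  replace (phi x s - phi x0 s) with ((phi x s - phi x0 t) + - (phi x0 s - phi x0 t)) by ring.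
  have := Cmod_triangle (phi x s - phi x0 t) (- (phi x0 s - phi x0 t)).
  by rewrite Cmod_opp; lra.
have ex0 := locally_singleton _ _ ex.
apply: filter_imp (filter_and _ _ ex Q) => x [Hex HQ].
rewrite -CInt_minus //.
apply: Rle_lt_trans (CInt_bound _ HQ) _; last lra.
exact: ex_CInt_minus.
Qed.

Lemma CInt_derive (f df : R -> C) :
  (forall t, (0 <= t <= 1)%R -> @is_derive R_AbsRing C_R_NormedModule f t (df t)) ->
  (forall t, (0 <= t <= 1)%R -> continuous df t) ->
  CInt df = f 1%R - f 0%R.
Proof.
move=> H1 H2; apply: CInt_unique.
apply: (@is_RInt_derive C_R_CompleteNormedModule) => t;
 (rewrite Rmin_left; last lra); (rewrite Rmax_right; last lra); [exact: H1 | exact: H2].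
Qed.

Lemma R_derP (f : R -> C) (t : R) (l : C) :
  @is_derive R_AbsRing C_R_NormedModule f t l <->
  forall e, (0 < e)%R -> locally t (fun u =>
    (Cmod (f u - f t - RtoC (u - t) * l) <= e * Rabs (u - t))%R).
Proof.
split=> [[_ H] e e0 | H].
  have := H t (fun P HP => HP) (mkposreal e e0); apply: filter_imp => u /=.
  by rewrite -Cmod_norm scal_R_Cmult.
split; first exact: is_linear_scal_l.
move=> x Hx e.
have <- := is_filter_lim_locally_unique _ _ Hx.
apply: filter_imp (H e (cond_pos e)) => u.
by rewrite /= -Cmod_norm scal_R_Cmult.
Qed.

Lemma C_derP (f : C -> C) (z l : C) :
  is_derive (K := C_AbsRing) (V := C_NormedModule) f z l <->
  forall e, (0 < e)%R -> @locally C_UniformSpace z (fun w =>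
    (Cmod (f w - f z - (w - z) * l) <= e * Cmod (w - z))%R).
Proof.
split=> [[_ H] e e0 | H].
  apply/locally_C.
  exact: (H z (fun P HP => HP) (mkposreal e e0)).
split; first exact: is_linear_scal_l.
move=> x Hx e.
have <- := is_filter_lim_locally_unique _ _ Hx.
by apply/locally_C/(H e (cond_pos e)).
Qed.

(** Caratheodory's form of the derivative. Together with its converse it turns the product rule, the
    chain rule and differentiation under an integral into statements on continuity. *)
Lemma C_der_slope (f g : C -> C) (z : C) :
  @locally C_UniformSpace z (fun w => f w - f z = (w - z) * g w) ->
  continuous (T := C_UniformSpace) g z ->
  is_derive (K := C_AbsRing) (V := C_NormedModule) f z (g z).
Proof.
move=> H /C_continuousP Hg; apply/C_derP => e e0.
apply: filter_imp (filter_and _ _ H (Hg _ e0)) => w [-> Hw].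
replace ((w - z) * g w - (w - z) * g z) with ((g w - g z) * (w - z)) by ring.
rewrite Cmod_mult; apply: Rmult_le_compat_r; [exact: Cmod_ge_0 | exact: Rlt_le].
Qed.

Lemma R_der_slope (f g : R -> C) (t : R) :
  locally t (fun u => f u - f t = RtoC (u - t) * g u) ->
  continuous g t ->
  @is_derive R_AbsRing C_R_NormedModule f t (g t).
Proof.
move=> H /C_continuousP Hg; apply/R_derP => e e0.
apply: filter_imp (filter_and _ _ H (Hg _ e0)) => u [-> Hu].
replace (RtoC (u - t) * g u - RtoC (u - t) * g t) with ((g u - g t) * RtoC (u - t)) by ring.
rewrite Cmod_mult Cmod_R; apply: Rmult_le_compat_r; [exact: Rabs_pos | exact: Rlt_le].
Qed.

Lemma C_subrK (a b : C) : a - b + b = a.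
Proof. by ring. Qed.

Lemma R_der_to_slope (f : R -> C) (t : R) (l : C) :
  @is_derive R_AbsRing C_R_NormedModule f t l ->
  exists g : R -> C, [/\ continuous g t, g t = l &
    forall u, f u - f t = RtoC (u - t) * g u].
Proof.
move=> /R_derP H.
pose g u := if Req_EM_T u t then l else (f u - f t) / RtoC (u - t).
have gt : g t = l by rewrite /g; destruct (Req_EM_T t t) => /=.
exists g; split => //.
- apply/C_continuousP => e e0.
  have e20 : (0 < e / 2)%R by lra.
  apply: filter_imp (H _ e20) => u Hu.
  rewrite gt /g; destruct (Req_EM_T u t) as [ut|ne] => /=.
    by rewrite /=; replace (l - l) with (RtoC 0) by ring; rewrite Cmod_0.
  have d0 : (u - t <> 0)%R by lra.
  have dC : RtoC (u - t) <> 0 by move/RtoC_inj.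
  replace ((f u - f t) / RtoC (u - t) - l)
    with ((f u - f t - RtoC (u - t) * l) / RtoC (u - t)) by (by field).
  rewrite Cmod_div // Cmod_R.
  have a0 := Rabs_pos_lt _ d0.
  apply: (Rmult_lt_reg_r (Rabs (u - t))) => //.
  by rewrite /Rdiv Rmult_assoc Rinv_l; nra.
move=> u; rewrite /g; destruct (Req_EM_T u t) as [->|ne] => /=; first by rewrite Rminus_diag; ring.
by field; move/RtoC_inj; lra.
Qed.

Lemma R_der_plus (f g : R -> C) (t : R) (a b : C) :
  @is_derive R_AbsRing C_R_NormedModule f t a ->
  @is_derive R_AbsRing C_R_NormedModule g t b ->
  @is_derive R_AbsRing C_R_NormedModule (fun u => f u + g u) t (a + b).
Proof. exact: (@is_derive_plus R_AbsRing C_R_NormedModule). Qed.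

Lemma R_der_mult (f g : R -> C) (t : R) (a b : C) :
  @is_derive R_AbsRing C_R_NormedModule f t a ->
  @is_derive R_AbsRing C_R_NormedModule g t b ->
  @is_derive R_AbsRing C_R_NormedModule (fun u => f u * g u) t (a * g t + f t * b).
Proof.
move=> /R_der_to_slope [p [pc <- Hp]] /R_der_to_slope [q [qc <- Hq]].
apply: (@R_der_slope _ (fun u => p u * g t + f u * q u)).
  apply: filter_imp filter_true => u _.
  have -> : f u * g u - f t * g t = (f u - f t) * g t + f u * (g u - g t) by ring.
  by rewrite Hp Hq; ring.
apply: C_cont_plus; apply: C_cont_mult => //; first exact: C_cont_const.
apply: (continuous_ext (fun u => RtoC (u - t) * p u + f t)) => [u|].
  by rewrite -Hp; exact: C_subrK.
apply: C_cont_plus; last exact: C_cont_const.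
apply: C_cont_mult => //; apply: C_cont_RtoC.
by apply: (@continuous_minus R_UniformSpace R_AbsRing R_NormedModule (fun u => u) (fun _ => t));
  [exact: continuous_id | exact: continuous_const].
Qed.

Lemma R_der_const (c : C) (t : R) : @is_derive R_AbsRing C_R_NormedModule (fun _ => c) t (RtoC 0).
Proof. exact: (@is_derive_const R_AbsRing C_R_NormedModule). Qed.

Lemma R_der_RtoC (f : R -> R) (t l : R) : is_derive f t l ->
  @is_derive R_AbsRing C_R_NormedModule (fun u => RtoC (f u)) t (RtoC l).
Proof.
move=> [_ H]; apply/R_derP => e e0.
have := H t (fun P HP => HP) (mkposreal e e0); apply: filter_imp => u /=.
by rewrite -RtoC_mult -!RtoC_minus Cmod_R.
Qed.

(** Only continuity is asked for at 0, because the derivatives in the scale [s] are given by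
    formulas that contain [/ s]. *)
Lemma R_der_zero_pos (f : R -> C) (b : R) : (0 < b)%R ->
  (forall t, (0 < t <= b)%R -> @is_derive R_AbsRing C_R_NormedModule f t (RtoC 0)) ->
  continuous f 0%R -> f b = f 0%R.
Proof.
move=> b0 H /C_continuousP Hc.
have K t : (0 < t < b)%R -> f t = f b.
  move=> Ht; apply: (@eq_is_derive C_R_NormedModule) => [u Hu|]; last lra.
  by apply: H; lra.
apply: NNPP => ne.
have /Cmod_gt_0 d0 := Cminus_eq_contra _ _ ne.
have [e He] := Hc _ d0.
have e0 := cond_pos e.
pose t := Rmin (b / 2) (e / 2).
have t0 : (0 < t)%R by apply: Rmin_glb_lt; lra.
have t1 : (t <= b / 2)%R by apply: Rmin_l.
have te : (t <= e / 2)%R by apply: Rmin_r.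
have : ball 0%R e t.
  by rewrite /ball /= /AbsRing_ball /abs /minus /plus /opp /= Ropp_0 Rplus_0_r Rabs_pos_eq; lra.
by move=> /He; rewrite K; [lra | lra].
Qed.

Lemma R_der_zero (f : R -> C) :
  (forall t, (0 < t <= 1)%R -> @is_derive R_AbsRing C_R_NormedModule f t (RtoC 0)) ->
  continuous f 0%R -> f 1%R = f 0%R.
Proof. by apply: R_der_zero_pos; lra. Qed.

(** * Iterated integrals *)

(** [Pint] at [s] evaluates its integrand at all [t * s], so the domains have to be closed under
    shrinking the scale. The space [X] carries the remaining parameters. *)
Definition star (X : UniformSpace) (O : X * R -> Prop) : Prop :=
  open O /\ forall x s t, O (x, s) -> (0 <= t <= 1)%R -> O (x, (t * s)%R).

Definition cont_on (X : UniformSpace) (O : X * R -> Prop) (g : X -> R -> C) : Prop :=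
  forall x s, O (x, s) -> continuous (fun p : X * R => g p.1 p.2) (x, s).

(** With [u = t * s], the product [s ^ r.+1 * Pint r g s] is the integral of [u ^ r * g u] over
    [0, s]. *)
Definition Pint (r : nat) (g : R -> C) (s : R) : C :=
  CInt (fun t => RtoC (t ^ r) * g (t * s)%R).

Lemma cont_pow (X : UniformSpace) (f : X -> R) (x : X) (r : nat) :
  continuous f x -> continuous (fun y => RtoC (f y ^ r)) x.
Proof.
move=> Hf; apply: (continuous_ext (fun y => Cpow (RtoC (f y)) r)) => [y|].
  by rewrite RtoC_pow.
exact/C_cont_pow/C_cont_RtoC.
Qed.

Section Star.
Variables (X : UniformSpace) (O : X * R -> Prop).
Hypothesis HO : star O.

Lemma cont_on_mult g h : cont_on O g -> cont_on O h -> cont_on O (fun x s => g x s * h x s).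
Proof. by move=> Hg Hh x s H; apply: C_cont_mult; [exact: Hg | exact: Hh]. Qed.

Lemma cont_on_plus g h : cont_on O g -> cont_on O h -> cont_on O (fun x s => g x s + h x s).
Proof. by move=> Hg Hh x s H; apply: C_cont_plus; [exact: Hg | exact: Hh]. Qed.

Lemma cont_on_slice g x s : cont_on O g -> O (x, s) -> continuous (g x) s.
Proof.
move=> Hg H.
apply: (@continuous_comp_2 _ _ _ _ (fun _ => x) (fun s => s) g).
- exact: continuous_const.
- exact: continuous_id.
- exact: Hg.
Qed.

Lemma Pint_integrand_cont r g x s t : cont_on O g -> O (x, s) -> (0 <= t <= 1)%R ->
  continuous (fun q : (X * R) * R => RtoC (q.2 ^ r) * g q.1.1 (q.2 * q.1.2)%R) ((x, s), t).
Proof.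
move=> Hg H Ht; apply: C_cont_mult; first exact/cont_pow/continuous_snd.
have Hf : continuous (fun q : (X * R) * R => q.1.1) ((x, s), t).
  by apply: (continuous_comp (fun q : (X * R) * R => q.1) fst); exact: continuous_fst.
have Hs : continuous (fun q : (X * R) * R => (q.2 * q.1.2)%R) ((x, s), t).
  apply: R_cont_mult; first exact: continuous_snd.
  by apply: (continuous_comp (fun q : (X * R) * R => q.1) snd);
    [exact: continuous_fst | exact: continuous_snd].
apply: (continuous_comp_2 _ _ (fun x s => g x s) _ Hf Hs) => /=.
by apply: Hg; apply: HO.2.
Qed.

Lemma ex_Pint r g x s : cont_on O g -> O (x, s) ->
  ex_CInt (fun t => RtoC (t ^ r) * g x (t * s)%R).
Proof.
move=> Hg H; apply: ex_CInt_cont => t Ht.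
apply: (@continuous_comp_2 _ _ _ _ (fun _ => (x, s)) (fun t => t)
  (fun p t => RtoC (t ^ r) * g p.1 (t * p.2)%R)).
- exact: continuous_const.
- exact: continuous_id.
- exact: Pint_integrand_cont.
Qed.

Lemma Pint_cont r g : cont_on O g -> cont_on O (fun x => Pint r (g x)).
Proof.
move=> Hg x s H.
apply: (@CInt_cont _ (fun (p : X * R) t => RtoC (t ^ r) * g p.1 (t * p.2)%R)).
  by move=> t Ht; apply: Pint_integrand_cont.
apply: filter_imp (HO.1 _ H) => -[x' s'] H'.
exact: (ex_Pint r Hg H').
Qed.

Lemma iter_Pint_cont r n g : cont_on O g -> cont_on O (fun x => iter n (Pint r) (g x)).
Proof. by move=> Hg; elim: n => [|n IH] //=; apply: Pint_cont. Qed.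

Lemma iter_Pint_ext r n (g h : R -> C) x : (forall s, O (x, s) -> g s = h s) ->
  forall s, O (x, s) -> iter n (Pint r) g s = iter n (Pint r) h s.
Proof.
move=> Hgh; elim: n => [|n IH] s H /=; first exact: Hgh.
by apply: CInt_ext => t Ht; rewrite IH //; apply: HO.2.
Qed.

Lemma iter_Pint_lin r n (c : C) (g h f : X -> R -> C) x :
  cont_on O g -> cont_on O h -> cont_on O f ->
  (forall s, O (x, s) -> g x s - h x s = c * f x s) ->
  forall s, O (x, s) ->
  iter n (Pint r) (g x) s - iter n (Pint r) (h x) s = c * iter n (Pint r) (f x) s.
Proof.
move=> Hg Hh Hf E; elim: n => [|n IH] s H /=; first exact: E.
have Hg' := ex_Pint r (iter_Pint_cont (r:=r) (n:=n) Hg) H.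
have Hh' := ex_Pint r (iter_Pint_cont (r:=r) (n:=n) Hh) H.
have Hf' := ex_Pint r (iter_Pint_cont (r:=r) (n:=n) Hf) H.
rewrite /Pint -CInt_minus // -CInt_mult //; apply: CInt_ext => t Ht.
transitivity (RtoC (t ^ r) * (iter n (Pint r) (g x) (t * s)%R - iter n (Pint r) (h x) (t * s)%R)).
  by rewrite -/(Pint r); ring.
by rewrite IH; [rewrite -/(Pint r); ring | exact: HO.2].
Qed.

Lemma iter_Pint0 r n (g : R -> C) x : (forall s, O (x, s) -> g s = 0) ->
  forall s, O (x, s) -> iter n (Pint r) g s = 0.
Proof.
move=> Hg; elim: n => [|n IH] s H /=; first exact: Hg.
rewrite /Pint (@CInt_ext _ (fun _ => 0)) ?CInt_const // => t Ht.
by rewrite IH; [ring | exact: HO.2].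
Qed.

End Star.

(* With kernels [w / (1 - s w)] this is, up to the factor [s ^ size l], the
   iterated integral of [Li]; the head of the list is the outermost integration. *)
Fixpoint MK (l : seq (nat * (R -> C))) : R -> C :=
  if l is q :: l' then iter q.1 (Pint (size l')) (fun s => q.2 s * MK l' s)
  else fun _ => 1.

(** The slope of [MK] when all kernels move at once. An entry holds kernels [f], [g] and a slope [h]
    with [f - g = c * h]; a difference of products is split as
    [(f - g) * MK_g + f * (MK_f - MK_g)]. *)
Fixpoint DK (l : seq (nat * ((R -> C) * (R -> C) * (R -> C)))) : R -> C :=
  if l is q :: l' then
    iter q.1 (Pint (size l'))
      (fun s => q.2.2 s * MK [seq (q.1, q.2.1.2) | q <- l'] s + q.2.1.1 s * DK l' s)
  else fun _ => 0.

Section Families.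
Variables (X : UniformSpace) (O : X * R -> Prop).
Hypothesis HO : star O.

Lemma MK_cont (T : Type) (e : T -> nat) (k : T -> X -> R -> C) (L : seq T) :
  List.Forall (fun q => cont_on O (k q)) L ->
  cont_on O (fun x => MK [seq (e q, k q x) | q <- L]).
Proof.
elim: L => [|q L IH] H /=; first by move=> x s _; apply: C_cont_const.
inversion H; subst => x s Hxs.
apply: (continuous_ext (fun p : X * R => iter (e q) (Pint (size L))
  (fun s => k q p.1 s * MK [seq (e q, k q p.1) | q <- L] s) p.2)) => [p|].
  by rewrite size_map.
apply: (iter_Pint_cont HO (g := fun x s => k q x s * MK [seq (e q, k q x) | q <- L] s)) => //.
by apply: cont_on_mult => //; apply: IH.
Qed.

Lemma DK_cont (L : seq (nat * ((X -> R -> C) * (X -> R -> C) * (X -> R -> C)))) :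
  List.Forall (fun q => [/\ cont_on O q.2.1.1, cont_on O q.2.1.2 & cont_on O q.2.2]) L ->
  cont_on O (fun x => DK [seq (q.1, (q.2.1.1 x, q.2.1.2 x, q.2.2 x)) | q <- L]).
Proof.
elim: L => [|q L IH] H /=; first by move=> x s _; apply: C_cont_const.
inversion H as [|q' L' [H1 H2 H3] HL]; subst => x s Hxs.
apply: (continuous_ext (fun p : X * R => iter q.1 (Pint (size L)) (fun s => q.2.2 p.1 s *
   MK [seq (q.1, q.2.1.2) | q <- [seq (q.1, (q.2.1.1 p.1, q.2.1.2 p.1, q.2.2 p.1)) | q <- L]] s
   + q.2.1.1 p.1 s * DK [seq (q.1, (q.2.1.1 p.1, q.2.1.2 p.1, q.2.2 p.1)) | q <- L] s) p.2)) => [p|].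
  by rewrite size_map.
apply: (iter_Pint_cont HO (g := fun x s => q.2.2 x s *
   MK [seq (q.1, q.2.1.2) | q <- [seq (q.1, (q.2.1.1 x, q.2.1.2 x, q.2.2 x)) | q <- L]] s
   + q.2.1.1 x s * DK [seq (q.1, (q.2.1.1 x, q.2.1.2 x, q.2.2 x)) | q <- L] s)) => // {x s Hxs}.
apply: cont_on_plus; apply: cont_on_mult => //; last exact: IH.
move=> x s Hxs.
apply: (continuous_ext (fun p : X * R => MK [seq (q.1, q.2.1.2 p.1) | q <- L] p.2)).
  by move=> p; rewrite -!map_comp.
apply: (MK_cont (k := fun q => q.2.1.2)) Hxs.
by apply: List.Forall_impl HL => ? [].
Qed.

Lemma MK_sub (L : seq (nat * ((X -> R -> C) * (X -> R -> C) * (X -> R -> C)))) (c : C) x :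
  List.Forall (fun q => [/\ cont_on O q.2.1.1, cont_on O q.2.1.2 & cont_on O q.2.2]) L ->
  List.Forall (fun q => forall s, O (x, s) ->
     q.2.1.1 x s - q.2.1.2 x s = c * q.2.2 x s) L ->
  forall s, O (x, s) ->
  MK [seq (q.1, q.2.1.1 x) | q <- L] s - MK [seq (q.1, q.2.1.2 x) | q <- L] s
   = c * DK [seq (q.1, (q.2.1.1 x, q.2.1.2 x, q.2.2 x)) | q <- L] s.
Proof.
elim: L => [|q L IH] HC HE s H /=; first by ring.
rewrite !size_map.
inversion HC as [|? ? [c1 c2 c3] HC']; inversion HE as [|? ? E HE']; subst.
have C1 : cont_on O (fun x => MK [seq (q.1, q.2.1.1 x) | q <- L]).
  by apply: (MK_cont (k := fun q => q.2.1.1)); apply: List.Forall_impl HC' => ? [].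
have C2 : cont_on O (fun x => MK [seq (q.1, q.2.1.2 x) | q <- L]).
  by apply: (MK_cont (k := fun q => q.2.1.2)); apply: List.Forall_impl HC' => ? [].
have C3 := DK_cont HC'.
have -> : [seq (q.1, q.2.1.2) | q <- [seq (q.1, (q.2.1.1 x, q.2.1.2 x, q.2.2 x)) | q <- L]]
  = [seq (q.1, q.2.1.2 x) | q <- L] by rewrite -map_comp.
apply: (@iter_Pint_lin X O HO (size L) q.1 c
  (fun x s => q.2.1.1 x s * MK [seq (q.1, q.2.1.1 x) | q <- L] s)
  (fun x s => q.2.1.2 x s * MK [seq (q.1, q.2.1.2 x) | q <- L] s)
  (fun x s => q.2.2 x s * MK [seq (q.1, q.2.1.2 x) | q <- L] s
     + q.2.1.1 x s * DK [seq (q.1, (q.2.1.1 x, q.2.1.2 x, q.2.2 x)) | q <- L] s)) => //.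
- exact: cont_on_mult.
- exact: cont_on_mult.
- by apply: cont_on_plus; apply: cont_on_mult.
move=> t Ht.
transitivity ((q.2.1.1 x t - q.2.1.2 x t) * MK [seq (q.1, q.2.1.2 x) | q <- L] t
  + q.2.1.1 x t * (MK [seq (q.1, q.2.1.1 x) | q <- L] t - MK [seq (q.1, q.2.1.2 x) | q <- L] t)).
  by ring.
by rewrite E // (IH HC' HE') //; ring.
Qed.

End Families.

Definition kw (w : C) (s : R) : C := w / (1 - RtoC s * w).

(** The pole of the kernel [kw w] stays off the segment from 0 to [s]; for [s = 1] this says that
    [w] is not in [1, oo). *)
Definition slit_on (s : R) (w : C) : Prop :=
  forall t, (0 <= t <= 1)%R -> 1 - RtoC (t * s) * w <> 0.

Definition slit (w : C) : Prop := slit_on 1 w.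

Definition kdom (X : UniformSpace) (V : X -> Prop) (ws : seq (X -> C)) : X * R -> Prop :=
  fun p => V p.1 /\ List.Forall (fun w => slit_on p.2 (w p.1)) ws.

Lemma cont_near0 (X : UniformSpace) (f : X -> C) x : continuous f x -> f x <> 0 ->
  locally x (fun y => f y <> 0).
Proof.
move=> /C_continuousP Hf /Cmod_gt_0 f0.
apply: filter_imp (Hf _ f0) => y Hy E; move: Hy; rewrite E.
by replace (0 - f x) with (- f x) by ring; rewrite Cmod_opp; lra.
Qed.

(** Each slit condition quantifies over a compact interval, so by [tube] it is an open condition on
    the parameter and the scale. *)
Lemma kdom_star (X : UniformSpace) (V : X -> Prop) (ws : seq (X -> C)) :
  open V -> List.Forall (fun w => forall x, V x -> continuous w x) ws ->
  star (kdom V ws).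
Proof.
move=> HV Hws; split; last first.
  move=> x s t [/= Vx Hs] Ht; split => //=; apply: List.Forall_impl Hs => w Hw t' Ht'.
  by rewrite -Rmult_assoc; apply: Hw; nra.
move=> [x s] [/= Vx Hs].
apply: filter_and.
  have [e He] := HV x Vx; exists e => y [Hy _]; exact: He.
elim: ws Hws Hs => [|w ws IH] Hws Hs; first by apply: filter_imp filter_true => y _; constructor.
inversion Hws as [|? ? Hw Hws']; inversion Hs as [|? ? Sw Hs']; subst.
have H1 : locally (x, s) (fun p : X * R => slit_on p.2 (w p.1)).
  apply: (tube (Q := fun p t => 1 - RtoC (t * p.2) * w p.1 <> 0)) => t Ht.
  apply: cont_near0; last exact: Sw.
  apply: C_cont_minus; first exact: C_cont_const.
  apply: C_cont_mult.
    apply: C_cont_RtoC; apply: R_cont_mult; first exact: continuous_snd.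
    by apply: (continuous_comp (fun q : (X * R) * R => q.1) snd);
      [exact: continuous_fst | exact: continuous_snd].
  apply: (continuous_comp (fun q : (X * R) * R => q.1.1) w); last exact: Hw.
  by apply: (continuous_comp (fun q : (X * R) * R => q.1) fst); exact: continuous_fst.
by apply: filter_imp (filter_and _ _ H1 (IH Hws' Hs')) => p [? ?]; constructor.
Qed.

Lemma kdom_den_cont (X : UniformSpace) (V : X -> Prop) (ws : seq (X -> C)) w :
  List.Forall (fun w => forall x, V x -> continuous w x) ws -> List.In w ws ->
  cont_on (kdom V ws) (fun x s => / (1 - RtoC s * w x)).
Proof.
move=> Hws /[dup] wi /(proj1 (List.Forall_forall _ _) Hws) Hw x s [/= Vx Hs].
have Sw := proj1 (List.Forall_forall _ _) Hs w wi.
apply: C_cont_inv => /=.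
  apply: C_cont_minus; first exact: C_cont_const.
  apply: C_cont_mult; first exact/C_cont_RtoC/continuous_snd.
  by apply: (continuous_comp fst w); [exact: continuous_fst | exact: Hw].
by have := Sw 1%R ltac:(lra); rewrite Rmult_1_l.
Qed.

Lemma kdom_cont (X : UniformSpace) (V : X -> Prop) (ws : seq (X -> C)) (w : X -> C) :
  (forall x, V x -> continuous w x) -> cont_on (kdom V ws) (fun x _ => w x).
Proof.
move=> Hw x s [/= Vx _].
by apply: (continuous_comp fst w); [exact: continuous_fst | exact: Hw].
Qed.

Definition kers (L : seq (nat * C)) : seq (nat * (R -> C)) := [seq (q.1, kw q.2) | q <- L].

(** For small arguments [w_i] this is the sum over [k_1 > ... > k_r > 0] of [s ^ k_1 * w_1 ^ (k_1 -
    k_2) * ... * w_r ^ k_r], divided by the product of the [k_i ^ n_i]. Indices 0 are allowed. The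
    comments on [lam] below refer to this series. *)
Definition lam (L : seq (nat * C)) (s : R) : C := RtoC (s ^ size L) * MK (kers L) s.

Definition evw (X : Type) (L : seq (nat * (X -> C))) (x : X) : seq (nat * C) :=
  [seq (q.1, q.2 x) | q <- L].

Lemma kw_cont (X : UniformSpace) (V : X -> Prop) (ws : seq (X -> C)) w :
  List.Forall (fun w => forall x, V x -> continuous w x) ws -> List.In w ws ->
  cont_on (kdom V ws) (fun x s => kw (w x) s).
Proof.
move=> Hws wi; apply: cont_on_mult; last exact: kdom_den_cont.
apply: kdom_cont => x Vx.
exact: (proj1 (List.Forall_forall _ _) Hws w wi).
Qed.

Lemma lam_cont (X : UniformSpace) (V : X -> Prop) (L : seq (nat * (X -> C))) :
  open V -> (forall q, List.In q L -> forall x, V x -> continuous q.2 x) ->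
  cont_on (kdom V [seq q.2 | q <- L]) (fun x => lam (evw L x)).
Proof.
move=> HV HL.
have Hws : List.Forall (fun w => forall x, V x -> continuous w x) [seq q.2 | q <- L].
  by apply/List.Forall_forall => w /List.in_map_iff [q [<- Hq]]; apply: HL.
have HO := kdom_star HV Hws.
rewrite /lam; apply: cont_on_mult.
  move=> x s _; apply: (continuous_ext (fun p : X * R => RtoC (p.2 ^ size L))) => [p|].
    by rewrite /evw size_map.
  exact/cont_pow/continuous_snd.
move=> x s H.
apply: (continuous_ext (fun p : X * R => MK [seq (q.1, kw (q.2 p.1)) | q <- L] p.2)).
  by move=> p; rewrite /kers /evw -!map_comp.
apply: (MK_cont HO (k := fun q x => kw (q.2 x))) H.
apply/List.Forall_forall => q Hq /=.
apply: kw_cont => //.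
exact: List.in_map.
Qed.

(** The parameter is a dummy: it makes the results on families available for a single list of
    kernels. *)
Definition cdom (ws : seq C) : R * R -> Prop :=
  @kdom R_UniformSpace (fun _ => True) [seq (fun _ => w) | w <- ws].

Definition ok (s : R) (L : seq (nat * C)) : Prop := List.Forall (fun q => slit_on s q.2) L.

Lemma cdomP (ws : seq C) x s : cdom ws (x, s) <-> List.Forall (slit_on s) ws.
Proof.
rewrite /cdom /kdom /=; elim: ws => [|w ws IH] /=; first by split=> // _; split.
split=> [[_ H]|H]; inversion H; subst.
  by constructor => //; apply/IH.
by split=> //; constructor => //; apply (IH.2 H3).2.
Qed.

Lemma cdom_consts (ws : seq C) :
  List.Forall (fun w : R -> C => forall x : R_UniformSpace, True -> continuous w x)
    [seq (fun _ => w) | w <- ws].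
Proof. by elim: ws => [|w ws IH] /=; constructor => // x _; apply: C_cont_const. Qed.

Lemma cdom_star ws : star (cdom ws).
Proof. by apply: kdom_star; [exact: open_true | exact: cdom_consts]. Qed.

Lemma cdom_den ws w : List.In w ws -> cont_on (cdom ws) (fun _ s => / (1 - RtoC s * w)).
Proof.
move=> H; apply: (@kdom_den_cont _ _ _ (fun _ => w)); first exact: cdom_consts.
by elim: ws H => [|v ws IH] //= [->|/IH]; [left | right].
Qed.

Lemma cont_on_const (X : UniformSpace) (O : X * R -> Prop) (c : C) : cont_on O (fun _ _ => c).
Proof. by move=> x s _; apply: C_cont_const. Qed.

Lemma cdom_kw ws w : List.In w ws -> cont_on (cdom ws) (fun _ => kw w).
Proof. by move=> H; apply: cont_on_mult; [exact: cont_on_const | exact: cdom_den]. Qed.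

Lemma cdom_MK ws L : (forall q, List.In q L -> List.In q.2 ws) ->
  cont_on (cdom ws) (fun _ => MK (kers L)).
Proof.
move=> H; apply: (MK_cont (cdom_star ws) (e := fun q : nat * C => q.1) (k := fun q _ => kw q.2)).
by apply/List.Forall_forall => q Hq; apply/cdom_kw/H.
Qed.

Lemma ok_cdom s L x : ok s L <-> cdom [seq q.2 | q <- L] (x, s).
Proof.
rewrite cdomP /ok; elim: L => [|q L IH] /=; first by split; constructor.
by split=> H; inversion H; constructor => //; apply/IH.
Qed.

Lemma slit_scale s t w : slit_on s w -> (0 <= t <= 1)%R -> slit_on (t * s) w.
Proof. by move=> H Ht u Hu; rewrite -Rmult_assoc; apply: H; nra. Qed.

Lemma slit_den s w : slit_on s w -> 1 - RtoC s * w <> 0.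
Proof. by move=> H; have := H 1%R ltac:(lra); rewrite Rmult_1_l. Qed.

Lemma ok_scale s t L : ok s L -> (0 <= t <= 1)%R -> ok (t * s) L.
Proof. by move=> H Ht; apply: List.Forall_impl H => q Hq; apply: slit_scale. Qed.

Lemma lam0 w l s : lam ((0%nat, w) :: l) s = RtoC s * kw w s * lam l s.
Proof. by rewrite /lam /= RtoC_mult; ring. Qed.

Lemma lam_at0 q l : lam (q :: l) 0 = 0.
Proof. by rewrite /lam /= Rmult_0_l; ring. Qed.

Lemma lam_head0 n l s : ok s l -> lam ((n, RtoC 0) :: l) s = 0.
Proof.
move=> H; rewrite /lam /=.
rewrite (@iter_Pint0 _ _ (cdom_star [seq q.2 | q <- l]) _ _ _ 0%R) //; first by ring.
  by move=> u _; rewrite /kw /Cdiv; ring.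
exact/ok_cdom.
Qed.

Lemma Pint_derive (X : UniformSpace) (O : X * R -> Prop) (g : X -> R -> C) x s r :
  star O -> cont_on O g -> O (x, s) -> (0 < s)%R ->
  @is_derive R_AbsRing C_R_NormedModule (fun u => RtoC (u ^ r.+1) * Pint r (g x) u) s
    (RtoC (s ^ r) * g x s).
Proof.
move=> HO Hg Hs s0.
pose f u := RtoC (u ^ r) * g x u.
have fc u : O (x, u) -> continuous f u.
  move=> Hu; apply: C_cont_mult; first by apply: (@cont_pow R_UniformSpace id); apply: continuous_id.
  exact: cont_on_slice Hg Hu.
have ex u : O (x, u) -> (0 < u)%R -> @ex_RInt C_R_CompleteNormedModule f 0 u.
  move=> Hu u0; apply: (@ex_RInt_continuous C_R_CompleteNormedModule) => v.
  rewrite Rmin_left; last lra. rewrite Rmax_right; last lra.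
  move=> Hv; apply: fc; replace v with ((v / u) * u)%R by (field; lra).
  apply: HO.2 Hu _; split; first by apply: Rdiv_le_0_compat; lra.
  by apply/(Rmult_le_reg_r u) => //; rewrite /Rdiv Rmult_assoc Rinv_l; lra.
have nbh : locally s (fun u => O (x, u) /\ (0 < u)%R).
  have [e He] := HO.1 _ Hs.
  have /= := filter_and (F := locally s) _ _ _ (locally_open _ _ (open_gt 0%R) (fun _ H => H) s s0).
  apply; exists e => u Hu; apply: He; split => //; exact: ball_center.
have E u : O (x, u) -> (0 < u)%R ->
    @RInt C_R_CompleteNormedModule f 0 u = RtoC (u ^ r.+1) * Pint r (g x) u.
  move=> Hu u0.
  have := @RInt_comp_lin C_R_CompleteNormedModule f u 0 0 1.
  rewrite Rmult_0_r Rmult_1_r !Rplus_0_r => <-; last exact: ex.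
  rewrite /Pint -CInt_mult; last exact: (@ex_Pint X O HO).
  apply: CInt_ext => t Ht.
  by rewrite /f scal_R_Cmult Rplus_0_r Rpow_mult_distr /= !RtoC_mult (Rmult_comm u t); ring.
apply: (is_derive_ext_loc (fun u => @RInt C_R_CompleteNormedModule f 0 u)).
  by apply: filter_imp nbh => u [? ?]; apply: E.
apply: (@is_derive_RInt C_R_NormedModule f _ 0 s); last exact: fc.
apply: filter_imp nbh => u [Hu u0].
exact: (@RInt_correct C_R_CompleteNormedModule) (ex _ Hu u0).
Qed.

(** On the series, [s d/ds] multiplies a summand by the outermost index [k_1]. *)
Lemma lam_derive n w l s : ok s ((n.+1, w) :: l) -> (0 < s)%R ->
  @is_derive R_AbsRing C_R_NormedModule (lam ((n.+1, w) :: l)) s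
    (lam ((n, w) :: l) s / RtoC s).
Proof.
move=> H s0.
have HO := cdom_star [seq q.2 | q <- (n.+1, w) :: l].
have /(ok_cdom _ _ 0%R) H' := H.
have := @Pint_derive _ _ (fun _ => iter n (Pint (size l)) (fun s => kw w s * MK (kers l) s)) 0%R s (size l)
  HO _ H' s0.
have -> : RtoC (s ^ size l) * iter n (Pint (size l)) (fun s => kw w s * MK (kers l) s) s
    = lam ((n, w) :: l) s / RtoC s.
  have sn : RtoC s <> 0 by move/RtoC_inj; lra.
  rewrite /lam /kers /= -/(kers l) size_map !RtoC_mult; field => //.
move=> K; apply: (is_derive_ext _ _ _ _ _ (K _)) => [u|].
  by rewrite /lam /kers /= size_map.
apply: (iter_Pint_cont HO (g := fun _ s => kw w s * MK (kers l) s)).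
apply: cont_on_mult; first by apply: cdom_kw; left.
by apply: cdom_MK => q Hq; right; apply: List.in_map.
Qed.

Lemma iter_Pint_scal (X : UniformSpace) (O : X * R -> Prop) (r n : nat) (c : C) (f g : X -> R -> C) x :
  star O -> cont_on O f -> cont_on O g -> (forall s, O (x, s) -> g x s = c * f x s) ->
  forall s, O (x, s) -> iter n (Pint r) (g x) s = c * iter n (Pint r) (f x) s.
Proof.
move=> HO Hf Hg E s Hs.
have := @iter_Pint_lin X O HO r n c g (fun _ _ => 0) f x Hg (@cont_on_const X O 0) Hf _ s Hs.
rewrite (@iter_Pint0 X O HO r n (fun _ => 0) x) // => <-; first by ring.
by move=> u /E ->; ring.
Qed.

Lemma iter_Pint_dil r n (g : R -> C) (c s : R) :
  iter n (Pint r) (fun u => g (c * u)%R) s = iter n (Pint r) g (c * s)%R.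
Proof.
elim: n s => [|n IH] s //=; apply: CInt_ext => t _; rewrite IH.
by congr (_ * iter n (Pint r) g _); ring.
Qed.

(** The exponents [k_1 - k_2, ..., k_r] of the arguments add up to [k_1], the exponent of the
    scale. *)
Lemma lam_dil (L : seq (nat * C)) (c s : R) : ok s [seq (q.1, RtoC c * q.2) | q <- L] ->
  lam [seq (q.1, RtoC c * q.2) | q <- L] s = lam L (c * s).
Proof.
move=> H; rewrite /lam size_map Rpow_mult_distr RtoC_mult.
suff -> : MK (kers [seq (q.1, RtoC c * q.2) | q <- L]) s = RtoC (c ^ size L) * MK (kers L) (c * s).
  by ring.
elim: L s H => [|q L IH] s H /=; first by ring.
inversion H as [|? ? Hq HL]; subst.
rewrite !size_map -iter_Pint_dil.
set ws := [seq q.2 | q <- [seq (q.1, RtoC c * q.2) | q <- q :: L]].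
have HO := cdom_star ws.
have Hk : cont_on (cdom ws) (fun _ => MK (kers [seq (q.1, RtoC c * q.2) | q <- L])).
  by apply: cdom_MK => p Hp; right; apply: List.in_map.
have Hw : cont_on (cdom ws) (fun _ => kw (RtoC c * q.2)) by apply: cdom_kw; left.
have kwE u : kw (RtoC c * q.2) u = RtoC c * kw q.2 (c * u)%R.
  by rewrite /kw RtoC_mult /Cdiv (Cmult_comm (RtoC u)) -Cmult_assoc;
     replace (RtoC c * q.2 * RtoC u) with (RtoC c * RtoC u * q.2) by ring; ring.
(* For nonzero [c] the continuity of the dilated integrand on [cdom ws] is read off from the
   identity [E] below, divided by a power of [c]; so [c = 0] is treated apart. *)
have [c0|c0] := Req_dec c 0.
  rewrite (@iter_Pint0 _ _ HO _ _ _ 0%R); last exact/ok_cdom.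
    by rewrite c0 /= Rmult_0_l; ring.
  by move=> u _; rewrite kwE c0; ring.
have cn : RtoC c <> 0 by move/RtoC_inj.
have pn : RtoC (c * c ^ size L) <> 0.
  by move/RtoC_inj => /Rmult_integral [] // H'; apply: (pow_nonzero c (size L)).
have E : forall u, cdom ws (0%R, u) -> kw (RtoC c * q.2) u * MK (kers [seq (q.1, RtoC c * q.2) | q <- L]) u
   = RtoC (c * c ^ size L) * (kw q.2 (c * u)%R * MK (kers L) (c * u)).
  move=> u /ok_cdom Hu; inversion Hu; subst.
  by rewrite IH // kwE RtoC_mult; ring.
apply: (@iter_Pint_scal _ _ _ _ _ (fun _ u => kw q.2 (c * u)%R * MK (kers L) (c * u))
  (fun _ u => kw (RtoC c * q.2) u * MK (kers [seq (q.1, RtoC c * q.2) | q <- L]) u) 0%R HO) => //.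
- move=> x u Hu.
  apply: (continuous_ext_loc _ (fun p : R * R => / RtoC (c * c ^ size L) *
    (kw (RtoC c * q.2) p.2 * MK (kers [seq (q.1, RtoC c * q.2) | q <- L]) p.2))).
    apply: filter_imp (HO.1 _ Hu) => -[y v] Hv /=.
    rewrite E; last exact/cdomP/(cdomP _ y v).
    rewrite Cmult_assoc Cinv_l //; ring.
  apply: C_cont_mult; first exact: C_cont_const.
  exact: (cont_on_mult Hw Hk).
- exact: cont_on_mult.
- exact/ok_cdom.
Qed.

(** * Dependence on the innermost argument *)

Definition npos (w : C) : Prop := ~ exists x : R, (0 <= x)%R /\ w = RtoC x.

Lemma npos_slit w s : npos w -> (0 <= s)%R -> slit_on s w.
Proof.
move=> Hw s0 t Ht E; apply: Hw; exists (/ (t * s))%R.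
have ts : (t * s <> 0)%R.
  by move=> H; move: E; rewrite H; replace (1 - RtoC 0 * w) with (RtoC 1) by ring; exact: C1_nz.
have tsC : RtoC (t * s) <> 0 by move/RtoC_inj.
have ts0 : (0 < t * s)%R by nra.
split; first exact/Rlt_le/Rinv_0_lt_compat.
rewrite RtoC_inv //.
have -> : w = (1 - (1 - RtoC (t * s) * w)) * / RtoC (t * s) by field.
by rewrite E; ring.
Qed.

Lemma npos_neq0 w : npos w -> w <> 0.
Proof. by move=> H E; apply: H; exists 0%R; split; [lra | ]. Qed.

Lemma npos_scale w c : npos w -> (0 < c)%R -> npos (RtoC c * w).
Proof.
move=> Hw c0 [x [x0 E]]; apply: Hw; exists (x / c)%R.
have cn : RtoC c <> 0 by move/RtoC_inj; lra.
split; first exact: Rdiv_le_0_compat.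
by rewrite RtoC_div ?RtoC_inj -?E; [field | lra].
Qed.

Lemma npos_inv w : npos w -> npos (/ w).
Proof.
move=> Hw [x [x0 E]]; have w0 := npos_neq0 Hw; apply: Hw.
have xn : x <> 0%R.
  by move=> H; apply: C1_nz; rewrite -(Cinv_r w) // E H; ring.
exists (/ x)%R; split; first by apply/Rlt_le/Rinv_0_lt_compat; lra.
by rewrite RtoC_inv // -E; field.
Qed.

Section Suffix.
Variables (O : R * R -> Prop) (x : R).
Hypothesis HO : star O.
Notation cst f := (cont_on O (fun _ => f)).

Lemma MK_app_cont (A l : seq (nat * (R -> C))) :
  List.Forall (fun q => cst q.2) A -> cst (MK l) -> cst (MK (A ++ l)).
Proof.
move=> HA Hl; elim: A HA => [|q A IH] HA //=; inversion HA; subst.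
apply: (iter_Pint_cont HO (g := fun _ s => q.2 s * MK (A ++ l) s)).
by apply: cont_on_mult => //; apply: IH.
Qed.

(** The weight [t ^ r.+1] times [s] is [t ^ r] times the scale [t * s] of the integrand. In this way
    an identity between lists of different lengths passes through the outer integrations. *)
Lemma iter_Pint_shift r n (f g h : R -> C) c1 c2 : cst f -> cst g -> cst h ->
  (forall s, O (x, s) -> RtoC s * f s = c1 * g s + c2 * h s) ->
  forall s, O (x, s) -> RtoC s * iter n (Pint r.+1) f s
    = c1 * iter n (Pint r) g s + c2 * iter n (Pint r) h s.
Proof.
move=> Hf Hg Hh E; elim: n => [|n IH] s Hs /=; first exact: E.
have ef := ex_Pint HO r.+1 (iter_Pint_cont HO (r := r.+1) (n := n) Hf) Hs.
have eg := ex_Pint HO r (iter_Pint_cont HO (r := r) (n := n) Hg) Hs.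
have eh := ex_Pint HO r (iter_Pint_cont HO (r := r) (n := n) Hh) Hs.
have ec c u : ex_CInt u -> ex_CInt (fun t => c * u t).
  move=> /CInt_correct Hu; exists (c * CInt u).
  have H1 := is_RInt_fct_extend_fst _ _ _ _ Hu.
  have H2 := is_RInt_fct_extend_snd _ _ _ _ Hu.
  apply: is_RInt_fct_extend_pair => /=.
    exact: (is_RInt_minus _ _ _ _ _ _ (is_RInt_scal _ _ _ c.1 _ H1) (is_RInt_scal _ _ _ c.2 _ H2)).
  exact: (is_RInt_plus _ _ _ _ _ _ (is_RInt_scal _ _ _ c.1 _ H2) (is_RInt_scal _ _ _ c.2 _ H1)).
rewrite /Pint -!CInt_mult //= -CInt_plus; [|exact: ec|exact: ec].
apply: CInt_ext => t Ht.
transitivity (RtoC (t ^ r) * (RtoC (t * s) * iter n (Pint r.+1) f (t * s)%R)).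
  by rewrite -/(Pint r.+1) !RtoC_mult; ring.
by rewrite IH; [rewrite -/(Pint r); ring | exact: HO.2].
Qed.

Lemma MK_suffix_shift (A l1 l2 l3 : seq (nat * (R -> C))) c1 c2 :
  List.Forall (fun q => cst q.2) A -> cst (MK l1) -> cst (MK l2) -> cst (MK l3) ->
  size l1 = (size l2).+1 -> size l3 = size l2 ->
  (forall s, O (x, s) -> RtoC s * MK l1 s = c1 * MK l2 s + c2 * MK l3 s) ->
  forall s, O (x, s) ->
    RtoC s * MK (A ++ l1) s = c1 * MK (A ++ l2) s + c2 * MK (A ++ l3) s.
Proof.
move=> HA H1 H2 H3 s1 s3 E; elim: A HA => [|q A IH] HA //=; inversion HA; subst.
rewrite !size_cat s1 s3 addnS.
apply: iter_Pint_shift; try by apply: cont_on_mult => //; apply: MK_app_cont.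
move=> s Hs; have -> : forall a b c : C, a * (b * c) = b * (a * c) by move=> *; ring.
by rewrite IH //; ring.
Qed.

Lemma MK_suffix_lin (A l1 l2 l3 : seq (nat * (R -> C))) c :
  List.Forall (fun q => cst q.2) A -> cst (MK l1) -> cst (MK l2) -> cst (MK l3) ->
  size l1 = size l3 -> size l2 = size l3 ->
  (forall s, O (x, s) -> MK l1 s - MK l2 s = c * MK l3 s) ->
  forall s, O (x, s) -> MK (A ++ l1) s - MK (A ++ l2) s = c * MK (A ++ l3) s.
Proof.
move=> HA H1 H2 H3 s1 s2 E; elim: A HA => [|q A IH] HA //=; inversion HA; subst.
rewrite !size_cat s1 s2.
apply: (@iter_Pint_lin _ O HO (size A + size l3) q.1 c (fun _ s => q.2 s * MK (A ++ l1) s)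
  (fun _ s => q.2 s * MK (A ++ l2) s) (fun _ s => q.2 s * MK (A ++ l3) s) x);
  try by apply: cont_on_mult => //; apply: MK_app_cont.
move=> s Hs; have -> : forall a b c : C, a * b - a * c = a * (b - c) by move=> *; ring.
by rewrite IH //; ring.
Qed.

End Suffix.

Lemma kers_cont ws (L : seq (nat * C)) : (forall q, List.In q L -> List.In q.2 ws) ->
  List.Forall (fun q => cont_on (cdom ws) (fun _ => q.2)) (kers L).
Proof.
move=> H; apply/List.Forall_forall => q /List.in_map_iff [p [<- Hp]] /=.
exact/cdom_kw/H.
Qed.

(** With index 0 the innermost variable [j] carries a finite geometric sum: for [0 < j < k], the
    terms [w' ^ (k - j) * w ^ j] add up to [(w' * w ^ k - w * w' ^ k) / (w - w')]. On kernels this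
    is a partial fraction decomposition. *)
Lemma lam_inner0 (A : seq (nat * C)) n w' w s :
  ok s (A ++ [:: (n, w'); (0%nat, w)]) ->
  (w - w') * lam (A ++ [:: (n, w'); (0%nat, w)]) s
    = w' * lam (A ++ [:: (n, w)]) s - w * lam (A ++ [:: (n, w')]) s.
Proof.
move=> H.
set ws := [seq q.2 | q <- A ++ [:: (n, w'); (0%nat, w)]].
have HO := cdom_star ws.
have inA q : List.In q A -> List.In q.2 ws.
  by move=> Hq; apply: List.in_map; apply: List.in_or_app; left.
have inw : List.In w ws.
  by apply: (List.in_map snd _ (0%nat, w)); apply: List.in_or_app; right; right; left.
have inw' : List.In w' ws.
  by apply: (List.in_map snd _ (n, w')); apply: List.in_or_app; right; left.
have cK l : (forall q, List.In q l -> List.In q.2 ws) -> cont_on (cdom ws) (fun _ => MK (kers l)).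
  exact: cdom_MK.
rewrite /lam /kers !map_cat !size_cat /= !addnS addn0 -/(kers A).
have E := @MK_suffix_shift (cdom ws) 0%R HO (kers A) [:: (n, kw w'); (0%nat, kw w)]
   [:: (n, kw w)] [:: (n, kw w')] (w' / (w - w')) (- w / (w - w')) (kers_cont inA)
   (cK [:: (n, w'); (0%nat, w)] _) (cK [:: (n, w)] _) (cK [:: (n, w')] _) erefl erefl _ s _.
have [e|ne] := Ceq_dec w w'.
  by rewrite e; ring.
have dn : w - w' <> 0 by apply: Cminus_eq_contra.
have {}E : RtoC s * MK (kers A ++ [:: (n, kw w'); (0%nat, kw w)]) s =
  w' / (w - w') * MK (kers A ++ [:: (n, kw w)]) s + - w / (w - w') * MK (kers A ++ [:: (n, kw w')]) s.
  apply: E.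
  - by move=> q [<-|[<-|[]]].
  - by move=> q [<-|[]].
  - by move=> q [<-|[]].
  - move=> u Hu /=.
    apply: (iter_Pint_shift (O := cdom ws) (x := 0%R) HO) Hu;
      try by apply: cont_on_mult; [exact: cdom_kw | exact: cont_on_const].
      by apply: cont_on_mult; [exact: cdom_kw | apply: cont_on_mult; [exact: cdom_kw | exact: cont_on_const]].
    move=> v /cdomP /List.Forall_forall Hv.
    have := slit_den (Hv w inw); have := slit_den (Hv w' inw').
    by rewrite /kw => d1 d2; field.
  - exact/ok_cdom.
transitivity ((w - w') * RtoC (s ^ (size A).+1) * (RtoC s * MK (kers A ++ [:: (n, kw w'); (0%nat, kw w)]) s)).
  by rewrite [in LHS]/= !RtoC_mult; ring.
by rewrite E; field.
Qed.

(** The slope in the innermost argument: the last kernel is replaced by [(kw w - kw w0) / (w - w0)],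
    written without the denominator. *)
Definition lam_slope (A : seq (nat * C)) (m : nat) (w w0 : C) (s : R) : C :=
  RtoC (s ^ (size A).+1) *
  MK (kers A ++ [:: (m, fun s => / (1 - RtoC s * w) * / (1 - RtoC s * w0))]) s.

Lemma lam_slopeP (A : seq (nat * C)) m w w0 s :
  ok s (A ++ [:: (m, w); (m, w0)]) ->
  lam (A ++ [:: (m, w)]) s - lam (A ++ [:: (m, w0)]) s = (w - w0) * lam_slope A m w w0 s.
Proof.
move=> H.
set ws := [seq q.2 | q <- A ++ [:: (m, w); (m, w0)]].
have HO := cdom_star ws.
have inA q : List.In q A -> List.In q.2 ws.
  by move=> Hq; apply: List.in_map; apply: List.in_or_app; left.
have inw : List.In w ws.
  by apply: (List.in_map snd _ (m, w)); apply: List.in_or_app; right; left.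
have inw0 : List.In w0 ws.
  by apply: (List.in_map snd _ (m, w0)); apply: List.in_or_app; right; right; left.
have cs : cont_on (cdom ws) (fun _ s => / (1 - RtoC s * w) * / (1 - RtoC s * w0)).
  by apply: cont_on_mult; exact: cdom_den.
rewrite /lam_slope /lam /kers !map_cat !size_cat /= addn1 -/(kers A).
have E := @MK_suffix_lin (cdom ws) 0%R HO (kers A) [:: (m, kw w)] [:: (m, kw w0)]
   [:: (m, fun s => / (1 - RtoC s * w) * / (1 - RtoC s * w0))] (w - w0) (kers_cont inA)
   _ _ _ erefl erefl _ s _.
rewrite Cmult_assoc (Cmult_comm (w - w0)) -Cmult_assoc -E.
- by rewrite /=; ring.
- by apply: (cdom_MK (L := [:: (m, w)])) => q [<-|[]].
- by apply: (cdom_MK (L := [:: (m, w0)])) => q [<-|[]].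
- apply: (iter_Pint_cont HO (g := fun _ s => / (1 - RtoC s * w) * / (1 - RtoC s * w0) * 1)).
  by apply: cont_on_mult => //; exact: cont_on_const.
- move=> u Hu /=.
  apply: (@iter_Pint_lin _ (cdom ws) HO 0 m (w - w0) (fun _ s => kw w s * 1) (fun _ s => kw w0 s * 1)
   (fun _ s => / (1 - RtoC s * w) * / (1 - RtoC s * w0) * 1) 0%R) Hu;
    try by apply: cont_on_mult; [try exact: cdom_kw | exact: cont_on_const].
  move=> v /cdomP /List.Forall_forall Hv.
  have := slit_den (Hv w inw); have := slit_den (Hv w0 inw0).
  by rewrite /kw => d1 d2; field.
- exact/ok_cdom.
Qed.

(** In [t], an antiderivative of [1 / (1 - t * s * w) ^ 2] is [t / (1 - t * s * w)]. *)
Lemma Pint_inv_sq w s : slit_on s w ->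
  Pint 0 (fun s => / (1 - RtoC s * w) * / (1 - RtoC s * w)) s = / (1 - RtoC s * w).
Proof.
move=> H.
have dn t : (0 <= t <= 1)%R -> 1 - RtoC (t * s) * w <> 0 by move/H.
have cd t : (0 <= t <= 1)%R -> continuous (fun t => / (1 - RtoC (t * s) * w)) t.
  move=> Ht; apply: C_cont_inv; last exact: dn.
  apply: C_cont_minus; first exact: C_cont_const.
  apply: C_cont_mult; last exact: C_cont_const.
  apply: C_cont_RtoC; apply: R_cont_mult; first exact: continuous_id.
  exact: continuous_const.
rewrite /Pint (@CInt_ext _ (fun t => / (1 - RtoC (t * s) * w) * / (1 - RtoC (t * s) * w))); last first.
  by move=> t _ /=; ring.
rewrite (@CInt_derive (fun t => RtoC t * / (1 - RtoC (t * s) * w))).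
- rewrite Rmult_1_l Rmult_0_l.
  by ring.
- move=> t Ht.
  apply: (@R_der_slope _ (fun u => / (1 - RtoC (u * s) * w) * / (1 - RtoC (t * s) * w)) t).
    have ct : continuous (fun u => 1 - RtoC (u * s) * w) t.
      apply: C_cont_minus; first exact: C_cont_const.
      apply: C_cont_mult; last exact: C_cont_const.
      apply: C_cont_RtoC; apply: R_cont_mult; first exact: continuous_id.
      exact: continuous_const.
    apply: filter_imp (cont_near0 ct (dn t Ht)) => u Hu.
    have Ht' := dn t Ht; rewrite !RtoC_mult in Hu Ht' *; rewrite RtoC_minus.
    by field.
  by apply: C_cont_mult; [exact: cd | exact: C_cont_const].
- by move=> t Ht; apply: C_cont_mult; exact: cd.
Qed.

(** On the diagonal [lam_slope] is the derivative in the innermost argument, and [w d/dw] multiplies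
    a summand by the innermost index [k_r]. *)
Lemma lam_slope_diag (A : seq (nat * C)) m w s : ok s (A ++ [:: (m, w)]) ->
  w * lam_slope A m.+1 w w s = lam (A ++ [:: (m, w)]) s.
Proof.
move=> H.
set ws := [seq q.2 | q <- A ++ [:: (m, w)]].
have HO := cdom_star ws.
have inA q : List.In q A -> List.In q.2 ws.
  by move=> Hq; apply: List.in_map; apply: List.in_or_app; left.
have inw : List.In w ws.
  by apply: (List.in_map snd _ (m, w)); apply: List.in_or_app; right; left.
have c1 : cont_on (cdom ws) (fun _ s => / (1 - RtoC s * w)) by exact: cdom_den.
have cq : cont_on (cdom ws) (fun _ s => / (1 - RtoC s * w) * / (1 - RtoC s * w)).
  by apply: cont_on_mult.
rewrite /lam_slope /lam /kers !map_cat !size_cat /= addn1 -/(kers A).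
rewrite Cmult_assoc (Cmult_comm w) -Cmult_assoc; congr (_ * _).
have E := @MK_suffix_lin (cdom ws) 0%R HO (kers A) [:: (m, kw w)] [:: (m, fun _ => RtoC 0)]
   [:: (m.+1, fun s => / (1 - RtoC s * w) * / (1 - RtoC s * w))] w (kers_cont inA)
   _ _ _ erefl erefl _ s _.
have Z0 : MK (kers A ++ [:: (m, fun=> RtoC 0)]) s = 0.
  have : forall u, cdom ws (0%R, u) -> MK (kers A ++ [:: (m, fun=> RtoC 0)]) u = 0.
    clear -HO; elim: (kers A) => [|q B IH] u Hu /=.
      by apply: (@iter_Pint0 _ _ HO _ _ _ 0%R) => // v _; ring.
    by apply: (@iter_Pint0 _ _ HO _ _ _ 0%R) => // v Hv; rewrite IH //; ring.
  by apply; exact/ok_cdom.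
rewrite Z0 in E.
rewrite -E.
- by ring.
- by apply: (cdom_MK (L := [:: (m, w)])) => q [<-|[]].
- apply: (iter_Pint_cont HO (g := fun _ _ => RtoC 0 * 1)); exact: cont_on_const.
- apply: (iter_Pint_cont HO (n := m.+1) (g := fun _ s => / (1 - RtoC s * w) * / (1 - RtoC s * w) * 1)).
  by apply: cont_on_mult => //; exact: cont_on_const.
- move=> u Hu.
  have -> : MK [:: (m.+1, fun s => / (1 - RtoC s * w) * / (1 - RtoC s * w))] u
     = iter m (Pint 0) (fun s => / (1 - RtoC s * w)) u.
    rewrite /MK /= -/(iter m.+1 _ _) iterSr.
    apply: (@iter_Pint_ext _ (cdom ws) HO 0 m _ _ 0%R _ _ Hu) => v Hv.
    rewrite -[RHS]Pint_inv_sq; last first.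
      by move/cdomP/List.Forall_forall: Hv; exact.
    by apply: CInt_ext => t _; ring.
  apply: (@iter_Pint_lin _ (cdom ws) HO 0 m w (fun _ s => kw w s * 1) (fun _ _ => RtoC 0 * 1)
   (fun _ s => / (1 - RtoC s * w)) 0%R) Hu => //.
    by apply: cont_on_mult; [exact: cdom_kw | exact: cont_on_const].
    exact: cont_on_const.
  by move=> v _; rewrite /kw /Cdiv; ring.
- exact/ok_cdom.
Qed.

Lemma lam_slope_cont (A : seq (nat * C)) m T w0 tau :
  (0 < tau)%R -> (forall q, List.In q A -> npos q.2) -> npos T -> npos w0 ->
  continuous (fun u => lam_slope A m (T / RtoC u) w0 u) tau.
Proof.
move=> tau0 HA HT Hw0.
pose X := R_UniformSpace.
pose V := fun u : X => (0 < u)%R.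
pose ws : seq (X -> C) := (fun u => T / RtoC u) :: (fun _ => w0) :: [seq (fun _ => q.2) | q <- A].
have HV : open V by exact: open_gt.
have Hws : List.Forall (fun w : X -> C => forall x : X, V x -> continuous w x) ws.
  constructor.
    move=> u u0; apply: C_cont_div; first exact: C_cont_const.
      exact/C_cont_RtoC/continuous_id.
    by move/RtoC_inj => E; rewrite /V E in u0; lra.
  constructor; first by move=> u _; exact: C_cont_const.
  by apply/List.Forall_forall => v /List.in_map_iff [q [<- _]] u _; exact: C_cont_const.
have HO := kdom_star HV Hws.
have key : cont_on (kdom V ws) (fun u => lam_slope A m (T / RtoC u) w0).
  rewrite /lam_slope; apply: cont_on_mult.
    by move=> x s _; apply/cont_pow/continuous_snd.
  pose L : seq (nat * (X -> R -> C)) := [seq (q.1, fun _ => kw q.2) | q <- A] ++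
     [:: (m, fun u s => / (1 - RtoC s * (T / RtoC u)) * / (1 - RtoC s * w0))].
  move=> x s Hs.
  apply: (continuous_ext (fun p : X * R => MK [seq (q.1, q.2 p.1) | q <- L] p.2)).
    by move=> p; rewrite /L map_cat -map_comp.
  apply: (MK_cont HO (k := fun q => q.2)) Hs.
  apply/List.Forall_forall => q Hq; case/In_cat: Hq => [/List.in_map_iff [p [<- Hp]]|[<-|[]]] /=.
    apply: (kw_cont (w := fun _ => p.2)) => //; right; right.
    exact: (List.in_map (fun q (_ : X) => q.2)).
  apply: cont_on_mult.
    by apply: (kdom_den_cont (w := fun u => T / RtoC u)) => //; left.
  by apply: (kdom_den_cont (w := fun _ => w0)) => //; right; left.
apply: (@continuous_comp_2 _ _ _ _ (fun u => u) (fun u => u) (fun u => lam_slope A m (T / RtoC u) w0)).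
- exact: continuous_id.
- exact: continuous_id.
apply: key; split=> //=.
have hs := npos_slit _ (Rlt_le _ _ tau0).
constructor; last first.
  constructor; first exact: hs.
  by apply/List.Forall_forall => v /List.in_map_iff [q [<- /HA Hq]]; apply: hs.
apply: hs.
have -> : T / RtoC tau = RtoC (/ tau) * T.
  by rewrite RtoC_inv; [rewrite /Cdiv Cmult_comm | lra].
by apply: npos_scale => //; apply: Rinv_0_lt_compat.
Qed.

Lemma npos_div T u : npos T -> (0 < u)%R -> npos (T / RtoC u).
Proof.
move=> HT u0; have -> : T / RtoC u = RtoC (/ u) * T.
  by rewrite RtoC_inv; [rewrite /Cdiv Cmult_comm | lra].
by apply: npos_scale => //; apply: Rinv_0_lt_compat.
Qed.

Lemma npos_ok s L : (forall q, List.In q L -> npos q.2) -> (0 <= s)%R -> ok s L.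
Proof. by move=> H s0; apply/List.Forall_forall => q /H Hq; apply: npos_slit. Qed.

(* The innermost variable moves as [T / tau] while the scale is [tau], so that
   the product of the two is fixed. *)
Lemma lam_full_derive (A : seq (nat * C)) n w m T tau :
  (0 < tau)%R -> (forall q, List.In q A -> npos q.2) -> npos w -> npos T ->
  @is_derive R_AbsRing C_R_NormedModule
    (fun u => lam ((n.+1, w) :: A ++ [:: (m.+1, T / RtoC u)]) u) tau
    ((lam ((n, w) :: A ++ [:: (m.+1, T / RtoC tau)]) tau
      - lam ((n.+1, w) :: A ++ [:: (m, T / RtoC tau)]) tau) / RtoC tau).
Proof.
move=> tau0 HA Hw HT.
set B := (n.+1, w) :: A.
have HB q : List.In q B -> npos q.2 by move=> [<-|/HA].
set w0 := T / RtoC tau.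
have Hw0 : npos w0 by exact: npos_div.
have tn : RtoC tau <> 0 by move/RtoC_inj; lra.
have okB u l : (0 < u)%R -> (forall q, List.In q l -> npos q.2) -> ok u (B ++ l).
  move=> u0 Hl; apply: npos_ok; last lra.
  by move=> q Hq; case/In_cat: Hq => [/HB|/Hl].
have D2 : @is_derive R_AbsRing C_R_NormedModule (lam (B ++ [:: (m.+1, w0)])) tau
    (lam ((n, w) :: A ++ [:: (m.+1, w0)]) tau / RtoC tau).
  by apply: lam_derive => //; apply: (okB _ [:: (m.+1, w0)]) => // q [<-|[]].
(* The effect of moving the innermost variable alone. The difference vanishes at [tau], and [T / u -
   T / tau = - (u - tau) * T / (u * tau)] gives its slope. *)
have D1 : @is_derive R_AbsRing C_R_NormedModule
    (fun u => lam (B ++ [:: (m.+1, T / RtoC u)]) u - lam (B ++ [:: (m.+1, w0)]) u) tau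
    (- (T / (RtoC tau * RtoC tau)) * lam_slope B m.+1 w0 w0 tau).
  apply: (@R_der_slope _ (fun u => - (T / (RtoC u * RtoC tau)) * lam_slope B m.+1 (T / RtoC u) w0 u)).
    have := locally_open _ _ (open_gt 0%R) (fun _ H => H) tau tau0.
    apply: filter_imp => u u0.
    have un : RtoC u <> 0 by move/RtoC_inj; lra.
    rewrite lam_slopeP; last by apply: okB => // q [<-|[<-|[]]] //; exact: npos_div.
    rewrite -/w0 RtoC_minus.
    move: (lam_slope _ _ _ _ _) (lam (B ++ _) tau) => x1 x2.
    by rewrite /w0; field.
  apply: C_cont_mult; last exact: lam_slope_cont.
  apply: C_cont_opp; apply: C_cont_div; first exact: C_cont_const.
    by apply: C_cont_mult; [exact/C_cont_RtoC/continuous_id | exact: C_cont_const].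
  exact: Cmult_neq_0.
have D := is_derive_plus _ _ _ _ _ D1 D2.
have E1 := @lam_slope_diag B m w0 tau (okB tau [:: (m, w0)] tau0 _).
have -> : (lam ((n, w) :: A ++ [:: (m.+1, w0)]) tau - lam (B ++ [:: (m, w0)]) tau) / RtoC tau
  = - (T / (RtoC tau * RtoC tau)) * lam_slope B m.+1 w0 w0 tau
    + lam ((n, w) :: A ++ [:: (m.+1, w0)]) tau / RtoC tau.
  rewrite -E1; last by move=> q [<-|[]].
  move: (lam_slope _ _ _ _ _) (lam _ tau) => x1 x2.
  by rewrite /w0; field.
apply: (is_derive_ext _ _ _ _ _ D) => u.
exact: C_subrK.
Qed.

(** * The sum over all decreasing sequences of nonzero integers *)

Fixpoint csum (f : nat -> C) (N : nat) : C :=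
  if N is k.+1 then csum f k + f k else RtoC 0.

Lemma csum_ext (f g : nat -> C) (N : nat) : (forall k, (k < N)%nat -> f k = g k) -> csum f N = csum g N.
Proof.
elim: N => [|N IH] H //=; rewrite H // IH // => k Hk; apply: H; exact: ltnW.
Qed.

Lemma csum_add (f g : nat -> C) (N : nat) : csum (fun k => f k + g k) N = csum f N + csum g N.
Proof. by elim: N => [|N IH] /=; [ring | rewrite IH; ring]. Qed.

Lemma csum_scal (c : C) (f : nat -> C) (N : nat) : csum (fun k => c * f k) N = c * csum f N.
Proof. by elim: N => [|N IH] /=; [ring | rewrite IH; ring]. Qed.

Lemma csum_recl (f : nat -> C) (N : nat) : csum f N.+1 = f 0%nat + csum (fun k => f k.+1) N.
Proof. by elim: N => [|N IH]; [rewrite /=; ring | rewrite [LHS]/= -/(csum f N.+1) IH /=; ring]. Qed.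

Lemma csum_zero (f : nat -> C) (N : nat) : (forall k, (k < N)%nat -> f k = 0) -> csum f N = 0.
Proof.
elim: N => [|N IH] H //=; rewrite H // IH; first by ring.
by move=> k Hk; apply: H; exact: ltnW.
Qed.

Lemma csum_rev (f : nat -> C) (N : nat) : csum f N = csum (fun k => f (N - k.+1)%nat) N.
Proof.
elim: N => [|N IH] //; rewrite [RHS]csum_recl subSS subn0 [LHS]/= {1}IH Cplus_comm.
by congr (_ + _).
Qed.

Lemma csum_tri (f : nat -> nat -> C) (N : nat) :
  csum (fun i => csum (f i) (N - i)) N = csum (fun j => csum (fun i => f i j) (N - j)) N.
Proof.
elim: N => [|N IH] //=; rewrite !subSnn /=.
have E h : csum (fun i => csum (h i) (N.+1 - i)) N
    = csum (fun i => csum (h i) (N - i)) N + csum (fun i => h i (N - i)%nat) N.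
  by rewrite -csum_add; apply: csum_ext => i Hi; rewrite subSn ?(ltnW Hi) //=.
rewrite (E f) (E (fun j i => f i j)) IH.
have E2 : csum (fun i => f i (N - i)%nat) N.+1 = csum (fun i => f (N - i)%nat i) N.+1.
  rewrite csum_rev; apply: csum_ext => i Hi; rewrite subSS.
  by congr (f _ _); rewrite subKn.
rewrite /= !subnn in E2.
by rewrite -Cplus_assoc Cplus_0_l E2; ring.
Qed.

Definition sgn (n : nat) : C := Cpow (RtoC (-1)) n.

Lemma sgnS n : sgn n.+1 = - sgn n.
Proof. by rewrite /sgn Cpow_S; move: (Cpow _ n) => x; ring. Qed.

Lemma sgnD m n : sgn (m + n) = sgn m * sgn n.
Proof. exact: Cpow_add_r. Qed.

Lemma sgn_sq n : sgn n * sgn n = 1.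
Proof. by elim: n => [|n IH]; [rewrite /sgn /=; ring | rewrite sgnS -IH; ring]. Qed.

(* The coefficient of [x ^ l] in [(1 + x) ^ (- n)]. *)
Definition gz (n l : nat) : Z :=
  (if odd l then - Z.of_nat 'C((n + l).-1, l) else Z.of_nat 'C((n + l).-1, l))%Z.

Definition gc (n l : nat) : C := RtoC (IZR (gz n l)).

Lemma gc0 n : gc n 0 = 1.
Proof. by rewrite /gc /gz bin0. Qed.

Lemma gc0S l : gc 0 l.+1 = 0.
Proof. by rewrite /gc /gz add0n /= bin_small //; case: (~~ odd l). Qed.

Lemma gcSS n l : gc n.+1 l.+1 = gc n l.+1 - gc n.+1 l.
Proof.
rewrite /gc -RtoC_minus -minus_IZR; congr (RtoC (IZR _)).
rewrite /gz !addSn !addnS /= binS.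
by case: (odd l) => /=; lia.
Qed.

(** The coefficient of [x ^ k] after each [1 / k_j ^ n_j] has been replaced by
    [1 / (k_j + x) ^ n_j], which expands into the terms [gc n_j l * x ^ l / k_j ^ (n_j + l)]. Here
    [phi] evaluates a list of raised indices. *)
Fixpoint SE (L : seq (nat * C)) (phi : seq (nat * C) -> C) (k : nat) : C :=
  if L is q :: L' then
    csum (fun l => gc q.1 l * SE L' (fun M => phi (((q.1 + l)%nat, q.2) :: M)) (k - l)) k.+1
  else if k is 0 then phi [::] else RtoC 0.

Definition SEs (L : seq (nat * C)) (s : R) (k : nat) : C := SE L (fun M => lam M s) k.

(** Multiplication of a generating series by [x]. *)
Definition shift (f : nat -> C) (k : nat) : C := if k is k'.+1 then f k' else RtoC 0.

Lemma SE_k0 L (phi : seq (nat * C) -> C) : SE L phi 0 = phi L.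
Proof.
elim: L phi => [|q L IH] phi //=.
by rewrite IH gc0 addn0 -surjective_pairing; ring.
Qed.

Lemma SE_ext L (phi psi : seq (nat * C) -> C) k : (forall M, [seq q.2 | q <- M] = [seq q.2 | q <- L] -> phi M = psi M) ->
  SE L phi k = SE L psi k.
Proof.
elim: L phi psi k => [|q L IH] phi psi k H /=; first by case: k => //; apply: H.
congr (_ + _); first apply: csum_ext => l _; congr (_ * _).
  by apply: IH => M HM; apply: H; rewrite /= HM.
by apply: IH => M HM; apply: H; rewrite /= HM.
Qed.

Lemma SE_scal L (phi : seq (nat * C) -> C) (c : C) k : SE L (fun M => c * phi M) k = c * SE L phi k.
Proof.
elim: L phi k => [|q L IH] phi k; first by case: k => [|k] /=; ring.
rewrite [LHS]/= -/(csum _ k.+1) [in RHS]/SE -/SE -csum_scal.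
by apply: csum_ext => l _; rewrite IH; ring.
Qed.

Lemma SE_der L (phi : R -> seq (nat * C) -> C) (psi : seq (nat * C) -> C) t k :
  (forall M, [seq q.2 | q <- M] = [seq q.2 | q <- L] ->
     @is_derive R_AbsRing C_R_NormedModule (fun u => phi u M) t (psi M)) ->
  @is_derive R_AbsRing C_R_NormedModule (fun u => SE L (phi u) k) t (SE L psi k).
Proof.
elim: L phi psi k => [|q L IH] phi psi k H.
  by case: k => [|k] /=; [apply: H | apply: R_der_const].
rewrite /SE -/SE; elim: k.+1 => [|N IHN] /=; first exact: R_der_const.
apply: R_der_plus => //.
have := R_der_mult (R_der_const (gc q.1 N) t) (IH (fun u M => phi u ((q.1 + N, q.2) :: M)%nat)
  (fun M => psi ((q.1 + N, q.2) :: M)%nat) (k - N)%nat _).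
replace (0 * SE L (fun M => phi t ((q.1 + N, q.2) :: M)%nat) (k - N) + gc q.1 N * SE L (fun M => psi ((q.1 + N, q.2) :: M)%nat) (k - N))
  with (gc q.1 N * SE L (fun M => psi ((q.1 + N, q.2) :: M)%nat) (k - N)) by ring.
by apply=> M HM; apply: H; rewrite /= HM.
Qed.

Lemma same_npos (L M : seq (nat * C)) : [seq q.2 | q <- M] = [seq q.2 | q <- L] ->
  (forall q, List.In q L -> npos q.2) -> forall q, List.In q M -> npos q.2.
Proof.
move=> E H q Hq.
have : List.In q.2 [seq q.2 | q <- M] by apply: List.in_map.
by rewrite E => /List.in_map_iff [p [<- /H]].
Qed.

(** [t d/dt] multiplies a summand by [k_1 = (k_1 + x) - x]: the first part lowers the index, the
    second one shifts the expansion. On coefficients this is Pascal's rule [gcSS]. *)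
Lemma SEs_derive n w L k t : (0 < t)%R -> npos w -> (forall q, List.In q L -> npos q.2) ->
  @is_derive R_AbsRing C_R_NormedModule (fun u => SEs ((n.+1, w) :: L) u k) t
   ((SEs ((n, w) :: L) t k - shift (SEs ((n.+1, w) :: L) t) k) / RtoC t).
Proof.
move=> t0 Hw HL.
have tn : RtoC t <> 0 by move/RtoC_inj; lra.
pose X l := SE L (fun M => lam (((n + l)%nat, w) :: M) t).
have D : @is_derive R_AbsRing C_R_NormedModule (fun u => SEs ((n.+1, w) :: L) u k) t
   (csum (fun l => gc n.+1 l * (/ RtoC t * X l (k - l)%nat)) k.+1).
  rewrite /SEs /SE -/SE; elim: k.+1 => [|N IHN] /=; first exact: R_der_const.
  apply: R_der_plus => //.
  have := R_der_mult (R_der_const (gc n.+1 N) t) (@SE_der L (fun u M => lam ((n.+1 + N, w) :: M)%nat u)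
   (fun M => / RtoC t * lam ((n + N, w) :: M)%nat t) t (k - N)%nat _).
  rewrite SE_scal -/(X N).
  replace (0 * SE L (fun M => lam ((n.+1 + N, w) :: M)%nat t) (k - N) + gc n.+1 N * (/ RtoC t * X N (k - N)%nat))
   with (gc n.+1 N * (/ RtoC t * X N (k - N)%nat)) by ring.
  apply=> M HM; rewrite Cmult_comm; apply: lam_derive => //.
  by apply: npos_ok; [move=> q [<-//|]; apply: same_npos HM HL _ | lra].
suff <- : csum (fun l => gc n.+1 l * (/ RtoC t * X l (k - l)%nat)) k.+1
  = (SEs ((n, w) :: L) t k - shift (SEs ((n.+1, w) :: L) t) k) / RtoC t by [].
have -> : SEs ((n, w) :: L) t k = csum (fun l => gc n l * X l (k - l)%nat) k.+1 by [].
have -> : shift (SEs ((n.+1, w) :: L) t) k = csum (fun l => gc n.+1 l * X l.+1 (k - l.+1)%nat) k.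
  case: k {D} => [|k] //=; rewrite -/(csum _ k.+1).
  rewrite /SEs /SE -/SE; apply: (@csum_ext _ _ k.+1) => l _.
  by rewrite subSS /X; congr (_ * _); apply: SE_ext => M _; rewrite addnS addSn.
rewrite !csum_recl !gc0 /Cdiv.
have -> : csum (fun l => gc n.+1 l.+1 * (/ RtoC t * X l.+1 (k - l.+1)%nat)) k
  = / RtoC t * csum (fun l => gc n l.+1 * X l.+1 (k - l.+1)%nat) k
    + (- / RtoC t) * csum (fun l => gc n.+1 l * X l.+1 (k - l.+1)%nat) k.
  rewrite -!csum_scal -csum_add; apply: csum_ext => l _.
  by rewrite gcSS; ring.
by ring.
Qed.

Lemma SEs0 w L s k : SEs ((0%nat, w) :: L) s k = RtoC s * kw w s * SEs L s k.
Proof.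
rewrite /SEs /SE -/SE csum_recl gc0 subn0 csum_zero; last first.
  by move=> l _; rewrite gc0S; ring.
rewrite (_ : SE L _ k = SE L (fun M => RtoC s * kw w s * lam M s) k); last first.
  by apply: SE_ext => M _; rewrite addn0 lam0.
by rewrite SE_scal; ring.
Qed.

Lemma SE_zero L (phi : seq (nat * C) -> C) k : (forall M, [seq q.2 | q <- M] = [seq q.2 | q <- L] -> phi M = 0) ->
  SE L phi k = 0.
Proof.
move=> H; rewrite (@SE_ext L phi (fun M => 0 * 0)) => [|M HM]; last by rewrite H //; ring.
by rewrite SE_scal; ring.
Qed.

Lemma SEs_at0 q L k : SEs (q :: L) 0 k = 0.
Proof. by apply: SE_zero => -[|p M] HM; rewrite ?lam_at0. Qed.

Lemma lam_cont_s L s : ok s L -> continuous (lam L) s.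
Proof.
move=> H.
pose X := R_UniformSpace.
have K := @lam_cont X (fun _ => True) [seq (q.1, fun _ : X => q.2) | q <- L] open_true _.
have E x : evw [seq (q.1, fun _ : X => q.2) | q <- L] x = L.
  by rewrite /evw -map_comp -[RHS]map_id; apply: eq_map => -[].
have Hd : kdom (fun _ : X => True) [seq q.2 | q <- [seq (q.1, fun _ : X => q.2) | q <- L]] (0%R, s).
  split=> //; rewrite -map_comp; apply/List.Forall_forall => w /List.in_map_iff [q [<- Hq]] /=.
  exact: (proj1 (List.Forall_forall _ _) H q Hq).
apply: (continuous_ext (fun u => lam (evw [seq (q.1, fun _ : X => q.2) | q <- L] 0%R) u)) => [u|].
  by rewrite E.
apply: (cont_on_slice (O := kdom (fun _ : X => True) _) (g := fun x => lam (evw _ x))) Hd.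
by apply: K => q /List.in_map_iff [p [<- _]] x _; exact: C_cont_const.
Qed.

Lemma SE_cont L (phi : R -> seq (nat * C) -> C) t k :
  (forall M, [seq q.2 | q <- M] = [seq q.2 | q <- L] -> continuous (fun u => phi u M) t) ->
  continuous (fun u => SE L (phi u) k) t.
Proof.
elim: L phi k => [|q L IH] phi k H.
  by case: k => [|k] /=; [apply: H | apply: C_cont_const].
rewrite /SE -/SE; elim: k.+1 => [|N IHN] /=; first exact: C_cont_const.
apply: C_cont_plus => //; apply: C_cont_mult; first exact: C_cont_const.
by apply: (IH (fun u M => phi u (_ :: M))) => M HM; apply: H; rewrite /= HM.
Qed.

Lemma SEs_cont L t k : (0 <= t)%R -> (forall q, List.In q L -> npos q.2) ->
  continuous (fun u => SEs L u k) t.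
Proof.
move=> t0 HL; apply: (SE_cont (phi := fun u M => lam M u)) => M HM.
by apply: lam_cont_s; apply: npos_ok => //; apply: same_npos HM HL.
Qed.

(** For [u > 0] this is the [lam] of scale [u] whose innermost argument is [T / u], see [fullE]; the
    present form also makes sense at [u = 0]. *)
Definition full (A : seq (nat * C)) (m : nat) (T : C) (u : R) : C :=
  lam ([seq (p.1, RtoC u * p.2) | p <- A] ++ [:: (m, T)]) 1.

Lemma fullE A m T u : (0 < u)%R -> (forall q, List.In q A -> npos q.2) -> npos T ->
  full A m T u = lam (A ++ [:: (m, T / RtoC u)]) u.
Proof.
move=> u0 HA HT.
have un : RtoC u <> 0 by move/RtoC_inj; lra.
have E : [seq (p.1, RtoC u * p.2) | p <- A] ++ [:: (m, T)]
   = [seq (p.1, RtoC u * p.2) | p <- A ++ [:: (m, T / RtoC u)]].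
  by rewrite map_cat /=; congr (_ ++ [:: (_, _)]); field.
rewrite /full E lam_dil ?Rmult_1_r // -E; apply: npos_ok; last lra.
move=> q /In_cat [/List.in_map_iff [p [<- /HA Hp]]|[<-|[]]] //.
exact: npos_scale.
Qed.

Lemma full_derive A n w m T t : (0 < t)%R -> (forall q, List.In q A -> npos q.2) ->
  npos w -> npos T ->
  @is_derive R_AbsRing C_R_NormedModule (full ((n.+1, w) :: A) m.+1 T) t
   ((full ((n, w) :: A) m.+1 T t - full ((n.+1, w) :: A) m T t) / RtoC t).
Proof.
move=> t0 HA Hw HT.
have HB k q : List.In q ((k, w) :: A) -> npos q.2 by move=> [<-|/HA].
rewrite !fullE //; try exact: HB.
have := locally_open _ _ (open_gt 0%R) (fun _ H => H) t t0.
move=> nb; apply: is_derive_ext_loc (lam_full_derive _ _ t0 HA Hw HT).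
by apply: filter_imp nb => u u0; rewrite fullE //; exact: HB.
Qed.

Lemma slit0 s : slit_on s 0.
Proof. by move=> t _; replace (1 - RtoC (t * s) * 0) with (RtoC 1) by ring; exact: C1_nz. Qed.

Lemma full_at0 q A m T : npos T -> full (q :: A) m T 0 = 0.
Proof.
move=> HT; rewrite /full /= Cmult_0_l; apply: lam_head0.
apply/List.Forall_forall => p /In_cat [/List.in_map_iff [p' [<- _]]|[<-|[]]] /=.
  by rewrite Cmult_0_l; exact: slit0.
by apply: npos_slit => //; lra.
Qed.

Lemma full_cont A m T t : (0 <= t)%R -> (forall q, List.In q A -> npos q.2) -> npos T ->
  continuous (full A m T) t.
Proof.
move=> t0 HA HT.
pose X := R_UniformSpace.
pose L : seq (nat * (X -> C)) := [seq (p.1, fun u => RtoC u * p.2) | p <- A] ++ [:: (m, fun _ => T)].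
have HL q : List.In q L -> forall x, True -> continuous q.2 x.
  move=> /In_cat [/List.in_map_iff [p [<- _]]|[<-|[]]] x _ /=; last exact: C_cont_const.
  by apply: C_cont_mult; [exact/C_cont_RtoC/continuous_id | exact: C_cont_const].
have K := @lam_cont X (fun _ => True) L open_true HL.
apply: (continuous_ext (fun u => lam (evw L u) 1)) => [u|].
  by rewrite /evw /L map_cat -map_comp.
apply: (@continuous_comp_2 _ _ _ _ (fun u => u) (fun _ => 1%R) (fun x s => lam (evw L x) s)).
- exact: continuous_id.
- exact: continuous_const.
apply: K; split=> //=; apply/List.Forall_forall => w /List.in_map_iff [q [<-]].
move=> /In_cat [/List.in_map_iff [p [<- /HA Hp]]|[<-|[]]] /=; last by apply: npos_slit => //; lra.
have [-> |tn] := Req_dec t 0; first by rewrite Cmult_0_l; exact: slit0.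
by apply: npos_slit; [apply: npos_scale => //; lra | lra].
Qed.

(** The coefficient of [x ^ N] in [bt(x) * L(x) * R(- x)], sequences being read as generating
    series. The right factor belongs to negative summation indices, whence [- x]. *)
Definition Cv (bt : nat -> C) (N : nat) (L R : nat -> C) : C :=
  csum (fun k1 => csum (fun k2 => bt (N - k1 - k2)%nat * sgn k2 * (L k1 * R k2)) (N.+1 - k1)) N.+1.

Lemma csum_recr (f : nat -> C) N : csum f N.+1 = csum f N + f N.
Proof. by []. Qed.

Lemma R_der_eq (f : R -> C) t (l l' : C) :
  @is_derive R_AbsRing C_R_NormedModule f t l -> l = l' ->
  @is_derive R_AbsRing C_R_NormedModule f t l'.
Proof. by move=> H <-. Qed.

Lemma Cv_ext bt N (L L' R R' : nat -> C) : (forall k, L k = L' k) -> (forall k, R k = R' k) ->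
  Cv bt N L R = Cv bt N L' R'.
Proof. by move=> HL HR; apply: csum_ext => k1 _; apply: csum_ext => k2 _; rewrite HL HR. Qed.

Lemma Cv_addL bt N (L L' R : nat -> C) (c c' : C) :
  Cv bt N (fun k => c * L k + c' * L' k) R = c * Cv bt N L R + c' * Cv bt N L' R.
Proof.
rewrite /Cv -!csum_scal -csum_add; apply: csum_ext => k1 _.
by rewrite -!csum_scal -csum_add; apply: csum_ext => k2 _; ring.
Qed.

Lemma Cv_addR bt N (L R R' : nat -> C) (c c' : C) :
  Cv bt N L (fun k => c * R k + c' * R' k) = c * Cv bt N L R + c' * Cv bt N L R'.
Proof.
rewrite /Cv -!csum_scal -csum_add; apply: csum_ext => k1 _.
by rewrite -!csum_scal -csum_add; apply: csum_ext => k2 _; ring.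
Qed.

Lemma Cv_shiftL bt N L R : Cv bt N.+1 (shift L) R = Cv bt N L R.
Proof.
rewrite /Cv csum_recl [X in X + _]csum_zero ?Cplus_0_l // => k _ /=; ring.
Qed.

(** The shift of [R] is a factor [- x], since [R] is taken at [- x]. *)
Lemma Cv_shiftR bt N L R : Cv bt N.+1 L (shift R) = - Cv bt N L R.
Proof.
transitivity (-(1) * Cv bt N L R); last by ring.
rewrite /Cv -csum_scal csum_recr [X in _ + X]csum_zero ?Cplus_0_r; last first.
  by move=> [|k] Hk; [rewrite /=; ring | lia].
apply: csum_ext => k1 Hk1.
rewrite (_ : (N.+2 - k1 = (N.+1 - k1).+1)%nat); last by lia.
rewrite csum_recl -csum_scal (_ : forall a b c d : C, a * b * (c * 0) + d = d); last by move=> *; ring.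
apply: csum_ext => k2 _; rewrite sgnS (_ : (N.+1 - k1 - k2.+1 = N - k1 - k2)%nat); last by lia.
by rewrite /=; ring.
Qed.

(** The factors [x] and [- x] that the two shifts contribute cancel. *)
Lemma Cv_shift bt N L R : Cv bt N (shift L) R + Cv bt N L (shift R) = 0.
Proof.
by case: N => [|N]; [rewrite /Cv /=; ring | rewrite Cv_shiftL Cv_shiftR; ring].
Qed.

Lemma cancel_pair (A B t X Y : C) : X + Y = 0 ->
  / t * A + - / t * X + (- / t * B + - / t * Y) = (A - B) / t.
Proof.
by move=> E; transitivity ((A - B) / t - / t * (X + Y)); [rewrite /Cdiv; ring | rewrite E; ring].
Qed.

(** The substitution of [- x] for [x], which exchanges the roles of the two factors. *)
Lemma Cv_swap bt N L R :
  Cv (fun a => sgn a * bt a) N R L = sgn N * Cv bt N L R.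
Proof.
rewrite /Cv (csum_tri (fun k1 k2 => _)) -csum_scal; apply: csum_ext => k1 Hk1.
rewrite -csum_scal; apply: csum_ext => k2 Hk2.
have E : (N - k1 - k2)%nat = (N - k2 - k1)%nat by lia.
rewrite -E.
have -> : sgn N = sgn (N - k1 - k2) * sgn k1 * sgn k2.
  by rewrite -!sgnD; congr (sgn _); lia.
transitivity (sgn (N - k1 - k2) * bt (N - k1 - k2)%nat * sgn k1 * (sgn k2 * sgn k2) * (R k2 * L k1)); last by ring.
by rewrite sgn_sq; ring.
Qed.

Lemma csum_der (f : nat -> R -> C) (g : nat -> C) t N :
  (forall k, (k < N)%nat -> @is_derive R_AbsRing C_R_NormedModule (f k) t (g k)) ->
  @is_derive R_AbsRing C_R_NormedModule (fun u => csum (fun k => f k u) N) t (csum g N).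
Proof.
elim: N => [|N IH] H /=; first exact: R_der_const.
by apply: R_der_plus; [apply: IH => k Hk; apply: H; exact: ltnW | exact: H].
Qed.

Lemma csum_cont (X : UniformSpace) (f : nat -> X -> C) t N :
  (forall k, (k < N)%nat -> continuous (f k) t) ->
  continuous (fun u => csum (fun k => f k u) N) t.
Proof.
elim: N => [|N IH] H /=; first exact: C_cont_const.
by apply: C_cont_plus; [apply: IH => k Hk; apply: H; exact: ltnW | exact: H].
Qed.

Lemma Cv_der bt N (L R : R -> nat -> C) (L' R' : nat -> C) t :
  (forall k, @is_derive R_AbsRing C_R_NormedModule (fun u => L u k) t (L' k)) ->
  (forall k, @is_derive R_AbsRing C_R_NormedModule (fun u => R u k) t (R' k)) ->
  @is_derive R_AbsRing C_R_NormedModule (fun u => Cv bt N (L u) (R u)) t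
    (Cv bt N L' (R t) + Cv bt N (L t) R').
Proof.
move=> HL HR; rewrite /Cv -csum_add; apply: csum_der => k1 _.
rewrite -csum_add; apply: csum_der => k2 _.
have := R_der_mult (R_der_const (bt (N - k1 - k2)%nat * sgn k2) t) (R_der_mult (HL k1) (HR k2)).
by set c := bt _ * _; replace (0 * (L t k1 * R t k2) + c * (L' k1 * R t k2 + L t k1 * R' k2))
  with (c * (L' k1 * R t k2) + c * (L t k1 * R' k2)) by ring.
Qed.

Lemma Cv_cont bt N (L R : R -> nat -> C) t :
  (forall k, continuous (fun u => L u k) t) -> (forall k, continuous (fun u => R u k) t) ->
  continuous (fun u => Cv bt N (L u) (R u)) t.
Proof.
move=> HL HR; apply: csum_cont => k1 _; apply: csum_cont => k2 _.
by apply: C_cont_mult; [exact: C_cont_const | apply: C_cont_mult].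
Qed.

Lemma Cv_0L bt N (L R : nat -> C) : (forall k, L k = 0) -> Cv bt N L R = 0.
Proof. by move=> H; apply: csum_zero => k1 _; apply: csum_zero => k2 _; rewrite H; ring. Qed.

Lemma Cv_0R bt N (L R : nat -> C) : (forall k, R k = 0) -> Cv bt N L R = 0.
Proof. by move=> H; apply: csum_zero => k1 _; apply: csum_zero => k2 _; rewrite H; ring. Qed.

(** * The regularised sum, its Bernoulli side, and their behaviour under scaling *)

Notation elt := (nat * C * C)%type.

Definition al (E : seq elt) : seq (nat * C) := [seq (q.1.1, q.1.2) | q <- E].
Definition bl (E : seq elt) : seq (nat * C) := rev [seq (q.1.1, q.2) | q <- E].
Definition wt (E : seq elt) : nat := sumn [seq q.1.1 | q <- E].

(** A decreasing sequence of nonzero integers has [i] positive terms followed by negative ones. An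
    element carries an index, a prefix product and an inverse suffix product of the arguments: the
    former serve the positive part, the latter the negative part, whose outermost variable is the
    last one. The sign comes from [(- m) ^ n]. *)
Definition Zs (E : seq elt) : C :=
  csum (fun i => lam (al (take i E)) 1 * (sgn (wt (drop i E)) * lam (bl (drop i E)) 1)) (size E).+1.

(** In the summand [i] the entry [i] sits at 0, the entries before it are positive and those after
    it negative. The value is the coefficient of [x ^ n_i] in the series of the [bt], times the left
    part with denominators [k + x], times the right part with denominators [- m + x]. *)
Definition Rs (bt : nat -> C) (E : seq elt) : C :=
  csum (fun i => Cv bt (nth (0%nat, RtoC 0, RtoC 0) E i).1.1 (SEs (al (take i E)) 1)
    (fun k => sgn (wt (drop i.+1 E)) * SEs (bl (drop i.+1 E)) 1 k)) (size E).

Definition d0 (k : nat) : C := if k is 0 then RtoC 1 else RtoC 0.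

Lemma SEs_nil s k : SEs [::] s k = d0 k.
Proof. by case: k => //=; rewrite /SEs /= /lam /=; ring. Qed.

Section Scaling.
Variables (ax bx ay by' : C) (M : seq elt).
Hypothesis Hax : npos ax.
Hypothesis Hbx : npos bx.
Hypothesis Hay : npos ay.
Hypothesis Hby : npos by'.
Hypothesis HM : forall q, List.In q M -> npos q.1.2 /\ npos q.2.

Lemma al_npos K : (forall q, List.In q K -> List.In q M) -> forall q, List.In q (al K) -> npos q.2.
Proof. by move=> H q /List.in_map_iff [p [<- /H/HM []]]. Qed.

Lemma bl_npos K : (forall q, List.In q K -> List.In q M) -> forall q, List.In q (bl K) -> npos q.2.
Proof.
move=> H q; rewrite /bl -map_rev => /List.in_map_iff [p [<- Hp]] /=.
suff : List.In p K by move/H/HM => [].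
elim: K p Hp {H} => [|a K IH] p //=; rewrite rev_cons -cats1 => /In_cat [/IH|[]]; by [right|left|].
Qed.

Lemma In_take (T : Type) j (x : T) s : List.In x (take j s) -> List.In x s.
Proof. by rewrite -{2}(cat_take_drop j s) => H; apply/In_cat; left. Qed.

Lemma In_drop (T : Type) j (x : T) s : List.In x (drop j s) -> List.In x s.
Proof. by rewrite -{2}(cat_take_drop j s) => H; apply/In_cat; right. Qed.

(** [Zs] after the first argument has been multiplied by [t] and the last one divided by [t]. All
    proper prefix and suffix quantities acquire a factor [t], while [ay] and [bx], which involve the
    full product, stay fixed; this is why the two extreme summands are [full]. On summands [t d/dt]
    is multiplication by [k_1 - k_r]. *)
Definition fZ (nx ny : nat) (t : R) : C :=
  sgn (nx + (wt M + ny)) * full ((ny, by') :: bl M) nx bx t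
  + csum (fun j => lam ((nx, ax) :: al (take j M)) t *
       (sgn (wt (drop j M) + ny) * lam ((ny, by') :: bl (drop j M)) t)) (size M).+1
  + full ((nx, ax) :: al M) ny ay t.

Definition fR (bt : nat -> C) (nx ny : nat) (t : R) : C :=
  Cv bt nx d0 (fun k => sgn (wt M + ny) * SEs ((ny, by') :: bl M) t k)
  + csum (fun j => Cv bt (nth (0%nat, RtoC 0, RtoC 0) M j).1.1 (SEs ((nx, ax) :: al (take j M)) t)
      (fun k => sgn (wt (drop j.+1 M) + ny) * SEs ((ny, by') :: bl (drop j.+1 M)) t k)) (size M)
  + Cv bt ny (SEs ((nx, ax) :: al M) t) d0.

Lemma csum_div_sub (f g : nat -> C) N (c : C) :
  csum (fun k => (f k - g k) / c) N = (csum f N - csum g N) / c.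
Proof.
rewrite /Cdiv.
transitivity (/ c * csum f N + - / c * csum g N); last by ring.
by rewrite -!csum_scal -csum_add; apply: csum_ext => k _; ring.
Qed.

Lemma fZ_derive nx ny t : (0 < t)%R ->
  @is_derive R_AbsRing C_R_NormedModule (fZ nx.+1 ny.+1) t
    ((fZ nx ny.+1 t - fZ nx.+1 ny t) / RtoC t).
Proof.
move=> t0.
have tn : RtoC t <> 0 by move/RtoC_inj; lra.
have HbM : forall q, List.In q (bl M) -> npos q.2 by apply: bl_npos.
have HaM : forall q, List.In q (al M) -> npos q.2 by apply: al_npos.
have D1 := R_der_mult (R_der_const (sgn (nx.+1 + (wt M + ny.+1))) t) (full_derive ny nx t0 HbM Hby Hbx).
have D3 := full_derive nx ny t0 HaM Hax Hay.
have D2 : @is_derive R_AbsRing C_R_NormedModule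
  (fun t => csum (fun j => lam ((nx.+1, ax) :: al (take j M)) t *
       (sgn (wt (drop j M) + ny.+1) * lam ((ny.+1, by') :: bl (drop j M)) t)) (size M).+1) t
  (csum (fun j => (lam ((nx, ax) :: al (take j M)) t *
       (sgn (wt (drop j M) + ny.+1) * lam ((ny.+1, by') :: bl (drop j M)) t)
     - lam ((nx.+1, ax) :: al (take j M)) t *
       (sgn (wt (drop j M) + ny) * lam ((ny, by') :: bl (drop j M)) t)) / RtoC t) (size M).+1).
  apply: csum_der => j _.
  have HbD : forall q, List.In q (bl (drop j M)) -> npos q.2 by apply: bl_npos => q; apply: In_drop.
  have HaT : forall q, List.In q (al (take j M)) -> npos q.2 by apply: al_npos => q; apply: In_take.
  have ok1 : ok t ((nx.+1, ax) :: al (take j M)).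
    by apply: npos_ok; [move=> q [<-|/HaT] | lra].
  have ok2 : ok t ((ny.+1, by') :: bl (drop j M)).
    by apply: npos_ok; [move=> q [<-|/HbD] | lra].
  apply: (R_der_eq (R_der_mult (lam_derive ok1 t0) (R_der_mult (R_der_const (sgn (wt (drop j M) + ny.+1)) t) (lam_derive ok2 t0)))).
  by rewrite addnS sgnS; field.
apply: (R_der_eq (R_der_plus (R_der_plus D1 D2) D3)).
rewrite csum_div_sub /fZ !addnS !addSn !sgnS.
set S1 := csum _ _; set S2 := csum _ _.
by field.
Qed.

(** In the inner summands the shifts of both factors cancel by [Cv_shift]. In the two extreme
    summands one factor is [d0] and has no shift; there the shift of the other one lowers the degree
    of [Cv], which is the index of the first, respectively last, entry. *)
Lemma fR_derive bt nx ny t : (0 < t)%R ->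
  @is_derive R_AbsRing C_R_NormedModule (fR bt nx.+1 ny.+1) t
    ((fR bt nx ny.+1 t - fR bt nx.+1 ny t) / RtoC t).
Proof.
move=> t0.
have tn : RtoC t <> 0 by move/RtoC_inj; lra.
have HbM : forall q, List.In q (bl M) -> npos q.2 by apply: bl_npos.
have HaM : forall q, List.In q (al M) -> npos q.2 by apply: al_npos.
have SL n (L : seq (nat * C)) w : npos w -> (forall q, List.In q L -> npos q.2) -> forall k,
  @is_derive R_AbsRing C_R_NormedModule (fun u => SEs ((n.+1, w) :: L) u k) t
   (/ RtoC t * SEs ((n, w) :: L) t k + (- / RtoC t) * shift (SEs ((n.+1, w) :: L) t) k).
  by move=> Hw HL k; apply: (R_der_eq (SEs_derive n k t0 Hw HL)); rewrite /Cdiv; ring.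
have SR e n (L : seq (nat * C)) w : npos w -> (forall q, List.In q L -> npos q.2) -> forall k,
  @is_derive R_AbsRing C_R_NormedModule (fun u => sgn (e + n.+1) * SEs ((n.+1, w) :: L) u k) t
   ((- / RtoC t) * (sgn (e + n) * SEs ((n, w) :: L) t k)
    + (- / RtoC t) * shift (fun k => sgn (e + n.+1) * SEs ((n.+1, w) :: L) t k) k).
  move=> Hw HL k; apply: (R_der_eq (R_der_mult (R_der_const _ t) (SL n L w Hw HL k))).
  by rewrite addnS sgnS; case: k => [|k] /=; ring.
have C0 k : @is_derive R_AbsRing C_R_NormedModule (fun _ => d0 k) t ((fun _ => RtoC 0) k).
  exact: R_der_const.
have D1 := Cv_der bt nx.+1 C0 (SR (wt M) ny (bl M) by' Hby HbM).
have D3 := Cv_der bt ny.+1 (SL nx (al M) ax Hax HaM) C0.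
rewrite (@Cv_0L bt nx.+1 (fun _ => RtoC 0)) // Cv_addR Cv_shiftR in D1.
rewrite (@Cv_0R bt ny.+1 _ (fun _ => RtoC 0)) // Cv_addL Cv_shiftL in D3.
have D2 : @is_derive R_AbsRing C_R_NormedModule
  (fun t => csum (fun j => Cv bt (nth (0%nat, RtoC 0, RtoC 0) M j).1.1 (SEs ((nx.+1, ax) :: al (take j M)) t)
      (fun k => sgn (wt (drop j.+1 M) + ny.+1) * SEs ((ny.+1, by') :: bl (drop j.+1 M)) t k)) (size M)) t
  (csum (fun j => (Cv bt (nth (0%nat, RtoC 0, RtoC 0) M j).1.1 (SEs ((nx, ax) :: al (take j M)) t)
      (fun k => sgn (wt (drop j.+1 M) + ny.+1) * SEs ((ny.+1, by') :: bl (drop j.+1 M)) t k)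
     - Cv bt (nth (0%nat, RtoC 0, RtoC 0) M j).1.1 (SEs ((nx.+1, ax) :: al (take j M)) t)
      (fun k => sgn (wt (drop j.+1 M) + ny) * SEs ((ny, by') :: bl (drop j.+1 M)) t k)) / RtoC t) (size M)).
  apply: csum_der => j _.
  have HbD : forall q, List.In q (bl (drop j.+1 M)) -> npos q.2 by apply: bl_npos => q; apply: In_drop.
  have HaT : forall q, List.In q (al (take j M)) -> npos q.2 by apply: al_npos => q; apply: In_take.
  apply: (R_der_eq (Cv_der bt _ (SL nx _ ax Hax HaT) (SR (wt (drop j.+1 M)) ny _ by' Hby HbD))).
  rewrite Cv_addL Cv_addR.
  exact: (cancel_pair _ _ _ (Cv_shift bt _ _ _)).
apply: (R_der_eq (R_der_plus (R_der_plus D1 D2) D3)).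
rewrite csum_div_sub /fR.
set S1 := csum _ _; set S2 := csum _ _.
by change [eta d0] with d0; rewrite /Cdiv; ring.
Qed.

Lemma fZ_at0 nx ny : fZ nx ny 0 = 0.
Proof.
rewrite /fZ !full_at0 // csum_zero; first by ring.
by move=> k _; rewrite lam_at0; ring.
Qed.

Lemma fR_at0 bt nx ny : fR bt nx ny 0 = 0.
Proof.
rewrite /fR Cv_0R; last by move=> k; rewrite SEs_at0; ring.
rewrite csum_zero; last by move=> k _; apply: Cv_0L => j; rewrite SEs_at0.
by rewrite Cv_0L; [ring | move=> k; rewrite SEs_at0].
Qed.

Lemma fZ_cont nx ny t : (0 <= t)%R -> continuous (fZ nx ny) t.
Proof.
move=> t0.
have HbM : forall q, List.In q (bl M) -> npos q.2 by apply: bl_npos.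
have HaM : forall q, List.In q (al M) -> npos q.2 by apply: al_npos.
apply: C_cont_plus; last by apply: full_cont => // q [<-|/HaM].
apply: C_cont_plus.
  apply: C_cont_mult; first exact: C_cont_const.
  by apply: full_cont => // q [<-|/HbM].
apply: csum_cont => j _.
have HbD : forall q, List.In q (bl (drop j M)) -> npos q.2 by apply: bl_npos => q; apply: In_drop.
have HaT : forall q, List.In q (al (take j M)) -> npos q.2 by apply: al_npos => q; apply: In_take.
apply: C_cont_mult; first by apply: lam_cont_s; apply: npos_ok => // q [<-|/HaT].
apply: C_cont_mult; first exact: C_cont_const.
by apply: lam_cont_s; apply: npos_ok => // q [<-|/HbD].
Qed.

Lemma fR_cont bt nx ny t : (0 <= t)%R -> continuous (fR bt nx ny) t.
Proof.
move=> t0.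
have HbM : forall q, List.In q (bl M) -> npos q.2 by apply: bl_npos.
have HaM : forall q, List.In q (al M) -> npos q.2 by apply: al_npos.
apply: C_cont_plus; first apply: C_cont_plus.
- apply: (Cv_cont _ _ (L := fun _ => d0)) => k; first exact: C_cont_const.
  apply: C_cont_mult; first exact: C_cont_const.
  by apply: SEs_cont => // q [<-|/HbM].
- apply: csum_cont => j _.
  have HbD : forall q, List.In q (bl (drop j.+1 M)) -> npos q.2 by apply: bl_npos => q; apply: In_drop.
  have HaT : forall q, List.In q (al (take j M)) -> npos q.2 by apply: al_npos => q; apply: In_take.
  apply: Cv_cont => k; first by apply: SEs_cont => // q [<-|/HaT].
  apply: C_cont_mult; first exact: C_cont_const.
  by apply: SEs_cont => // q [<-|/HbD].
- apply: (Cv_cont _ _ (R := fun _ => d0)) => k; last exact: C_cont_const.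
  by apply: SEs_cont => // q [<-|/HaM].
Qed.

(* Both sides vanish at [t = 0] and have the same derivative. *)
Lemma fZ_fR bt nx ny :
  (forall t, (0 < t)%R -> fZ nx ny.+1 t = - fR bt nx ny.+1 t) ->
  (forall t, (0 < t)%R -> fZ nx.+1 ny t = - fR bt nx.+1 ny t) ->
  fZ nx.+1 ny.+1 1 = - fR bt nx.+1 ny.+1 1.
Proof.
move=> H1 H2.
have : fZ nx.+1 ny.+1 1 + fR bt nx.+1 ny.+1 1 = fZ nx.+1 ny.+1 0 + fR bt nx.+1 ny.+1 0.
  apply: (@R_der_zero (fun u => fZ nx.+1 ny.+1 u + fR bt nx.+1 ny.+1 u)) => [t [t0 _]|].
    apply: (R_der_eq (R_der_plus (fZ_derive nx ny t0) (fR_derive bt nx ny t0))).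
    by rewrite H1 // H2 // /Cdiv; ring.
  by apply: C_cont_plus; [apply: fZ_cont | apply: fR_cont]; lra.
rewrite fZ_at0 fR_at0 => E.
have -> : fZ nx.+1 ny.+1 1 = (fZ nx.+1 ny.+1 1 + fR bt nx.+1 ny.+1 1) - fR bt nx.+1 ny.+1 1 by ring.
by rewrite E; ring.
Qed.

End Scaling.

Arguments csum : simpl never.

(** Minus the regularised sum of [T ^ k / k ^ n] over all nonzero integers [k]. With this definition
    the induction of [key] is free of Bernoulli polynomials; [bt_beta] identifies the function
    afterwards. *)
Definition bt (T : C) (n : nat) : C := - (lam [:: (n, T)] 1 + sgn n * lam [:: (n, / T)] 1).

(** Compatibility of prefix and suffix products: [c] is the product of the arguments before the
    current entry, so the inverse of the product from this entry on is [c / T]. *)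
Fixpoint chain (T c : C) (E : seq elt) : Prop :=
  if E is q :: E' then q.2 = c / T /\ chain T q.1.2 E' else c = T.

Definition wfE (T : C) (E : seq elt) : Prop :=
  [/\ E <> [::], chain T 1 E, npos T & forall q, List.In q E -> npos q.1.2 /\ npos q.2].

Definition scM (t : R) (M : seq elt) : seq elt :=
  [seq (q.1.1, RtoC t * q.1.2, RtoC t * q.2) | q <- M].

Lemma Cv0 (b L R : nat -> C) : Cv b 0 L R = b 0%nat * (L 0%nat * R 0%nat).
Proof. by transitivity (0 + (0 + b 0%nat * 1 * (L 0%nat * R 0%nat))); [|ring]. Qed.

Lemma lam_nil s : lam [::] s = 1.
Proof. by rewrite /lam /=; ring. Qed.

Lemma wt_scM t M : wt (scM t M) = wt M.
Proof. by rewrite /wt /scM -map_comp. Qed.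

Lemma wt_rcons M q : wt (rcons M q) = (wt M + q.1.1)%nat.
Proof. by rewrite /wt map_rcons sumn_rcons. Qed.

Lemma al_scM t M : al (scM t M) = [seq (q.1, RtoC t * q.2) | q <- al M].
Proof. by rewrite /al /scM -!map_comp. Qed.

Lemma bl_scM t M : bl (scM t M) = [seq (q.1, RtoC t * q.2) | q <- bl M].
Proof. by rewrite /bl /scM -!map_comp map_rev -map_comp. Qed.

Lemma bl_rcons M q : bl (rcons M q) = (q.1.1, q.2) :: bl M.
Proof. by rewrite /bl map_rcons rev_rcons. Qed.

Lemma bl_cons M q : bl (q :: M) = bl M ++ [:: (q.1.1, q.2)].
Proof. by rewrite /bl /= rev_cons cats1. Qed.

Lemma lam_sc t L : (0 < t)%R -> (forall q, List.In q L -> npos q.2) ->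
  lam [seq (q.1, RtoC t * q.2) | q <- L] 1 = lam L t.
Proof.
move=> t0 HL; rewrite lam_dil ?Rmult_1_r //; apply: npos_ok; last lra.
by move=> q /List.in_map_iff [p [<- /HL Hp]]; apply: npos_scale.
Qed.

Lemma SE_map L (phi : seq (nat * C) -> C) (t : C) k :
  SE [seq (q.1, t * q.2) | q <- L] phi k = SE L (fun M => phi [seq (q.1, t * q.2) | q <- M]) k.
Proof.
elim: L phi k => [|q L IH] phi k //.
apply: (@csum_ext (fun l => gc q.1 l *
  SE [seq (q.1, t * q.2) | q <- L] (fun M => phi (((q.1 + l)%nat, t * q.2) :: M)) (k - l))) => l _.
by rewrite IH.
Qed.

Lemma SEs_sc t L k : (0 < t)%R -> (forall q, List.In q L -> npos q.2) ->
  SEs [seq (q.1, RtoC t * q.2) | q <- L] 1 k = SEs L t k.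
Proof.
move=> t0 HL; rewrite /SEs SE_map; apply: SE_ext => M HM.
by apply: lam_sc => //; apply: same_npos HM HL.
Qed.

Section Link.
Variables (ax bx ay by' : C) (M : seq elt).
Hypothesis Hax : npos ax.
Hypothesis Hbx : npos bx.
Hypothesis Hay : npos ay.
Hypothesis Hby : npos by'.
Hypothesis HM : forall q, List.In q M -> npos q.1.2 /\ npos q.2.
Variables (nx ny : nat) (t : R).
Hypothesis t0 : (0 < t)%R.

Let E : seq elt := (nx, RtoC t * ax, bx) :: rcons (scM t M) (ny, ay, RtoC t * by').

Lemma drop_scM j : (j <= size M)%nat ->
  drop j (rcons (scM t M) (ny, ay, RtoC t * by')) = rcons (scM t (drop j M)) (ny, ay, RtoC t * by').
Proof. by move=> Hj; rewrite drop_rcons ?size_map // /scM map_drop. Qed.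

Lemma take_scM j : (j <= size M)%nat ->
  take j (rcons (scM t M) (ny, ay, RtoC t * by')) = scM t (take j M).
Proof. by move=> Hj; rewrite -cats1 takel_cat ?size_map // /scM map_take. Qed.

Lemma al_take_npos j : forall q, List.In q ((nx, ax) :: al (take j M)) -> npos q.2.
Proof.
by move=> q [<-//|]; apply: (al_npos HM) => p; apply: In_take.
Qed.

Lemma bl_drop_npos j : forall q, List.In q ((ny, by') :: bl (drop j M)) -> npos q.2.
Proof.
by move=> q [<-//|]; apply: (bl_npos HM) => p; apply: In_drop.
Qed.

Lemma al_all_npos : forall q, List.In q ((nx, ax) :: al M) -> npos q.2.
Proof. by have := @al_take_npos (size M); rewrite take_size. Qed.

Lemma bl_all_npos : forall q, List.In q ((ny, by') :: bl M) -> npos q.2.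
Proof. by have := @bl_drop_npos 0; rewrite drop0. Qed.

Lemma Zs_scaled : Zs E = fZ ax bx ay by' M nx ny t.
Proof.
rewrite /Zs /fZ (_ : size E = (size M).+2); last by rewrite /E /= size_rcons size_map.
rewrite csum_recl csum_recr Cplus_assoc; congr (_ + _ + _).
- rewrite take0 drop0 /E /wt /= map_rcons sumn_rcons -/(wt (scM t M)) wt_scM.
  by rewrite bl_cons bl_rcons bl_scM lam_nil Cmult_1_l.
- apply: csum_ext => j Hj; have {}Hj : (j <= size M)%nat by lia.
  rewrite /E /= take_scM // drop_scM // wt_rcons wt_scM bl_rcons al_scM bl_scM /=.
  have := lam_sc t0 (@al_take_npos j); have := lam_sc t0 (@bl_drop_npos j).
  by rewrite /= => -> ->.
- rewrite /E take_oversize ?drop_oversize /= ?size_rcons ?size_map //.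
  rewrite /full /al /= map_rcons -cats1 /= -/(al (scM t M)) al_scM.
  by rewrite ?lam_nil /sgn /= ?lam_nil !Cmult_1_r.
Qed.

Lemma Rs_scaled b : Rs b E = fR ax by' M b nx ny t.
Proof.
rewrite /Rs /fR (_ : size E = (size M).+2); last by rewrite /E /= size_rcons size_map.
rewrite csum_recl csum_recr Cplus_assoc; congr (_ + _ + _).
- rewrite take0 drop1 /E /= wt_rcons wt_scM bl_rcons bl_scM /=.
  apply: Cv_ext => k; first exact: SEs_nil.
  by have := SEs_sc k t0 bl_all_npos; rewrite /= => ->.
- apply: csum_ext => j Hj.
  rewrite /E /= take_scM; last exact: ltnW. rewrite drop_scM //.
  rewrite nth_rcons size_map Hj wt_rcons wt_scM bl_rcons al_scM bl_scM /=.
  rewrite (nth_map (0%nat, RtoC 0, RtoC 0)) //.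
  apply: Cv_ext => k.
    by have := SEs_sc k t0 (@al_take_npos j); rewrite /= => ->.
  by have := SEs_sc k t0 (@bl_drop_npos j.+1); rewrite /= => ->.
- rewrite /E /= nth_rcons size_map ltnn eqxx take_scM // take_size drop_oversize; last first.
    by rewrite size_rcons size_map.
  rewrite al_scM; apply: Cv_ext => k.
    by have := SEs_sc k t0 al_all_npos; rewrite /= => ->.
  by rewrite /wt /bl /= SEs_nil /sgn /=; ring.
Qed.
End Link.

Lemma bt0 T : npos T -> bt T 0 = 1.
Proof.
move=> HT; have T0 := npos_neq0 HT.
have d1 : 1 - T <> 0.
  move=> H; apply: HT; exists 1%R; split; [lra|].
  by rewrite -(Cplus_0_r T) -H; ring.
rewrite /bt !lam0 /lam /= /kw /sgn /=.
have d2 : T - 1 <> 0.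
  by move=> H; apply: d1; transitivity (- (T - 1)); [ring | rewrite H; ring].
by field; split.
Qed.

Lemma lam_inner (A : seq (nat * C)) m w v : w <> v ->
  ok 1 (A ++ [:: (m, w); (0%nat, v)]) ->
  lam (A ++ [:: (m, w); (0%nat, v)]) 1
   = (w * lam (A ++ [:: (m, v)]) 1 - v * lam (A ++ [:: (m, w)]) 1) / (v - w).
Proof.
move=> ne H; have d : v - w <> 0 by apply: Cminus_eq_contra => E; apply: ne.
by rewrite -lam_inner0 //; field.
Qed.

Lemma bl_In E q : List.In q (bl E) -> exists2 p, List.In p E & q = (p.1.1, p.2).
Proof.
rewrite /bl -map_rev => /List.in_map_iff [p [<- Hp]]; exists p => //.
elim: E Hp => [|a K IH] //=; rewrite rev_cons -cats1 => /In_cat [/IH|[]]; by [right|left|].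
Qed.

Lemma npos1 w : npos w -> 1 - w <> 0.
Proof.
move=> Hw H; apply: Hw; exists 1%R; split; [lra|].
by rewrite -(Cplus_0_r w) -H; ring.
Qed.

(** * Index 0 at the head, and the reflection of summation indices *)

Section Head.
Variables (T ax bx am bm : C) (m : nat) (E1 : seq elt).
Let E : seq elt := (0%nat, ax, bx) :: (m, am, bm) :: E1.
Let E' : seq elt := (m, am, bx) :: E1.
Hypothesis HE : wfE T E.

Lemma head_npos : [/\ npos T, npos ax & npos bx].
Proof. by case: HE => _ _ HT H; have [] := H _ (or_introl erefl). Qed.

Lemma wf_head : wfE T E'.
Proof.
case: HE => _ /= [H1 [H2 H3]] HT H; split => //= q [<-|Hq] /=.
  split; last by have [] := H _ (or_introl erefl).
  by have [] := H _ (or_intror (or_introl erefl)).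
by apply: H; right; right.
Qed.

(** Summing the geometric series over [k_1 > k_2] gives the factor [ax / (1 - ax)] and absorbs the
    first argument into the second one. The forbidden value [k_1 = 0] has to be taken out; it occurs
    exactly when all other indices are negative, which is the subtracted term. *)
Lemma head_Z : Zs E = kw ax 1 * Zs E' - sgn (wt ((m, am, bm) :: E1)) * lam (bl ((m, am, bm) :: E1)) 1.
Proof.
have [HT Hax Hbx] := head_npos.
have T0 := npos_neq0 HT; have d1 := npos1 Hax.
case: HE => _ /= [Ebx [Ebm _]] _ Hn.
have Hbm : npos bm by have [] := Hn _ (or_intror (or_introl erefl)).
rewrite /Zs; change (size E).+1 with (size E1).+3; change (size E').+1 with (size E1).+2.
rewrite csum_recl (csum_recl _ (size E1).+1) [in RHS]csum_recl.
rewrite take0 drop0 /E /E' [take 1 _]/= [drop 1 _]/= [take 0 _]/= [drop 0 _]/= ?take0 ?drop0 -/E.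
rewrite [al [::]]/= lam_nil [al [:: _]]/=.
have -> : bl E = bl E1 ++ [:: (m, bm); (0%nat, bx)].
  by rewrite /E !bl_cons -catA.
(* In the summand without positive indices the entry with index 0 is innermost, so partial fractions
   apply; the other summands have it outermost, where [lam0] does. *)
rewrite lam_inner; last first.
- apply: npos_ok; last lra.
  move=> q /In_cat [/bl_In [p Hp ->] /=|[<-|[<-|[]]]] //.
  by have [] := Hn _ (or_intror (or_intror Hp)).
- rewrite Ebx Ebm => /(f_equal (fun z => T * z)) H; apply: d1.
  have -> : ax = T * (ax / T) by field.
  by rewrite H; field.
rewrite /E' !bl_cons /= -/(al _).
have -> : wt E = wt ((m, am, bm) :: E1) by [].
have -> : wt ((m, am, bx) :: E1) = wt ((m, am, bm) :: E1) by [].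
rewrite (_ : csum _ (size E1).+1 = kw ax 1 * csum (fun k => lam (al ((m, am, bx) :: take k E1)) 1 *
    (sgn (wt (drop k E1)) * lam (bl (drop k E1)) 1)) (size E1).+1); last first.
  rewrite -csum_scal; apply: csum_ext => k _.
  by rewrite /= lam0 /=; ring.
rewrite lam0 /= (_ : lam [::] 1 = 1); last by rewrite /lam /=; ring.
set X := lam (bl E1 ++ [:: (m, bx)]) 1; set Y := lam (bl E1 ++ [:: (m, bm)]) 1.
set S := csum _ _; set s := sgn _.
rewrite Ebx Ebm /kw.
have d2 : 1 / T - ax / T <> 0.
  by move=> H; apply: d1; transitivity (T * (1 / T - ax / T)); [field | rewrite H; ring].
by field; repeat split.
Qed.

(** The summand at position 0 is a coefficient of degree 0, namely [b 0] times the all-negative sum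
    of the tail: this matches the term taken out in [head_Z]. The other summands contain the
    geometric factor. *)
Lemma head_R (b : nat -> C) : b 0%nat = 1 ->
  Rs b E = sgn (wt ((m, am, bm) :: E1)) * lam (bl ((m, am, bm) :: E1)) 1 + kw ax 1 * Rs b E'.
Proof.
move=> b0.
rewrite /Rs; change (size E) with (size E').+1; rewrite csum_recl; congr (_ + _).
  by rewrite take0 drop1 [(nth _ E 0).1.1]/= Cv0 b0 SEs_nil /SEs SE_k0 /=; ring.
rewrite -csum_scal; apply: csum_ext => j _ /=.
have E1' : al (take j ((m, am, bm) :: E1)) = al (take j E') by case: (j).
have E2 : (nth (0%nat, RtoC 0, RtoC 0) ((m, am, bm) :: E1) j).1.1
  = (nth (0%nat, RtoC 0, RtoC 0) E' j).1.1 by case: (j).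
rewrite E1' E2.
set R := fun k => _; set L := SEs (al (take j E')) 1.
transitivity (Cv b (nth (0%nat, RtoC 0, RtoC 0) E' j).1.1 (fun k => kw ax 1 * L k + 0 * L k) R).
  by apply: Cv_ext => k //; rewrite SEs0 /L; ring.
by rewrite Cv_addL; ring.
Qed.

End Head.

(** The reflection [k -> - k]: it reverses the order, exchanges prefix products with inverse suffix
    products, and replaces [T] by [/ T]. *)
Definition starE (E : seq elt) : seq elt := rev [seq (q.1.1, q.2, q.1.2) | q <- E].

Lemma size_starE E : size (starE E) = size E.
Proof. by rewrite size_rev size_map. Qed.

Lemma al_take_star E i : (i <= size E)%nat -> al (take i (starE E)) = bl (drop (size E - i) E).
Proof.
move=> Hi; rewrite /starE take_rev size_map /al /bl map_rev -map_drop -map_comp.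
by [].
Qed.

Lemma bl_drop_star E i : (i <= size E)%nat -> bl (drop i (starE E)) = al (take (size E - i) E).
Proof.
move=> Hi; rewrite /starE drop_rev size_map /al /bl map_rev -map_take revK -map_comp.
by [].
Qed.

Lemma wt_rev E : wt (rev E) = wt E.
Proof. by rewrite /wt map_rev sumn_rev. Qed.

Lemma wt_star E : wt (starE E) = wt E.
Proof. by rewrite wt_rev /wt -map_comp. Qed.

Lemma wt_cat E F : wt (E ++ F) = (wt E + wt F)%nat.
Proof. by rewrite /wt map_cat sumn_cat. Qed.

Lemma wt_drop_star E i : (i <= size E)%nat -> wt (drop i (starE E)) = wt (take (size E - i) E).
Proof. by move=> Hi; rewrite /starE drop_rev size_map wt_rev -map_take /wt -map_comp. Qed.

Lemma Zs_star E : Zs (starE E) = sgn (wt E) * Zs E.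
Proof.
rewrite /Zs size_starE csum_rev -csum_scal; apply: csum_ext => i Hi.
have Hi' : (i <= size E)%nat by [].
rewrite subSS al_take_star ?leq_subr // bl_drop_star ?leq_subr // wt_drop_star ?leq_subr //.
have sE : sgn (wt E) = sgn (wt (take i E)) * sgn (wt (drop i E)).
  by rewrite -sgnD -wt_cat cat_take_drop.
rewrite subKn // sE.
transitivity (lam (bl (drop i E)) 1 * (sgn (wt (take i E)) * lam (al (take i E)) 1) * (sgn (wt (drop i E)) * sgn (wt (drop i E)))).
  by rewrite sgn_sq; ring.
by ring.
Qed.

Lemma Rs_star b E : Rs (fun a => sgn a * b a) (starE E) = sgn (wt E) * Rs b E.
Proof.
rewrite /Rs size_starE csum_rev -csum_scal; apply: csum_ext => i Hi.
have le1 : (size E - i.+1 <= size E)%nat by apply: leq_subr.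
have le2 : ((size E - i.+1).+1 <= size E)%nat by lia.
rewrite al_take_star // bl_drop_star // wt_drop_star //.
have -> : (size E - (size E - i.+1) = i.+1)%nat by lia.
have -> : (size E - (size E - i.+1).+1 = i)%nat by lia.
have -> : (nth (0%nat, RtoC 0, RtoC 0) (starE E) (size E - i.+1)).1.1 = (nth (0%nat, RtoC 0, RtoC 0) E i).1.1.
  rewrite /starE nth_rev size_map; last by lia.
  have -> : (size E - (size E - i.+1).+1 = i)%nat by lia.
  by rewrite (nth_map (0%nat, RtoC 0, RtoC 0)).
set n := (nth _ E i).1.1; set L := SEs (al _) 1; set R := SEs (bl _) 1.
transitivity (Cv (fun a => sgn a * b a) n R (fun k => sgn (wt (take i E)) * L k + 0 * L k)).
  by apply: Cv_ext => // k; ring.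
rewrite Cv_addR Cv_swap.
transitivity (sgn (wt E) * Cv b n L (fun k => sgn (wt (drop i.+1 E)) * R k + 0 * R k)); last first.
  by congr (_ * _); apply: Cv_ext => // k; ring.
rewrite Cv_addR.
have -> : sgn (wt E) = sgn (wt (take i E)) * sgn n * sgn (wt (drop i.+1 E)).
  rewrite -!sgnD -addnA; congr (sgn _); rewrite -[in LHS](cat_take_drop i E) wt_cat.
  by rewrite (drop_nth (0%nat, RtoC 0, RtoC 0)).
transitivity (sgn (wt (take i E)) * sgn n * Cv b n L R * (sgn (wt (drop i.+1 E)) * sgn (wt (drop i.+1 E)))).
  by rewrite sgn_sq; ring.
by ring.
Qed.

Lemma bt_inv T n : npos T -> bt (/ T) n = sgn n * bt T n.
Proof.
move=> /npos_neq0 T0; rewrite /bt (_ : / / T = T); last by field.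
transitivity (- (sgn n * sgn n * lam [:: (n, / T)] 1 + sgn n * lam [:: (n, T)] 1)); last by ring.
by rewrite sgn_sq; ring.
Qed.

Lemma chain_star T c E K : npos T -> chain T c E -> chain (/ T) (c / T) K ->
  chain (/ T) 1 (catrev [seq (q.1.1, q.2, q.1.2) | q <- E] K).
Proof.
move=> /npos_neq0 T0.
elim: E c K => [|q E IH] c K /= => [-> |[Eq HE] HK].
  by rewrite (_ : T / T = 1) //; field.
apply: IH HE _; split => /=; first by field.
by rewrite Eq.
Qed.

Lemma wf_star T E : wfE T E -> wfE (/ T) (starE E).
Proof.
case=> ne ch HT Hn; split.
- by move: ne; case: (E) => // q E0 _ /(f_equal size); rewrite size_starE.
- rewrite /starE /rev; apply: chain_star ch _ => //=.
  by rewrite /Cdiv Cmult_1_l.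
- exact: npos_inv.
move=> q; rewrite /starE -map_rev => /List.in_map_iff [p [<- Hp]] /=.
have /Hn [] : List.In p E => //.
elim: (E) Hp => [|a K IH] //=; rewrite rev_cons -cats1 => /In_cat [/IH|[]]; by [right|left|].
Qed.

Lemma chain_scale T t c M q : chain T c (rcons M q) -> chain T (RtoC t * c) (rcons (scM t M) (q.1.1, q.1.2, RtoC t * q.2)).
Proof.
elim: M c => [|p M IH] c /= [-> H]; split=> //; try by rewrite /Cdiv; ring.
exact: IH.
Qed.

Lemma Cv_d0 (b : nat -> C) N : Cv b N d0 d0 = b N.
Proof.
rewrite /Cv csum_recl subn0 csum_recl [X in _ + X + _]csum_zero; last by move=> k _ /=; ring.
rewrite csum_zero; last by move=> k _; apply: csum_zero => j _ /=; ring.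
by rewrite !subn0 /sgn /=; ring.
Qed.

Lemma scM1 M : scM 1 M = M.
Proof.
by rewrite /scM -[RHS]map_id; apply: eq_map => -[[n a] b] /=; rewrite !Cmult_1_l.
Qed.

Lemma In_rcons (S : Type) (x y : S) s : List.In x (rcons s y) <-> List.In x s \/ x = y.
Proof.
rewrite -cats1; split=> [/In_cat [H|[<-|[]]]|[H|->]]; [by left|by right| |].
  by apply/In_cat; left.
by apply/In_cat; right; left.
Qed.

Lemma chain_exp T c M ny ny' ay by' : chain T c (rcons M (ny, ay, by')) -> chain T c (rcons M (ny', ay, by')).
Proof. by elim: M c => [|p M IH] c //= [-> H]; split=> //; apply: IH. Qed.

Lemma wf_scaled T t nx nx' ny ny' ax bx ay by' M : (0 < t)%R ->
  wfE T ((nx, ax, bx) :: rcons M (ny, ay, by')) ->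
  wfE T ((nx', RtoC t * ax, bx) :: rcons (scM t M) (ny', ay, RtoC t * by')).
Proof.
move=> t0 [_ /= [Eb ch] HT Hn]; split=> //=.
  by split=> //; apply: chain_exp (chain_scale t ch).
have [hx1 hx2] := Hn _ (or_introl erefl).
have [hy1 hy2] := Hn (ny, ay, by') (or_intror ((In_rcons _ _ _).2 (or_intror erefl))).
move=> q [<-|/In_rcons [/List.in_map_iff [p [<- Hp]]|->]] /=.
- by split => //; apply: npos_scale.
- have [h1 h2] := Hn p (or_intror ((In_rcons _ _ _).2 (or_introl Hp))).
  by split; apply: npos_scale.
- by split => //; apply: npos_scale.
Qed.

Lemma wf_npos T nx ny ax bx ay by' M : wfE T ((nx, ax, bx) :: rcons M (ny, ay, by')) ->
  [/\ npos ax, npos bx, npos ay, npos by' & forall q, List.In q M -> npos q.1.2 /\ npos q.2].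
Proof.
move=> [_ _ HT Hn].
have [hx1 hx2] := Hn _ (or_introl erefl).
have [hy1 hy2] := Hn (ny, ay, by') (or_intror ((In_rcons _ _ _).2 (or_intror erefl))).
by split => // q Hq; apply: Hn; right; apply/In_rcons; left.
Qed.

(* The regularised sum of [\prod_i z_i ^ k_i / k_i ^ n_i] over all decreasing
   sequences of nonzero integers, evaluated by partial fractions in the
   outermost index. *)
Theorem key T E : wfE T E -> Zs E = - Rs (bt T) E.
Proof.
have [N] := ubnP (wt E + size E).
elim: N T E => // N IH T E HN HE.
case: E HE HN => [|x E] HE HN; first by case: HE.
case/lastP: E HE HN => [|M y] HE HN.
  (* In depth one both sides agree by the definition of [bt]. *)
  case: HE => _ /= [Eb Ea] HT _; move: Eb Ea {HN}; case: x => [[n a] b] /= -> ->.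
  have -> : Rs (bt T) [:: (n, T, 1 / T)] = 0 + Cv (bt T) n (SEs [::] 1) (fun k => 1 * SEs [::] 1 k) by [].
  have -> : Zs [:: (n, T, 1 / T)] = 0 + lam [::] 1 * (sgn (n + 0) * lam [:: (n, 1 / T)] 1)
     + lam [:: (n, T)] 1 * (1 * lam [::] 1) by [].
  rewrite (@Cv_ext _ _ _ d0 _ d0); [|exact: SEs_nil|by move=> k; rewrite SEs_nil; ring].
  rewrite Cv_d0 lam_nil addn0 (_ : 1 / T = / T); last by rewrite /Cdiv Cmult_1_l.
  by rewrite /bt; ring.
(* Stated for arbitrary [T'], since the reflected list of a later case belongs to [/ T]. *)
have Hhead : forall T' ax bx m E1, wfE T' ((0%nat, ax, bx) :: m :: E1) ->
    (wt (m :: E1) + size (m :: E1) < N)%nat ->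
    Zs ((0%nat, ax, bx) :: m :: E1) = - Rs (bt T') ((0%nat, ax, bx) :: m :: E1).
  move=> T' ax bx [[m am] bm] E1 HE' HN'.
  have [HT' _ _] := head_npos HE'.
  rewrite (head_Z HE') (head_R ax bx am bm m E1 (bt0 HT')) (IH T' _ _ (wf_head HE')) //.
  by ring.
case: x HE HN => [[nx ax] bx] HE HN; case: y HE HN => [[ny ay] by'] HE HN.
case: nx HE HN => [|nx] HE HN.
  case: (rcons M (ny, ay, by')) (size_rcons M (ny, ay, by')) HE HN => [|m E1] // _ HE HN.
  by apply: Hhead => //; move: HN; rewrite /wt /= addnS ltnS.
(* A last index 0 is moved to the head by reflection; both sides change by the same sign, because
   [bt (/ T) n = sgn n * bt T n]. *)
case: ny HE HN => [|ny] HE HN.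
  have HS := wf_star HE.
  have : Zs (starE ((nx.+1, ax, bx) :: rcons M (0%nat, ay, by')))
     = - Rs (bt (/ T)) (starE ((nx.+1, ax, bx) :: rcons M (0%nat, ay, by'))).
    have ws := wt_star ((nx.+1, ax, bx) :: rcons M (0%nat, ay, by')).
    have ss := size_starE ((nx.+1, ax, bx) :: rcons M (0%nat, ay, by')).
    have E0 : starE ((nx.+1, ax, bx) :: rcons M (0%nat, ay, by'))
      = (0%nat, by', ay) :: rcons (starE M) (nx.+1, bx, ax).
      by rewrite /starE /= map_rcons rev_cons rev_rcons.
    rewrite E0 in HS ws ss *.
    case: (rcons (starE M) _) (size_rcons (starE M) (nx.+1, bx, ax)) HS ws ss => [|m E1] // _ HS ws ss.
    apply: Hhead => //.
    have : (wt ((0%nat, by', ay) :: m :: E1) + size ((0%nat, by', ay) :: m :: E1) < N.+1)%nat by rewrite ws ss.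
    by rewrite /wt /= addnS ltnS.
  rewrite Zs_star (_ : Rs (bt (/ T)) _ = Rs (fun a => sgn a * bt T a) (starE ((nx.+1, ax, bx) :: rcons M (0%nat, ay, by')))).
    rewrite Rs_star; set s := sgn _; set z := Zs _; set r := Rs _ _ => H.
    transitivity (s * s * z); first by rewrite sgn_sq; ring.
    rewrite -Cmult_assoc H; transitivity (- (s * s * r)); [by ring | by rewrite sgn_sq; ring].
  have HT : npos T by case: HE.
  apply: csum_ext => i _; apply: csum_ext => k1 _; apply: csum_ext => k2 _.
  by rewrite bt_inv.
have [hax hbx hay hby hM] := wf_npos HE.
have E1 : (nx.+1, ax, bx) :: rcons M (ny.+1, ay, by')
   = (nx.+1, RtoC 1 * ax, bx) :: rcons (scM 1 M) (ny.+1, ay, RtoC 1 * by').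
  by rewrite scM1 !Cmult_1_l.
have size_wt n n' t : (wt ((n, (RtoC t * ax)%C, bx) :: rcons (scM t M) (n', ay, (RtoC t * by')%C))
    + size ((n, (RtoC t * ax)%C, bx) :: rcons (scM t M) (n', ay, (RtoC t * by')%C))
    = n + wt M + n' + (size M).+2)%nat.
  by rewrite {1}/wt /= -/(wt _) wt_rcons wt_scM size_rcons size_map /=; lia.
have HN' : (nx + wt M + ny + (size M).+2 + 2 < N.+1)%nat.
  by have := size_wt nx.+1 ny.+1 1%R; rewrite -E1 => E2; move: HN; rewrite E2; lia.
(* Both end indices are positive: the list is its own scaling at [t = 1], and for every [t > 0] the
   induction hypothesis applies to the two lists with one end index lowered. *)
rewrite E1 Zs_scaled ?Rs_scaled //; try lra.
apply: fZ_fR => // t t0.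
  have W := wf_scaled nx ny.+1 t0 HE.
  have := IH T _ _ W; rewrite size_wt Zs_scaled ?Rs_scaled //; apply; lia.
have W := wf_scaled nx.+1 ny t0 HE.
have := IH T _ _ W; rewrite size_wt Zs_scaled ?Rs_scaled //; apply; lia.
Qed.

(** * The inversion formula and Bernoulli polynomials *)

Lemma big_csum (f : nat -> C) n : \big[Cplus/RtoC 0]_(k < n) f k = csum f n.
Proof.
elim: n f => [|n IH] f; first by rewrite big_ord0.
by rewrite big_ord_recl csum_recl (IH (fun k => f k.+1)).
Qed.

Lemma big_Rplus_C (f : nat -> R) n : RtoC (\big[Rplus/0%R]_(k < n) f k) = csum (fun k => RtoC (f k)) n.
Proof.
elim: n f => [|n IH] f; first by rewrite big_ord0.
by rewrite big_ord_recl csum_recl RtoC_plus (IH (fun k => f k.+1)).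
Qed.

Lemma size_bernoulli_seq n : size (bernoulli_seq n) = n.
Proof. by elim: n => //= n IH; rewrite size_rcons IH. Qed.

Lemma nth_bernoulli_seq n k : (k < n)%nat -> nth 0%R (bernoulli_seq n) k = bernoulli k.
Proof.
elim: n => // n IH; rewrite ltnS leq_eqVlt => /orP [/eqP -> //|Hk].
by rewrite [bernoulli_seq _]/= nth_rcons size_bernoulli_seq Hk IH.
Qed.

Lemma bernoulli_rec m :
  csum (fun k => RtoC (INR 'C(m.+1, k) * bernoulli k)) m.+1 = RtoC (if m is 0 then 1 else 0).
Proof.
have E : bernoulli m = ((if m is 0 then 1 else 0)
   - / INR m.+1 * \big[Rplus/0]_(k < m) (INR 'C(m.+1, k) * bernoulli k))%R.
  rewrite {1}/bernoulli [bernoulli_seq _]/= nth_rcons size_bernoulli_seq ltnn eqxx.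
  by congr (_ - _ * _)%R; apply: eq_bigr => k _; rewrite nth_bernoulli_seq.
have m0 : INR m.+1 <> 0%R by apply: not_0_INR.
rewrite csum_recr -big_Rplus_C -RtoC_plus E; congr RtoC.
rewrite (_ : 'C(m.+1, m) = m.+1); last by rewrite -[in RHS](binSn m).
rewrite Rmult_minus_distr_l -Rmult_assoc Rinv_r // Rmult_1_l.
case: m E m0 => [|m] E m0; last by ring.
by rewrite big_ord0 /=; ring.
Qed.

Lemma BPE n x : bernoulli_poly n x
  = csum (fun k => RtoC (INR 'C(n, k) * bernoulli k) * Cpow x (n - k)) n.+1.
Proof. exact: (big_csum (fun k => RtoC (INR 'C(n, k) * bernoulli k) * Cpow x (n - k)) n.+1). Qed.

Lemma BP0 x : bernoulli_poly 0 x = 1.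
Proof.
rewrite BPE csum_recr /csum /=.
have := bernoulli_rec 0; rewrite csum_recr /csum bin0 => E.
transitivity (0 + RtoC (1 * bernoulli 0)); last by rewrite -E.
by rewrite !Rmult_1_l; ring.
Qed.

Lemma BP_at0 n : bernoulli_poly n 0 = RtoC (bernoulli n).
Proof.
rewrite BPE csum_recr csum_zero.
  by rewrite binn subnn /= Rmult_1_l; ring.
move=> k Hk; have -> : (n - k = (n - k).-1.+1)%nat by lia.
by rewrite Cpow_S; ring.
Qed.

Lemma BP_at1 n : bernoulli_poly n.+2 1 = bernoulli_poly n.+2 0.
Proof.
rewrite BP_at0 BPE csum_recr binn subnn Cpow_1_l.
rewrite (@csum_ext _ (fun k => RtoC (INR 'C(n.+2, k) * bernoulli k))); last first.
  by move=> k _; rewrite Cpow_1_l; ring.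
by rewrite bernoulli_rec /= Rmult_1_l; ring.
Qed.

Lemma pow_der (a c : C) (m : nat) (s : R) :
  @is_derive R_AbsRing C_R_NormedModule (fun s => Cpow (a + RtoC s * c) m) s
    (RtoC (INR m) * c * Cpow (a + RtoC s * c) m.-1).
Proof.
have lin : @is_derive R_AbsRing C_R_NormedModule (fun s => a + RtoC s * c) s c.
  apply: (@R_der_slope _ (fun _ => c)); last exact: C_cont_const.
  by apply: filter_imp filter_true => u _; rewrite RtoC_minus; ring.
elim: m => [|m IH].
  by apply: R_der_eq (R_der_const 1 s) _; rewrite /=; ring.
apply: (R_der_eq (R_der_mult lin IH)).
rewrite S_INR RtoC_plus [m.+1.-1]/=.
case: m {IH} => [|m]; first by rewrite /=; ring.
by rewrite [m.+1.-1]/= !Cpow_S; ring.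
Qed.

Lemma BP_der (a c : C) (n : nat) (s : R) :
  @is_derive R_AbsRing C_R_NormedModule (fun s => bernoulli_poly n.+1 (a + RtoC s * c)) s
    (RtoC (INR n.+1) * c * bernoulli_poly n (a + RtoC s * c)).
Proof.
apply: (is_derive_ext (fun s => csum (fun k => RtoC (INR 'C(n.+1, k) * bernoulli k)
   * Cpow (a + RtoC s * c) (n.+1 - k)) n.+2)) => [u|]; first by rewrite BPE.
have D := @csum_der (fun k s => RtoC (INR 'C(n.+1, k) * bernoulli k) * Cpow (a + RtoC s * c) (n.+1 - k))
  (fun k => RtoC (INR n.+1) * c * (RtoC (INR 'C(n, k) * bernoulli k) * Cpow (a + RtoC s * c) (n - k))) s n.+2 _.
rewrite (_ : _ * bernoulli_poly n _ = csum (fun k => RtoC (INR n.+1) * c * (RtoC (INR 'C(n, k) * bernoulli k) * Cpow (a + RtoC s * c) (n - k))) n.+2); last first.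
  by rewrite BPE -csum_scal [RHS]csum_recr bin_small // Rmult_0_l; ring.
apply: D => k Hk.
apply: (R_der_eq (R_der_mult (R_der_const _ s) (pow_der a c (n.+1 - k) s))).
have -> : (n.+1 - k).-1 = (n - k)%nat by lia.
have B : (INR 'C(n.+1, k) * INR (n.+1 - k) = INR n.+1 * INR 'C(n, k))%R.
  by rewrite -!mult_INR; congr INR; have := mul_bin_down n.+1 k; rewrite /= !multE; lia.
transitivity (RtoC (INR 'C(n.+1, k) * INR (n.+1 - k)) * RtoC (bernoulli k) * c * Cpow (a + RtoC s * c) (n - k)).
  by rewrite !RtoC_mult; ring.
by rewrite B !RtoC_mult; ring.
Qed.

(** Its vanishing is the duplication formula [2 * B_n (2 s) = 2 ^ n * (B_n (s) + B_n (s + 1/2))]. *)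
Definition PB (n : nat) (s : R) : C :=
  RtoC (2 ^ n) * (bernoulli_poly n (0 + RtoC s * 1) + bernoulli_poly n (RtoC (/ 2) + RtoC s * 1))
  - RtoC 2 * bernoulli_poly n (0 + RtoC s * 2).

Lemma PB_der n s : @is_derive R_AbsRing C_R_NormedModule (PB n.+1) s (RtoC (2 * INR n.+1) * PB n s).
Proof.
have D1 := BP_der 0 1 n s; have D2 := BP_der (RtoC (/ 2)) 1 n s; have D3 := BP_der 0 (RtoC 2) n s.
have D := R_der_plus (R_der_mult (R_der_const (RtoC (2 ^ n.+1)) s) (R_der_plus D1 D2))
  (R_der_mult (R_der_const (- RtoC 2) s) D3).
apply: (is_derive_ext _ _ _ _ _ (R_der_eq D _)) => [u|].
  by rewrite /PB; apply: (_ : forall a b c : C, a + - b * c = a - b * c); move=> *; ring.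
by rewrite /PB -tech_pow_Rmult !RtoC_mult; ring.
Qed.

Lemma PB_cont n s : continuous (PB n) s.
Proof.
case: n => [|n].
  by apply: (continuous_ext (fun _ => RtoC (2 ^ 0) * (1 + 1) - RtoC 2 * 1)) => [u|];
   [rewrite /PB !BP0 | exact: C_cont_const].
apply: (@ex_derive_continuous R_AbsRing C_R_NormedModule (PB n.+1)); eexists; exact: PB_der.
Qed.

(** From degree 2 on, [B (1) = B (0)]. In degree 1 this fails, but the coefficients [2 ^ 1] and 2
    coincide, so the values at 0 and at 1 drop out. *)
Lemma PB_half n : PB n.+1 (/ 2) = PB n.+1 0.
Proof.
rewrite /PB !Cmult_0_l !Cmult_1_r !Cplus_0_l !Cplus_0_r.
have -> : RtoC (/ 2) + RtoC (/ 2) = RtoC 1 by rewrite -RtoC_plus; congr RtoC; field.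
have -> : RtoC (/ 2) * RtoC 2 = RtoC 1 by rewrite -RtoC_mult; congr RtoC; field.
case: n => [|n]; last by rewrite BP_at1; ring.
by rewrite /= Rmult_1_r; ring.
Qed.

(** By induction [PB n.+1] has derivative 0 and is a constant [c]. Then [PB n.+2] is affine with
    slope [2 * (n + 2) * c], and its equal values at 0 and 1/2 force [c = 0]. *)
Lemma PB_eq0 n s : (0 <= s)%R -> PB n s = 0.
Proof.
elim: n s => [|n IH] s s0; first by rewrite /PB !BP0 /=; ring.
have cst t : (0 <= t)%R -> PB n.+1 t = PB n.+1 0.
  move=> t0; have [->//|tn] := Req_dec t 0.
  apply: R_der_zero_pos; [lra | | exact: PB_cont].
  move=> u Hu; apply: (R_der_eq (PB_der n u)); rewrite IH; [ring | lra].
rewrite cst //.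
pose c := PB n.+1 0.
pose f (t : R) := PB n.+2 t - RtoC t * (RtoC (2 * INR n.+2) * c).
have F : f (/ 2)%R = f 0%R.
  apply: R_der_zero_pos; [lra | |]; last first.
    apply: C_cont_minus; first exact: PB_cont.
    by apply: C_cont_mult; [exact/C_cont_RtoC/continuous_id | exact: C_cont_const].
  move=> t Ht.
  have lin : @is_derive R_AbsRing C_R_NormedModule (fun s => - (RtoC s * (RtoC (2 * INR n.+2) * c))) t (- (RtoC (2 * INR n.+2) * c)).
    apply: (@R_der_slope _ (fun _ => - (RtoC (2 * INR n.+2) * c))); last exact: C_cont_const.
    by apply: filter_imp filter_true => u _; rewrite RtoC_minus; ring.
  by apply: (R_der_eq (R_der_plus (PB_der n.+1 t) lin)); rewrite cst -/c; [ring | lra].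
rewrite /f PB_half in F.
have n0 : (0 < INR n.+2)%R by apply: lt_0_INR; lia.
have k0 : RtoC (/ 2 * (2 * INR n.+2)) <> 0 by move/RtoC_inj; lra.
have : RtoC (/ 2 * (2 * INR n.+2)) * c = 0.
  rewrite RtoC_mult -Cmult_assoc.
  transitivity (PB n.+2 0 - RtoC 0 * (RtoC (2 * INR n.+2) * c) - (PB n.+2 0 - RtoC (/ 2) * (RtoC (2 * INR n.+2) * c))); first by ring.
  by rewrite F; ring.
move=> H; apply: NNPP => cn; exact: (Cmult_neq_0 _ _ k0 cn H).
Qed.

Lemma BP_quarter n : RtoC (2 ^ n) * (bernoulli_poly n (RtoC (/ 4)) + bernoulli_poly n (RtoC (3 / 4)))
  = RtoC 2 * bernoulli_poly n (RtoC (/ 2)).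
Proof.
have := @PB_eq0 n (/ 4) ltac:(lra).
rewrite /PB !Cmult_1_r !Cplus_0_l -RtoC_plus -RtoC_mult.
have -> : (/ 2 + / 4 = 3 / 4)%R by field.
have -> : (/ 4 * 2 = / 2)%R by field.
by move=> H; apply/Ceq_minus.
Qed.

Lemma lam_slope1_cont m (w0 : C) : slit w0 ->
  continuous (T := C_UniformSpace) (fun w : C => lam_slope [::] m w w0 1) w0.
Proof.
move=> Hw.
pose X := C_UniformSpace.
pose ws : seq (X -> C) := [:: (fun w => w); (fun _ => w0)].
have Hws : List.Forall (fun w : X -> C => forall x : X, True -> continuous w x) ws.
  by constructor; [move=> x _; exact: continuous_id | constructor; [move=> x _; exact: C_cont_const | ]].
have HO := kdom_star (V := fun _ : X => True) open_true Hws.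
apply: (@continuous_comp_2 _ _ _ _ (fun w : X => w) (fun _ => 1%R) (fun w s => lam_slope [::] m w w0 s)).
- exact: continuous_id.
- exact: continuous_const.
rewrite /lam_slope.
pose O := kdom (fun _ : X => True) ws.
suff K : cont_on O (fun (w : X) s => RtoC (s ^ 1) *
   MK [seq (q.1, q.2 w) | q <- [:: (m, fun (w : X) s => / (1 - RtoC s * w) * / (1 - RtoC s * w0))]] s).
  by apply: K; split=> //; constructor => //; constructor.
apply: cont_on_mult; first by move=> x s _; apply/cont_pow/continuous_snd.
apply: (MK_cont HO (k := fun q => q.2)); constructor => //=.
apply: cont_on_mult.
  by apply: (kdom_den_cont (w := fun w : X => w)) => //; left.
by apply: (kdom_den_cont (w := fun _ : X => w0)) => //; right; left.
Qed.

(** The rule [z d/dz Li_{n+1} = Li_n] along a path with logarithmic derivative [u]. *)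
Lemma lam1_derive n (g : R -> C) (u : C) s :
  locally s (fun t => npos (g t)) ->
  @is_derive R_AbsRing C_R_NormedModule g s (u * g s) ->
  @is_derive R_AbsRing C_R_NormedModule (fun t => lam [:: (n.+1, g t)] 1) s (u * lam [:: (n, g s)] 1).
Proof.
move=> Hg /R_der_to_slope [h [hc hs Hh]].
have nsl w : npos w -> slit w by move=> Hw; apply: npos_slit => //; lra.
have sl := nsl _ (locally_singleton _ _ Hg).
have E := @lam_slope_diag [::] n (g s) 1 _.
rewrite /= in E; rewrite -E; last by constructor; [exact: sl | constructor].
have -> : u * (g s * lam_slope [::] n.+1 (g s) (g s) 1) = h s * lam_slope [::] n.+1 (g s) (g s) 1.
  by rewrite hs; ring.
apply: (@R_der_slope _ (fun t => h t * lam_slope [::] n.+1 (g t) (g s) 1)).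
  apply: filter_imp Hg => t Ht.
  have := @lam_slopeP [::] n.+1 (g t) (g s) 1 _; rewrite /= => ->; last first.
    by constructor; [exact: nsl | constructor; [exact: sl | constructor]].
  by rewrite Hh; ring.
apply: C_cont_mult => //.
apply: (continuous_comp g (fun w : C => lam_slope [::] n.+1 w (g s) 1)); last exact: lam_slope1_cont.
apply: (continuous_ext (fun t => RtoC (t - s) * h t + g s)) => [t|].
  by rewrite -Hh; exact: C_subrK.
apply: C_cont_plus; last exact: C_cont_const.
apply: C_cont_mult => //; apply: C_cont_RtoC.
by apply: (@continuous_minus R_UniformSpace R_AbsRing R_NormedModule (fun u => u) (fun _ => s));
  [exact: continuous_id | exact: continuous_const].
Qed.

(** * The complex exponential, the principal logarithm and the inversion formula *)

Definition cexp (w : C) : C := (exp (Re w) * cos (Im w), exp (Re w) * sin (Im w))%R.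

Lemma pair_C (a b : R) : ((a, b) : C) = RtoC a + RtoC b * Ci.
Proof. by rewrite /RtoC /Ci /Cplus /Cmult /=; congr (_, _); ring. Qed.

Lemma cexp_der (u : C) s :
  @is_derive R_AbsRing C_R_NormedModule (fun t => cexp (RtoC t * u)) s (u * cexp (RtoC s * u)).
Proof.
case: u => x y.
have E t : cexp (RtoC t * (x, y)) = RtoC (exp (t * x) * cos (t * y)) + RtoC (exp (t * x) * sin (t * y)) * Ci.
  rewrite /cexp re_scal_l im_scal_l /= pair_C //.
have D1 : is_derive (fun t => exp (t * x) * cos (t * y))%R s
   (x * (exp (s * x) * cos (s * y)) - y * (exp (s * x) * sin (s * y)))%R.
  by auto_derive => //; ring.
have D2 : is_derive (fun t => exp (t * x) * sin (t * y))%R s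
   (x * (exp (s * x) * sin (s * y)) + y * (exp (s * x) * cos (s * y)))%R.
  by auto_derive => //; ring.
apply: (is_derive_ext (fun t => RtoC (exp (t * x) * cos (t * y)) + RtoC (exp (t * x) * sin (t * y)) * Ci)) => [t|].
  by rewrite E.
apply: (R_der_eq (R_der_plus (R_der_RtoC D1) (R_der_mult (R_der_RtoC D2) (R_der_const Ci s)))).
rewrite E pair_C; move: (exp (s * x) * cos (s * y))%R (exp (s * x) * sin (s * y))%R => p q.
rewrite !(RtoC_plus, RtoC_minus, RtoC_mult).
have Ci2 : Ci * Ci = -(1) by rewrite /Ci /Cmult /Copp /RtoC /=; congr (_, _); ring.
transitivity (RtoC x * RtoC p + RtoC y * RtoC q * (Ci * Ci) + (RtoC x * RtoC q + RtoC y * RtoC p) * Ci).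
  by rewrite Ci2; ring.
by ring.
Qed.

Lemma npos_cexp (w : C) : (Rabs (Im w) < PI)%R -> npos (- cexp w).
Proof.
case: w => x y /= Hy [r [r0 H]].
have ex := exp_pos x.
have H1 : (exp x * cos y = - r)%R by have := f_equal Re H; rewrite /= ; lra.
have H2 : (exp x * sin y = 0)%R by have := f_equal Im H; rewrite /= ; lra.
have s0 : sin y = 0%R by nra.
have /Rabs_def2 [y1 y2] := Hy.
have y0 : y = 0%R.
  case: (Rtotal_order y 0) => [Hlt|[//|Hgt]].
    have := sin_gt_0 (- y) ltac:(lra) ltac:(lra); rewrite sin_neg; lra.
  have := sin_gt_0 y ltac:(lra) ltac:(lra); lra.
by move: H1; rewrite y0 cos_0; nra.
Qed.

Lemma cexp_Clog (w : C) : w <> 0 -> cexp (Clog w) = w.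
Proof.
move=> w0; have m0 : (0 < Cmod w)%R by apply/Cmod_gt_0.
rewrite /cexp /Clog /= exp_ln //.
have M := Cmod2_alt w.
have Hq : (-1 <= Re w / Cmod w <= 1)%R.
  have := re_le_Cmod w => /Rabs_le_between [h1 h2].
  split; first by apply: (Rmult_le_reg_r (Cmod w)) => //; rewrite /Rdiv Rmult_assoc Rinv_l; lra.
  by apply: (Rmult_le_reg_r (Cmod w)) => //; rewrite /Rdiv Rmult_assoc Rinv_l; lra.
have C1 : cos (principal_arg w) = (Re w / Cmod w)%R.
  by rewrite /principal_arg; destruct (Rle_dec 0 (Im w)) => /=; rewrite ?cos_neg cos_acos.
have S1 : sin (principal_arg w) = (Im w / Cmod w)%R.
  have Q : sqrt (1 - (Re w / Cmod w)²) = (Rabs (Im w) / Cmod w)%R.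
    have -> : (1 - (Re w / Cmod w)² = (Rabs (Im w) / Cmod w)²)%R.
      rewrite /Rsqr.
      have -> : (Rabs (Im w) / Cmod w * (Rabs (Im w) / Cmod w) = (Im w)^2 / (Cmod w)^2)%R.
        rewrite -(pow2_abs (Im w)); field; lra.
      rewrite M; have M' : (Re w ^ 2 + Im w ^ 2 <> 0)%R by rewrite -M; nra.
      have -> : (Re w / Cmod w * (Re w / Cmod w) = (Re w)^2 / (Cmod w)^2)%R by field; lra.
      by rewrite M; field.
    rewrite sqrt_Rsqr //; apply: Rdiv_le_0_compat => //; exact: Rabs_pos.
  rewrite /principal_arg; destruct (Rle_dec 0 (Im w)) as [H|H] => /=.
    by rewrite sin_acos // Q Rabs_pos_eq.
  by rewrite sin_neg sin_acos // Q Rabs_left; [field | ]; lra.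
rewrite C1 S1 [RHS]surjective_pairing; congr (_, _); rewrite /Re /Im; field; lra.
Qed.

Lemma Clog_Im (w : C) : npos (- w) -> (Rabs (Im (Clog w)) < PI)%R.
Proof.
move=> Hw; have P0 := PI_RGT_0.
have w0 : w <> 0.
  by move=> E; apply: (npos_neq0 Hw); rewrite E; ring.
have Hle : (Rabs (Im (Clog w)) <= PI)%R.
  rewrite /Clog /= /principal_arg; have [h1 h2] := acos_bound (Re w / Cmod w).
  by destruct (Rle_dec 0 (Im w)) => /=; rewrite ?Rabs_Ropp Rabs_pos_eq.
case: (Rle_lt_or_eq_dec _ _ Hle) => // E; exfalso; apply: Hw.
have m0 : (0 < Cmod w)%R by apply/Cmod_gt_0.
exists (Cmod w); split; first lra.
have := cexp_Clog w0; rewrite /cexp [Re (Clog w)]/= exp_ln //.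
set y := Im (Clog w) in E *.
have Ey : y = PI \/ y = (- PI)%R.
  by move: E; rewrite /Rabs; case: Rcase_abs => _ H; [right | left]; lra.
have [cy sy] : cos y = (-1)%R /\ sin y = 0%R.
  by case: Ey => ->; rewrite ?cos_neg ?sin_neg cos_PI sin_PI; split; lra.
rewrite cy sy => Ew; rewrite -{1}Ew /Copp /RtoC /=; congr (_, _); ring.
Qed.

Definition Bh (n : nat) (x : C) : C := Cpow two_pi_i n / RtoC (INR n`!) * bernoulli_poly n x.

Lemma two_pi_i_neq0 : two_pi_i <> 0.
Proof.
apply: Cmult_neq_0; last exact: Ci_nz.
by move/RtoC_inj; have := PI_RGT_0; lra.
Qed.

Lemma Bh_der n (u : C) s :
  @is_derive R_AbsRing C_R_NormedModule (fun s => Bh n.+1 (RtoC (/ 2) + RtoC s * (u / two_pi_i))) s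
    (u * Bh n (RtoC (/ 2) + RtoC s * (u / two_pi_i))).
Proof.
apply: (R_der_eq (R_der_mult (R_der_const _ s) (BP_der (RtoC (/ 2)) (u / two_pi_i) n s))).
have tp := two_pi_i_neq0.
have f0 : RtoC (INR n`!) <> 0.
  by move/RtoC_inj; apply: not_0_INR; have := fact_gt0 n; lia.
have n0 : RtoC (INR n.+1) <> 0 by move/RtoC_inj; apply: not_0_INR.
rewrite /Bh factS mult_INR RtoC_mult Cpow_S; field; by repeat split.
Qed.

Lemma cexp_opp (w : C) : cexp w * cexp (- w) = 1.
Proof.
case: w => x y; rewrite /cexp /= cos_neg sin_neg exp_Ropp /Cmult /RtoC /=.
have e0 := exp_pos x; have t := sin2_cos2 y; rewrite /Rsqr in t.
congr (_, _); last by ring.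
transitivity (sin y * sin y + cos y * cos y)%R => //; field; lra.
Qed.

Lemma cexp_inv (w : C) : - cexp (- w) = / (- cexp w).
Proof.
have H := cexp_opp w.
have n0 : cexp w <> 0 by move=> E; apply: C1_nz; rewrite -H E; ring.
have n1 : - cexp w <> 0.
  by move=> E; apply: n0; transitivity (- - cexp w); [ring | rewrite E; ring].
transitivity (- (cexp w * cexp (- w)) / cexp w); first by field.
by rewrite H; field.
Qed.

(* The inversion formula states that this vanishes. *)
Definition Ed (n : nat) (u : C) (s : R) : C :=
  Bh n (RtoC (/ 2) + RtoC s * (u / two_pi_i)) - bt (- cexp (RtoC s * u)) n.

Lemma Im_scal_lt (u : C) s : (Rabs (Im u) < PI)%R -> (0 <= s <= 1)%R -> (Rabs (Im (RtoC s * u)) < PI)%R.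
Proof.
move=> Hu Hs; rewrite im_scal_l Rabs_mult (Rabs_pos_eq s); last lra.
have := Rabs_pos (Im u); nra.
Qed.

Lemma Im_scal_nbh (u : C) s : (Rabs (Im u) < PI)%R -> (0 <= s <= 1)%R ->
  locally s (fun t => (Rabs (Im (RtoC t * u)) < PI)%R).
Proof.
move=> Hu Hs.
have H := Im_scal_lt Hu Hs.
have /C_continuousP/(_ (PI - Rabs (Im (RtoC s * u)))%R) : continuous (fun t => RtoC (t * Im u)) s.
  by apply: C_cont_RtoC; apply: R_cont_mult; [exact: continuous_id | exact: continuous_const].
move=> /(_ ltac:(lra)); apply: filter_imp => t.
rewrite -RtoC_minus Cmod_R !im_scal_l => Ht.
have := Rabs_triang (t * Im u - s * Im u) (s * Im u).
rewrite (_ : t * Im u - s * Im u + s * Im u = t * Im u)%R; last by ring.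
by lra.
Qed.

Lemma Ed_derive n (u : C) s : (Rabs (Im u) < PI)%R -> (0 <= s <= 1)%R ->
  @is_derive R_AbsRing C_R_NormedModule (Ed n.+1 u) s (u * Ed n u s).
Proof.
move=> Hu Hs.
have gd v : @is_derive R_AbsRing C_R_NormedModule (fun t => - cexp (RtoC t * v)) s (v * - cexp (RtoC s * v)).
  apply: (is_derive_ext _ _ _ _ _ (R_der_eq (R_der_mult (R_der_const (-(1)) s) (cexp_der v s)) _)) => [t|].
    by apply: (_ : forall a : C, -(1) * a = - a); move=> *; ring.
  by ring.
have nb v : (Rabs (Im v) < PI)%R -> locally s (fun t => npos (- cexp (RtoC t * v))).
  by move=> Hv; apply: filter_imp (Im_scal_nbh Hv Hs) => t; apply: npos_cexp.
have Hu' : (Rabs (Im (- u)) < PI)%R by rewrite im_opp Rabs_Ropp.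
have D1 := lam1_derive n (nb _ Hu) (gd u).
have D2 := lam1_derive n (nb _ Hu') (gd (- u)).
have D3 := Bh_der n u s.
have inv t : - cexp (RtoC t * - u) = / - cexp (RtoC t * u).
  by rewrite -cexp_inv; congr (- cexp _); ring.
apply: (is_derive_ext _ _ _ _ _ (R_der_eq (R_der_plus D3 (R_der_plus D1 (R_der_mult (R_der_const (sgn n.+1) s) D2))) _)) => [t|].
  rewrite /Ed /bt -inv.
  by apply: (_ : forall a b c : C, a + (b + c) = a - - (b + c)); move=> *; ring.
by rewrite /Ed /bt -inv sgnS; ring.
Qed.

Lemma Ed_at0 n u : Ed n u 0 = Bh n (RtoC (/ 2)) - bt (-(1)) n.
Proof.
rewrite /Ed !Cmult_0_l Cplus_0_r; congr (_ - bt (- _) _).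
by rewrite /cexp /= exp_0 cos_0 sin_0 /RtoC; congr (_, _); ring.
Qed.

Lemma npos_i (e : R) : e <> 0%R -> npos (RtoC e * Ci).
Proof.
move=> e0 [x [_ H]]; apply: e0.
have := f_equal Im H; rewrite /= ; lra.
Qed.

Lemma npos_m1 : npos (-(1)).
Proof. by move=> [x [x0 H]]; have := f_equal Re H; rewrite /=; lra. Qed.

(** The distribution relation for the two square roots of [-(1)]: multiplying by [2 ^ n] turns
    [1 / k ^ n] into [1 / (k / 2) ^ n], and only even [k] survive. The induction integrates it in
    the scale, starting from geometric series. *)
Lemma lam_dist n s : (0 <= s)%R ->
  RtoC (2 ^ n) * (lam [:: (n, Ci)] s + lam [:: (n, - Ci)] s) = RtoC 2 * lam [:: (n, -(1))] (s * s).
Proof.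
have ni : npos Ci by rewrite -(Cmult_1_l Ci); apply: npos_i; lra.
have nmi : npos (- Ci).
  have -> : - Ci = RtoC (-1) * Ci by ring.
  by apply: npos_i; lra.
have o w t k : npos w -> (0 <= t)%R -> ok t [:: (k, w)].
  by move=> Hw t0; apply: npos_ok => // q [<-|[]].
elim: n s => [|n IH] s s0.
  rewrite !lam0 !lam_nil /kw /=.
  have d1 := slit_den (npos_slit ni s0); have d2 := slit_den (npos_slit nmi s0).
  have d3 : 1 - RtoC (s * s) * -(1) <> 0 by apply: slit_den; apply: npos_slit npos_m1 _; nra.
  have Ci2 : Ci * Ci = -(1) by rewrite /Ci /Cmult /Copp /RtoC /=; congr (_, _); ring.
  have P : (1 - RtoC s * Ci) * (1 - RtoC s * - Ci) = 1 - RtoC (s * s) * -(1).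
    by rewrite RtoC_mult -Ci2; ring.
  rewrite -P in d3 *.
  transitivity (2 * (RtoC s * RtoC s) * (Ci * Ci) / ((1 - RtoC s * Ci) * (1 - RtoC s * - Ci))).
    by field; split.
  by rewrite Ci2 RtoC_mult; field; split.
pose f t := RtoC (2 ^ n.+1) * (lam [:: (n.+1, Ci)] t + lam [:: (n.+1, - Ci)] t)
   + - RtoC 2 * lam [:: (n.+1, -(1))] (t * t).
have cl w t : npos w -> (0 <= t)%R -> continuous (lam [:: (n.+1, w)]) t.
  by move=> Hw t0; apply/lam_cont_s/o.
have [->|sn] := Req_dec s 0; first by rewrite Rmult_0_l !lam_at0; ring.
suff : f s = f 0%R.
  rewrite /f Rmult_0_l !lam_at0 => E; apply/Ceq_minus.
  by rewrite /Cminus; transitivity (f s); [rewrite /f; ring | rewrite /f E; ring].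
apply: R_der_zero_pos; [lra | |].
  move=> t [t0 _]; have tn : RtoC t <> 0 by move/RtoC_inj; lra.
  have D1 := lam_derive (o Ci t n.+1 ni (Rlt_le _ _ t0)) t0.
  have D2 := lam_derive (o (- Ci) t n.+1 nmi (Rlt_le _ _ t0)) t0.
  have tt0 : (0 < t * t)%R by nra.
  have D3 := lam_derive (o (-(1)) (t * t)%R n.+1 npos_m1 (Rlt_le _ _ tt0)) tt0.
  have dt : is_derive (fun t : R => t * t)%R t (2 * t)%R by auto_derive => //; ring.
  have D4 := @is_derive_comp R_AbsRing C_R_NormedModule _ _ _ _ _ D3 dt.
  rewrite scal_R_Cmult in D4.
  apply: (R_der_eq (R_der_plus (R_der_mult (R_der_const (RtoC (2 ^ n.+1)) t) (R_der_plus D1 D2)) (R_der_mult (R_der_const (- RtoC 2) t) D4))).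
  have E := IH t (Rlt_le _ _ t0).
  rewrite -tech_pow_Rmult !RtoC_mult.
  transitivity (2 / RtoC t * (RtoC (2 ^ n) * (lam [:: (n, Ci)] t + lam [:: (n, - Ci)] t)
     - 2 * lam [:: (n, -(1))] (t * t))); first by field.
  by rewrite E; field.
apply: C_cont_plus; apply: C_cont_mult; try exact: C_cont_const.
  by apply: C_cont_plus; apply: cl => //; lra.
apply: (continuous_comp (fun t : R => (t * t)%R) (lam [:: (n.+1, -(1))])).
  by apply: R_cont_mult; exact: continuous_id.
by apply: cl; [exact: npos_m1 | lra].
Qed.

Lemma bt_dist n : RtoC (2 ^ n) * (bt Ci n + bt (- Ci) n) = RtoC 2 * bt (-(1)) n.
Proof.
have := @lam_dist n 1 ltac:(lra); rewrite Rmult_1_r /bt => E.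
have Cn : / - Ci = Ci.
  by have := Ci_nz => h; transitivity (- / Ci); [field | rewrite Ci_inv; ring].
rewrite Ci_inv Cn (_ : / -(1) = -(1)); last by field.
transitivity (- ((1 + sgn n) * (RtoC (2 ^ n) * (lam [:: (n, Ci)] 1 + lam [:: (n, - Ci)] 1)))); first by ring.
by rewrite E; ring.
Qed.

Lemma quarter_arg (P e : R) : P <> 0%R ->
  (RtoC 0 + RtoC (e * (P / 2)) * Ci) / (RtoC (2 * P) * Ci) = RtoC (e / 4).
Proof.
move=> P0; have PC : RtoC P <> 0 by move/RtoC_inj.
have C2 : RtoC 2 <> 0 by move/RtoC_inj; lra.
have C4 : RtoC 4 <> 0 by move/RtoC_inj; lra.
have Cn := Ci_nz.
rewrite /Rdiv !RtoC_mult !RtoC_inv; try lra.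
by field; split.
Qed.

(** By induction [Ed n.+1 u] is constant in [s], and its value [c] at [s = 0] is the same for all
    [u]. Both parts of [Ed] satisfy the duplication relation between the points [i], [- i] and [-1],
    hence so does the constant: [(2 * 2 ^ n.+1 - 2) * c = 0]. *)
Lemma Ed_eq0 n u s : (Rabs (Im u) < PI)%R -> (0 <= s <= 1)%R -> Ed n u s = 0.
Proof.
have P0 := PI_RGT_0.
elim: n u s => [|n IH] u s Hu Hs.
  rewrite /Ed bt0; last by apply: npos_cexp; apply: Im_scal_lt.
  by rewrite /Bh BP0 /=; field.
have cst v t : (Rabs (Im v) < PI)%R -> (0 <= t <= 1)%R -> Ed n.+1 v t = Ed n.+1 v 0.
  move=> Hv Ht; have [->//|tn] := Req_dec t 0.
  apply: R_der_zero_pos; [lra | |].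
    by move=> r Hr; apply: (R_der_eq (Ed_derive n Hv _)); [lra | rewrite IH //; [ring | lra]].
  by apply: (@ex_derive_continuous R_AbsRing C_R_NormedModule (Ed n.+1 v)); eexists; apply: Ed_derive => //; lra.
rewrite cst // Ed_at0.
set c := _ - _.
(* For [e = -1] and [e = 1] the point [- cexp (e * PI / 2 * Ci)] is [Ci] and [- Ci], with Bernoulli
   arguments 1/4 and 3/4. *)
have q (e : R) : (Rabs e <= 1)%R -> bt (- cexp (RtoC 0 + RtoC (e * (PI / 2)) * Ci)) n.+1
    = Bh n.+1 (RtoC (/ 2 + e / 4)) - c.
  move=> He.
  pose v := RtoC 0 + RtoC (e * (PI / 2)) * Ci.
  have Hv : (Rabs (Im v) < PI)%R.
    have -> : Im v = (e * (PI / 2))%R by rewrite /v /=; ring.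
    by rewrite Rabs_mult (Rabs_pos_eq (PI / 2)); [nra | lra].
  have := cst v 1%R Hv ltac:(lra); rewrite Ed_at0 -/c /Ed !Cmult_1_l => <-.
  have -> : RtoC (/ 2) + v / two_pi_i = RtoC (/ 2 + e / 4); last by rewrite -/v; ring.
  by rewrite RtoC_plus; congr (_ + _); apply: quarter_arg; lra.
have e1 : - cexp (RtoC 0 + RtoC (-1 * (PI / 2)) * Ci) = Ci.
  have -> : RtoC 0 + RtoC (-1 * (PI / 2)) * Ci = (0%R, (- (PI / 2))%R).
    by rewrite pair_C; congr (_ + RtoC _ * _); ring.
  rewrite /cexp /= exp_0 cos_neg sin_neg cos_PI2 sin_PI2 /Ci /Copp /=; congr (_, _); ring.
have e2 : - cexp (RtoC 0 + RtoC (1 * (PI / 2)) * Ci) = - Ci.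
  have -> : RtoC 0 + RtoC (1 * (PI / 2)) * Ci = (0%R, (PI / 2)%R).
    by rewrite pair_C; congr (_ + RtoC _ * _); ring.
  rewrite /cexp /= exp_0 cos_PI2 sin_PI2 /Ci /Copp /=; congr (_, _); ring.
have q1 := q (-1)%R _; have q2 := q 1%R _.
have := bt_dist n.+1.
rewrite -{1}e1 -e2 q1 ?q2; [| by rewrite Rabs_R1; lra | by rewrite Rabs_Ropp Rabs_R1; lra].
have -> : (/ 2 + -1 / 4 = / 4)%R by field.
have -> : (/ 2 + 1 / 4 = 3 / 4)%R by field.
have B := BP_quarter n.+1.
have -> : bt (-(1)) n.+1 = Bh n.+1 (RtoC (/ 2)) - c by rewrite /c; ring.
move=> H.
have K : RtoC (2 * 2 ^ n.+1 - 2) * c = 0.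
  rewrite RtoC_minus RtoC_mult.
  transitivity (Cpow two_pi_i n.+1 / RtoC (INR n.+1`!) * (RtoC (2 ^ n.+1) * (bernoulli_poly n.+1 (RtoC (/ 4)) + bernoulli_poly n.+1 (RtoC (3 / 4)))
     - 2 * bernoulli_poly n.+1 (RtoC (/ 2)))
     - (RtoC (2 ^ n.+1) * (Bh n.+1 (RtoC (/ 4)) - c + (Bh n.+1 (RtoC (3 / 4)) - c)) - 2 * (Bh n.+1 (RtoC (/ 2)) - c))).
    by rewrite /Bh; ring.
  by rewrite B H; ring.
have k0 : RtoC (2 * 2 ^ n.+1 - 2) <> 0.
  move/RtoC_inj; rewrite -tech_pow_Rmult; have := pow_R1_Rle 2 n ltac:(lra); lra.
by apply: NNPP => cn; exact: (Cmult_neq_0 _ _ k0 cn K).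
Qed.

(** The path [s -> - cexp (s * Clog (- T))] leads from -1 to [T] and avoids [0, oo), as the
    imaginary part of the logarithm stays below [PI] in modulus. *)
Lemma bt_beta n T : npos T -> bt T n = beta n T.
Proof.
move=> HT.
have T0 : - T <> 0.
  by move=> E; apply: (npos_neq0 HT); transitivity (- - T); [ring | rewrite E; ring].
have HT' : npos (- - T) by rewrite (_ : - - T = T) //; ring.
have := @Ed_eq0 n (Clog (- T)) 1 (Clog_Im HT') ltac:(lra).
rewrite /Ed !Cmult_1_l cexp_Clog // (_ : - - T = T); last by ring.
by move=> E; symmetry; apply/Ceq_minus; exact: E.
Qed.

Notation Cder f z l := (is_derive (K := C_AbsRing) (V := C_NormedModule) f z l).
Notation Rder f t l := (@is_derive R_AbsRing C_R_NormedModule f t l).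

(** * The identity theorem *)

Lemma C_der_to_slope (f : C -> C) (z l : C) : Cder f z l ->
  exists g : C -> C, [/\ continuous (T := C_UniformSpace) g z, g z = l &
    forall w, f w - f z = (w - z) * g w].
Proof.
move=> /C_derP H.
pose g w := if Ceq_dec w z then l else (f w - f z) / (w - z).
have gz : g z = l by rewrite /g; destruct (Ceq_dec z z) => /=.
exists g; split => //.
  apply/C_continuousP => e e0.
  have e20 : (0 < e / 2)%R by lra.
  apply: filter_imp (H _ e20) => w Hw.
  rewrite gz /g; destruct (Ceq_dec w z) as [wz|ne] => /=.
    by replace (l - l) with (RtoC 0) by ring; rewrite Cmod_0.
  have d0 := Cminus_eq_contra _ _ ne.
  replace ((f w - f z) / (w - z) - l) with ((f w - f z - (w - z) * l) / (w - z)) by (by field).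
  rewrite Cmod_div //.
  have /Cmod_gt_0 a0 := d0.
  apply: (Rmult_lt_reg_r (Cmod (w - z))) => //.
  by rewrite /Rdiv Rmult_assoc Rinv_l; nra.
move=> w; rewrite /g; destruct (Ceq_dec w z) as [->|ne] => /=; first by ring.
by field; apply: Cminus_eq_contra.
Qed.

Lemma C_der_cont (f : C -> C) (z l : C) : Cder f z l -> continuous (T := C_UniformSpace) f z.
Proof.
move=> /C_der_to_slope [g [gc _ Hg]].
apply: (continuous_ext (fun w => (w - z) * g w + f z)) => [w|].
  by rewrite -Hg; exact: C_subrK.
apply: C_cont_plus; last exact: C_cont_const.
apply: C_cont_mult => //; apply: C_cont_minus; [exact: continuous_id | exact: C_cont_const].
Qed.

Lemma R_der_cont (f : R -> C) (t : R) (l : C) : Rder f t l -> continuous f t.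
Proof. by move=> H; apply: (@ex_derive_continuous R_AbsRing C_R_NormedModule); exists l. Qed.

Lemma R_der_comp (f : C -> C) (g : R -> C) (t : R) (l v : C) :
  Cder f (g t) l -> Rder g t v -> Rder (fun s => f (g s)) t (v * l).
Proof.
move=> /C_der_to_slope [p [pc <- Hp]] Hg; have gc := R_der_cont Hg.
have [q [qc <- Hq]] := R_der_to_slope Hg.
apply: (@R_der_slope _ (fun s => q s * p (g s))).
  by apply: filter_imp filter_true => s _; rewrite Hp Hq; ring.
by apply: C_cont_mult => //; apply: (continuous_comp g p).
Qed.

Lemma R_der_lin (a b : C) t : Rder (fun s => a + RtoC s * b) t b.
Proof.
apply: (@R_der_slope _ (fun _ => b)); last exact: C_cont_const.
by apply: filter_imp filter_true => u _; rewrite RtoC_minus; ring.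
Qed.

Lemma segment_int (f f' : C -> C) (a b : C) :
  (forall t, (0 <= t <= 1)%R -> Cder f (a + RtoC t * (b - a)) (f' (a + RtoC t * (b - a)))) ->
  (forall t, (0 <= t <= 1)%R -> continuous (T := C_UniformSpace) f' (a + RtoC t * (b - a))) ->
  f b - f a = (b - a) * CInt (fun t => f' (a + RtoC t * (b - a))).
Proof.
move=> H1 H2.
have cf t : (0 <= t <= 1)%R -> continuous (fun t => f' (a + RtoC t * (b - a))) t.
  move=> Ht; apply: (continuous_comp (fun t => a + RtoC t * (b - a)) f'); last exact: H2.
  exact: R_der_cont (R_der_lin _ _ t).
rewrite -CInt_mult; last exact: ex_CInt_cont.
rewrite (@CInt_derive (fun t => f (a + RtoC t * (b - a)))).
- congr (f _ - f _); ring.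
- by move=> t Ht; apply: R_der_comp (H1 t Ht) (R_der_lin _ _ t).
- by move=> t Ht; apply: C_cont_mult; [exact: C_cont_const | exact: cf].
Qed.

(** [Phi s - Phi s0] is [s - s0] times the mean [K] of [Phi'] over the segment from [s0] to [s]. As
    [K] is jointly continuous, its integral is a slope. *)
Lemma CInt_param_der (Phi Phi' : R -> R -> C) s0 d : (0 < d)%R ->
  (forall s t, (Rabs (s - s0) < d)%R -> Rder (fun s => Phi s t) s (Phi' s t)) ->
  (forall s t, (Rabs (s - s0) < d)%R -> continuous (fun p : R * R => Phi' p.1 p.2) (s, t)) ->
  (forall s, (Rabs (s - s0) < d)%R -> ex_CInt (Phi s)) ->
  Rder (fun s => CInt (Phi s)) s0 (CInt (Phi' s0)).
Proof.
move=> d0 H1 H2 H3.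
have near s : (Rabs (s - s0) < d)%R -> forall u, (0 <= u <= 1)%R -> (Rabs (s0 + u * (s - s0) - s0) < d)%R.
  move=> Hs u Hu; rewrite (_ : s0 + u * (s - s0) - s0 = u * (s - s0))%R; last by ring.
  by rewrite Rabs_mult Rabs_pos_eq; [have := Rabs_pos (s - s0); nra | lra].
have s00 : (Rabs (s0 - s0) < d)%R by rewrite Rminus_diag Rabs_R0.
have nb s : (Rabs (s - s0) < d)%R -> locally s (fun s' => (Rabs (s' - s0) < d)%R).
  move=> Hs; have e0 : (0 < d - Rabs (s - s0))%R by lra.
  exists (mkposreal _ e0) => s' /= Hs'.
  have : (Rabs (s' - s) < d - Rabs (s - s0))%R by exact: Hs'.
  have := Rabs_triang (s' - s) (s - s0).
  by rewrite (_ : s' - s + (s - s0) = s' - s0)%R; [lra | ring].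
pose K (p : R * R) := CInt (fun u => Phi' (s0 + u * (p.1 - s0))%R p.2).
have inc p u : (Rabs (p.1 - s0) < d)%R -> (0 <= u <= 1)%R ->
    continuous (fun q : (R * R) * R => Phi' (s0 + q.2 * (q.1.1 - s0))%R q.1.2) (p, u).
  move=> Hp Hu.
  have c1 : continuous (fun q : (R * R) * R => (s0 + q.2 * (q.1.1 - s0))%R) (p, u).
    apply: (@continuous_plus _ R_AbsRing R_NormedModule); first exact: continuous_const.
    apply: R_cont_mult; first exact: continuous_snd.
    apply: (@continuous_minus _ R_AbsRing R_NormedModule); last exact: continuous_const.
    by apply: (continuous_comp (fun q : (R * R) * R => q.1) fst); exact: continuous_fst.
  have c2 : continuous (fun q : (R * R) * R => q.1.2) (p, u).
    by apply: (continuous_comp (fun q : (R * R) * R => q.1) snd); [exact: continuous_fst | exact: continuous_snd].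
  by apply: (continuous_comp_2 _ _ Phi' _ c1 c2); apply: H2; apply: near.
have Kc p : (Rabs (p.1 - s0) < d)%R -> continuous K p.
  move=> Hp; apply: (@CInt_cont _ (fun (p : R * R) u => Phi' (s0 + u * (p.1 - s0))%R p.2)).
    by move=> u Hu; apply: inc.
  have [e He] := nb _ Hp.
  exists e => q [Hq _]; apply: ex_CInt_cont => u Hu.
  apply: (@continuous_comp_2 _ _ _ _ (fun _ => q) (fun u => u) (fun p u => Phi' (s0 + u * (p.1 - s0))%R p.2)).
  - exact: continuous_const.
  - exact: continuous_id.
  - by apply: inc => //; apply: He.
have Kd s t : (Rabs (s - s0) < d)%R -> Phi s t - Phi s0 t = RtoC (s - s0) * K (s, t).
  move=> Hs; rewrite /K /= -CInt_mult; last first.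
    apply: ex_CInt_cont => u Hu.
    apply: (@continuous_comp_2 _ _ _ _ (fun _ => (s, t)) (fun u => u) (fun p u => Phi' (s0 + u * (p.1 - s0))%R p.2)).
    - exact: continuous_const.
    - exact: continuous_id.
    - exact: inc.
  rewrite (@CInt_derive (fun u => Phi (s0 + u * (s - s0))%R t)).
  - by congr (Phi _ _ - Phi _ _); ring.
  - move=> u Hu; rewrite -scal_R_Cmult.
    apply: (@is_derive_comp R_AbsRing C_R_NormedModule (fun s => Phi s t) (fun u => s0 + u * (s - s0))%R u
      (Phi' (s0 + u * (s - s0))%R t) (s - s0)%R); first by apply: H1; apply: near.
    by auto_derive => //; ring.
  - move=> u Hu; apply: C_cont_mult; first exact: C_cont_const.
    apply: (@continuous_comp_2 _ _ _ _ (fun _ => (s, t)) (fun u => u) (fun p u => Phi' (s0 + u * (p.1 - s0))%R p.2)).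
    - exact: continuous_const.
    - exact: continuous_id.
    - exact: inc.
have Kt s t : (Rabs (s - s0) < d)%R -> continuous (fun t => K (s, t)) t.
  move=> Hs.
  apply: (@continuous_comp_2 _ _ _ _ (fun _ => s) (fun t => t) (fun s t => K (s, t))).
  - exact: continuous_const.
  - exact: continuous_id.
  - by apply: (continuous_ext K) => [[? ?]//|]; apply: Kc.
have -> : CInt (Phi' s0) = CInt (fun t => K (s0, t)).
  apply: CInt_ext => t _; rewrite /K /= -[LHS]CInt_const.
  by apply: CInt_ext => u _; congr (Phi' _ _); ring.
apply: (@R_der_slope _ (fun s => CInt (fun t => K (s, t)))).
  apply: filter_imp (nb _ s00) => s Hs.
  rewrite -CInt_minus; [|exact: H3|exact: H3].
  rewrite -CInt_mult; last by apply: ex_CInt_cont => t _; apply: Kt.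
  by apply: CInt_ext => t _; apply: Kd.
apply: (@CInt_cont _ (fun s t => K (s, t))).
  by move=> t _; apply: (continuous_ext K) => [[? ?]//|]; apply: Kc.
by apply: filter_imp (nb _ s00) => s Hs; apply: ex_CInt_cont => t _; apply: Kt.
Qed.

(** * Cauchy's formula on a disc and accumulation of zeros *)

Definition circ (r t : R) : C := RtoC r * cexp (RtoC t * two_pi_i).

Lemma circ_der r t : Rder (circ r) t (two_pi_i * circ r t).
Proof.
apply: (R_der_eq (R_der_mult (R_der_const (RtoC r) t) (cexp_der two_pi_i t))).
by rewrite /circ; ring.
Qed.

Lemma circ_cont r t : continuous (circ r) t.
Proof. exact: R_der_cont (circ_der r t). Qed.

Lemma two_pi_iE t : RtoC t * two_pi_i = (0%R, (t * (2 * PI))%R).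
Proof. by rewrite /two_pi_i /Ci /Cmult /RtoC /=; congr (_, _); ring. Qed.

Lemma circ_mod r t : (0 < r)%R -> Cmod (circ r t) = r.
Proof.
move=> r0; rewrite /circ Cmod_mult Cmod_R Rabs_pos_eq; last lra.
rewrite two_pi_iE /cexp /= exp_0 /Cmod /=.
have := sin2_cos2 (t * (2 * PI)); rewrite /Rsqr => E.
have -> : (1 * cos (t * (2 * PI)) * (1 * cos (t * (2 * PI)) * 1) + 1 * sin (t * (2 * PI)) * (1 * sin (t * (2 * PI)) * 1) = 1)%R.
  by apply: eq_trans E; ring.
by rewrite sqrt_1; ring.
Qed.

Lemma circ_per r : circ r 1 = circ r 0.
Proof.
rewrite /circ !two_pi_iE /cexp /= Rmult_1_l Rmult_0_l cos_2PI sin_2PI cos_0 sin_0 //.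
Qed.

Section Disc.
Variables (f f' : C -> C) (r : R).
Hypothesis r0 : (0 < r)%R.
Hypothesis Hf : forall z, (Cmod z < 3 * r)%R -> Cder f z (f' z) /\ continuous (T := C_UniformSpace) f' z.

Let ker (w : C) (t : R) : C := circ r t / (circ r t - w).

Lemma circ_sub_mod w t : (r - Cmod w <= Cmod (circ r t - w))%R.
Proof.
have := Cmod_triangle (circ r t - w) w; rewrite C_subrK circ_mod //; lra.
Qed.

Lemma circ_sub_neq0 w t : (Cmod w < r)%R -> circ r t - w <> 0.
Proof. by move=> Hw E; have := circ_sub_mod w t; rewrite E Cmod_0; lra. Qed.

Lemma ker_cont w t : (Cmod w < r)%R -> continuous (ker w) t.
Proof.
move=> Hw; apply: C_cont_div; first exact: circ_cont.
  by apply: C_cont_minus; [exact: circ_cont | exact: C_cont_const].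
exact: circ_sub_neq0.
Qed.

Lemma fcirc_cont t : continuous (fun t => f (circ r t)) t.
Proof.
apply: (continuous_comp (circ r) f); first exact: circ_cont.
by apply: C_der_cont (Hf _).1; rewrite circ_mod //; lra.
Qed.

(** The circle is contracted to [w] along [p s t]. The derivative in [s] of the integral of
    [f (p s t) * ker w t] is the integral of [circ r t * f' (p s t)], which vanishes for [s > 0]. *)
Lemma cauchy w : (Cmod w < r)%R ->
  CInt (fun t => f (circ r t) * ker w t) = f w * CInt (ker w).
Proof.
move=> Hw.
pose p s t := w + RtoC s * (circ r t - w).
(* Differentiating at [s] in [0, 1] needs an open interval of parameters; on this one the contracted
   circles stay within radius [3 * r]. *)
have pin s t : (-1/2 < s < 3/2)%R -> (Cmod (p s t) < 3 * r)%R.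
  move=> Hs; rewrite /p.
  have -> : w + RtoC s * (circ r t - w) = RtoC (1 - s) * w + RtoC s * circ r t.
    by rewrite RtoC_minus; ring.
  apply: Rle_lt_trans (Cmod_triangle _ _) _; rewrite (Cmod_mult _ w) (Cmod_mult _ (circ r t)) !Cmod_R circ_mod //.
  have h1 : (Rabs (1 - s) <= 3 / 2)%R by apply: Rabs_le; lra.
  have h2 : (Rabs s <= 3 / 2)%R by apply: Rabs_le; lra.
  have := Cmod_ge_0 w; have := Rabs_pos (1 - s); have := Rabs_pos s; nra.
pose Phi s t := f (p s t) * ker w t.
pose Phi' s t := circ r t * f' (p s t).
have pc s t : continuous (fun q : R * R => p q.1 q.2) (s, t).
  apply: C_cont_plus; first exact: C_cont_const.
  apply: C_cont_mult; first exact/C_cont_RtoC/continuous_fst.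
  apply: C_cont_minus; last exact: C_cont_const.
  by apply: (continuous_comp snd (circ r)); [exact: continuous_snd | exact: circ_cont].
have pct s t : continuous (p s) t.
  by apply: C_cont_plus; [exact: C_cont_const | apply: C_cont_mult; [exact: C_cont_const | apply: C_cont_minus; [exact: circ_cont | exact: C_cont_const]]].
have D s : (0 <= s <= 1)%R -> Rder (fun s => CInt (Phi s)) s (CInt (Phi' s)).
  move=> Hs.
  have ns u : (Rabs (u - s) < 1 / 2)%R -> (-1/2 < u < 3/2)%R by move=> /Rabs_def2; lra.
  apply: (@CInt_param_der Phi Phi' s (1 / 2)); first lra.
  - move=> u t /ns Hu.
    have D1 : Rder (fun s => f (p s t)) u ((circ r t - w) * f' (p u t)).
      exact: (@R_der_comp f (fun s => p s t) u _ _ (Hf (pin u t Hu)).1 (R_der_lin w (circ r t - w) u)).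
    apply: (R_der_eq (R_der_mult D1 (R_der_const (ker w t) u))).
    by rewrite /Phi' /ker -/(p u t); have := @circ_sub_neq0 w t Hw => h; field.
  - move=> u t /ns Hu; apply: C_cont_mult.
      by apply: (continuous_comp snd (circ r)); [exact: continuous_snd | exact: circ_cont].
    by apply: (continuous_comp (fun q : R * R => p q.1 q.2) f'); [exact: pc | exact: (Hf (pin u t Hu)).2].
  - move=> u /ns Hu; apply: ex_CInt_cont => t _; apply: C_cont_mult; last exact: ker_cont.
    by apply: (continuous_comp (p u) f); [exact: pct | exact: C_der_cont (Hf (pin u t Hu)).1].
(* Up to the nonzero factor [s * two_pi_i] the integrand is the derivative in [t] of [f (p s t)],
   and the loop closes. *)
have Z s : (0 < s <= 1)%R -> CInt (Phi' s) = 0.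
  move=> Hs; have sn : RtoC s * two_pi_i <> 0.
    by apply: Cmult_neq_0; [move/RtoC_inj; lra | exact: two_pi_i_neq0].
  have Hs' : (-1/2 < s < 3/2)%R by lra.
  have cPhi' t : continuous (Phi' s) t.
    apply: C_cont_mult; first exact: circ_cont.
    by apply: (continuous_comp (p s) f'); [exact: pct | exact: (Hf (pin s t Hs')).2].
  have : RtoC s * two_pi_i * CInt (Phi' s) = 0.
    rewrite -CInt_mult; last by apply: ex_CInt_cont => t _.
    rewrite (@CInt_derive (fun t => f (p s t))).
    - by rewrite /p circ_per; ring.
    - move=> t _.
      have dp : Rder (p s) t (RtoC s * (two_pi_i * circ r t)).
        apply: (is_derive_ext (fun t => (w - RtoC s * w) + RtoC s * circ r t)) => [u|].
          by rewrite /p; apply: (_ : forall a b c : C, (a - b * a) + b * c = a + b * (c - a)); move=> *; ring.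
        apply: (R_der_eq (R_der_plus (R_der_const (w - RtoC s * w) t) (R_der_mult (R_der_const (RtoC s) t) (circ_der r t)))).
        by ring.
      apply: (R_der_eq (@R_der_comp f (p s) t _ _ (Hf (pin s t Hs')).1 dp)).
      by rewrite /Phi'; ring.
    - by move=> t _; apply: C_cont_mult => //; exact: C_cont_const.
  by move=> H; apply: NNPP => cn; exact: (Cmult_neq_0 _ _ sn cn H).
have : CInt (Phi 1%R) = CInt (Phi 0%R).
  apply: (@R_der_zero (fun s => CInt (Phi s))) => [s Hs|].
    by apply: (R_der_eq (D s _)); [lra | exact: Z].
  by apply: R_der_cont (D 0%R _); lra.
rewrite -CInt_mult; last by apply: ex_CInt_cont => t _; apply: ker_cont.
move=> E; transitivity (CInt (Phi 1%R)); [|rewrite E]; apply: CInt_ext => t _; rewrite /Phi /p;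
  congr (f _ * _); ring.
Qed.

Lemma fcirc_bound : exists M, (0 <= M)%R /\ forall t, (0 <= t <= 1)%R -> (Cmod (f (circ r t)) <= M)%R.
Proof.
have [|t0 [Ht0 _]] := continuity_ab_maj (fun t => Cmod (f (circ r t))) 0 1 Rle_0_1.
  move=> t _; apply/continuity_pt_filterlim/filterlim_locally => e.
  have /C_continuousP/(_ e (cond_pos e)) := @fcirc_cont t.
  apply: filter_imp => u Hu.
  rewrite /ball /= /AbsRing_ball /abs /minus /plus /opp /=.
  apply: Rle_lt_trans Hu.
  have h1 := Cmod_triangle (f (circ r u) - f (circ r t)) (f (circ r t)).
  have h2 := Cmod_triangle (- (f (circ r u) - f (circ r t))) (f (circ r u)).
  rewrite Cmod_opp in h2; rewrite C_subrK in h1.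
  rewrite (_ : - (f (circ r u) - f (circ r t)) + f (circ r u) = f (circ r t)) in h2; last by ring.
  by apply: Rabs_le; lra.
exists (Cmod (f (circ r t0))); split; [exact: Cmod_ge_0 | exact: Ht0].
Qed.

Definition zeros_cluster (g : C -> C) : Prop :=
  forall e, (0 < e)%R -> exists w : C, [/\ w <> 0, (Cmod w < e)%R & g w = 0].

(* Expanding Cauchy's formula in powers of [w]: as zeros cluster at [0], all coefficients
   vanish, and the remainder is [O ((|w| / r) ^ N)]. *)
Lemma disc_zero : zeros_cluster f -> forall w, (Cmod w < r / 2)%R -> f w = 0.
Proof.
move=> acc.
have [M [M0 HM]] := fcirc_bound.
have cn t : circ r t <> 0 by apply/Cmod_gt_0; rewrite circ_mod.
pose rho N w := CInt (fun t => f (circ r t) * Cpow (/ circ r t) N * ker w t).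
have pc N t : continuous (fun t => f (circ r t) * Cpow (/ circ r t) N) t.
  apply: C_cont_mult; first exact: fcirc_cont.
  by apply: C_cont_pow; apply: C_cont_inv => //; exact: circ_cont.
have kb w t : (Cmod w < r / 2)%R -> (Cmod (ker w t) <= 2)%R.
  move=> Hw; have Hw' : (Cmod w < r)%R by lra.
  rewrite /ker Cmod_div; last exact: circ_sub_neq0.
  rewrite circ_mod //; have := circ_sub_mod w t => h.
  by apply/Rle_div_l; lra.
have rb N w : (Cmod w < r / 2)%R -> (Cmod (rho N w) <= M * (/ r) ^ N * 2)%R.
  move=> Hw; apply: CInt_bound.
    by apply: ex_CInt_cont => t _; apply: C_cont_mult; [exact: pc | apply: ker_cont; lra].
  move=> t Ht; rewrite (Cmod_mult _ (ker w t)) (Cmod_mult (f (circ r t))) Cmod_pow Cmod_inv // circ_mod //.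
  have r1 : (0 <= (/ r) ^ N)%R by apply/pow_le/Rlt_le/Rinv_0_lt_compat.
  apply: Rmult_le_compat; [apply: Rmult_le_pos => //; exact: Cmod_ge_0 | exact: Cmod_ge_0 | | exact: kb].
  by apply: Rmult_le_compat_r => //; exact: HM.
have rec N w : (Cmod w < r / 2)%R ->
    rho N w = CInt (fun t => f (circ r t) * Cpow (/ circ r t) N) + w * rho N.+1 w.
  move=> Hw; have Hw' : (Cmod w < r)%R by lra.
  rewrite /rho -CInt_mult; last first.
    by apply: ex_CInt_cont => t _; apply: C_cont_mult; [exact: pc | exact: ker_cont].
  rewrite -CInt_plus.
  - apply: CInt_ext => t _; rewrite /ker Cpow_S; have := @circ_sub_neq0 w t Hw' => h; field; by split.
  - by apply: ex_CInt_cont => t _; exact: pc.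
  - apply: ex_CInt_cont => t _; apply: C_cont_mult; first exact: C_cont_const.
    by apply: C_cont_mult; [exact: pc | exact: ker_cont].
have main N w : (Cmod w < r / 2)%R -> f w * CInt (ker w) = Cpow w N * rho N w.
  elim: N w => [|N IH] w Hw.
    rewrite -cauchy; last lra.
    by rewrite /rho /= Cmult_1_l; apply: CInt_ext => t _; ring.
  (* At a nonzero zero [v] of [f] the induction hypothesis forces [c = - v * rho N.+1 v]. With [B]
     bounding [rho N.+1], this is impossible for nonzero [c] once [Cmod v < Cmod c / (B + 1)]. *)
  set c := CInt (fun t => f (circ r t) * Cpow (/ circ r t) N).
  suff c0 : c = 0 by rewrite IH // rec // -/c c0 Cpow_S; ring.
  apply: NNPP => /Cmod_gt_0 c0.
  set B := (M * (/ r) ^ N.+1 * 2)%R.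
  have B0 : (0 <= B)%R.
    by apply: Rmult_le_pos; [apply: Rmult_le_pos => //; apply/pow_le/Rlt_le/Rinv_0_lt_compat | lra].
  have e0 : (0 < Rmin (r / 2) (Cmod c / (B + 1)))%R.
    by apply: Rmin_glb_lt; [lra | apply: Rdiv_lt_0_compat; lra].
  have [v [v0 Hv fv]] := acc _ e0.
  have Hv1 : (Cmod v < r / 2)%R by apply: Rlt_le_trans Hv (Rmin_l _ _).
  have Hv2 : (Cmod v < Cmod c / (B + 1))%R by apply: Rlt_le_trans Hv (Rmin_r _ _).
  have E := IH v Hv1; rewrite fv rec // -/c in E.
  have E2 : c + v * rho N.+1 v = 0.
    apply: NNPP => h; have vN : Cpow v N <> 0 by exact: Cpow_nz.
    apply: (Cmult_neq_0 _ _ vN h); apply: eq_trans (esym E) _; ring.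
  have E3 : Cmod c = (Cmod v * Cmod (rho N.+1 v))%R.
    rewrite -Cmod_mult -[in RHS]Cmod_opp; congr Cmod.
    have -> : c = c + v * rho N.+1 v + - (v * rho N.+1 v) by ring.
    by rewrite E2; ring.
  have h1 := rb N.+1 v Hv1; rewrite -/B in h1.
  have h2 := Cmod_ge_0 v; have h3 := Cmod_ge_0 (rho N.+1 v).
  have h4 : (Cmod v * (B + 1) < Cmod c)%R by apply/Rlt_div_r => //; lra.
  nra.
move=> w Hw.
(* [ker w t - 1 = w / (circ r t - w)] has modulus at most [Cmod w / (r - Cmod w) < 1], so the mean
   of [ker w] cannot be 0. *)
have K0 : CInt (ker w) <> 0.
  have Hw' : (Cmod w < r)%R by lra.
  move=> E.
  have : (Cmod (CInt (fun t => (ker w t - 1)%C)) <= Cmod w / (r - Cmod w))%R.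
    apply: CInt_bound.
      by apply: ex_CInt_cont => t _; apply: C_cont_minus; [exact: ker_cont | exact: C_cont_const].
    move=> t _; have h := @circ_sub_neq0 w t Hw'.
    have -> : ker w t - 1 = w / (circ r t - w) by rewrite /ker; field.
    rewrite Cmod_div //; apply: Rmult_le_compat_l; first exact: Cmod_ge_0.
    by apply: Rinv_le_contravar; [lra | exact: circ_sub_mod].
  rewrite CInt_minus; last 2 first.
  - by apply: ex_CInt_cont => t _; exact: ker_cont.
  - by apply: ex_CInt_cont => t _; exact: C_cont_const.
  rewrite E CInt_const (_ : 0 - 1 = - (1)); last by ring.
  rewrite Cmod_opp Cmod_1 => /Rle_div_r; lra.
apply: NNPP => fw.
have /Cmod_gt_0 P := Cmult_neq_0 _ _ fw K0.
have [w0|w0] := Req_dec (Cmod w) 0.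
  apply: (Cmult_neq_0 _ _ fw K0); rewrite (main 1%nat w Hw) Cpow_S.
  by rewrite [X in X * _ * _](Cmod_eq_0 _ w0); ring.
have q1 : (Rabs (Cmod w / r) < 1)%R.
  rewrite Rabs_pos_eq; last by apply: Rdiv_le_0_compat => //; exact: Cmod_ge_0.
  by apply/Rlt_div_l => //; lra.
have e0 : (0 < Cmod (f w * CInt (ker w)) / (2 * M + 1))%R by apply: Rdiv_lt_0_compat; lra.
have [N HN] := pow_lt_1_zero _ q1 _ e0.
have := HN N (le_n N).
have E := main N w Hw.
have := rb N w Hw.
rewrite Rabs_pos_eq; last by apply: pow_le; apply: Rdiv_le_0_compat => //; exact: Cmod_ge_0.
rewrite E Cmod_mult Cmod_pow /Rdiv Rpow_mult_distr => h1 h2.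
have w1 : (0 <= Cmod w ^ N)%R by apply/pow_le/Cmod_ge_0.
have r1 : (0 < (/ r) ^ N)%R by apply/pow_lt/Rinv_0_lt_compat.
have h3 : (Cmod w ^ N * (/ r) ^ N * (2 * M + 1) < Cmod w ^ N * Cmod (rho N w))%R.
  by apply/Rlt_div_r => //; lra.
have h4 := Rmult_le_compat_l _ _ _ w1 h1; nra.
Qed.

End Disc.

(** Let [m] be the supremum of the [t] for which [f] vanishes on [0, t]. Zeros cluster at [m] from
    the left, so [f] vanishes on a disc around [m], and [m] can only be 1. *)
Lemma id_segment (Om : C -> Prop) (f f' : C -> C) (dl : R) :
  open (T := C_UniformSpace) Om -> (forall t, (0 <= t <= 1)%R -> Om (RtoC t)) ->
  (forall z, Om z -> Cder f z (f' z) /\ continuous (T := C_UniformSpace) f' z) ->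
  (0 < dl)%R -> (forall t, (0 <= t < dl)%R -> f (RtoC t) = 0) -> f (RtoC 1) = 0.
Proof.
move=> HO Hseg Hf dl0 Hz.
pose E t := (0 <= t <= 1)%R /\ forall u, (0 <= u <= t)%R -> f (RtoC u) = 0.
have E0 : E 0%R by split; [lra | move=> u Hu; apply: Hz; lra].
have [m [Hm1 Hm2]] : {m | is_lub E m}.
  by apply: completeness; [exists 1%R => t [? _]; lra | exists 0%R].
have m01 : (0 <= m <= 1)%R by split; [exact: Hm1 | apply: Hm2 => t [? _]; lra].
have below u : (0 <= u < m)%R -> f (RtoC u) = 0.
  move=> Hu; apply: NNPP => ne.
  have : is_upper_bound E u.
    move=> t [Ht Ht2]; apply: Rnot_lt_le => ut; apply: ne; apply: Ht2; lra.
  move/Hm2; lra.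
have mpos : (0 < m)%R.
  have : E (Rmin (dl / 2) 1).
    have a1 := Rmin_l (dl / 2) 1; have a2 := Rmin_r (dl / 2) 1.
    have a3 : (0 < Rmin (dl / 2) 1)%R by apply: Rmin_glb_lt; lra.
    by split; [lra | move=> u Hu; apply: Hz; lra].
  move/Hm1; have a3 : (0 < Rmin (dl / 2) 1)%R by apply: Rmin_glb_lt; lra.
  lra.
have [e He] := HO _ (Hseg m m01).
have inO w : (Cmod w < e)%R -> Om (RtoC m + w).
  move=> Hw; apply: He; apply: C_ballP.
  by rewrite (_ : RtoC m + w - RtoC m = w); last by ring.
pose r := (e / 3)%R.
have r0 : (0 < r)%R by apply: Rdiv_lt_0_compat; [exact: cond_pos | lra].
pose g w := f (RtoC m + w); pose g' w := f' (RtoC m + w).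
have Hg z : (Cmod z < 3 * r)%R -> Cder g z (g' z) /\ continuous (T := C_UniformSpace) g' z.
  move=> Hz'; have [D1 D2] := Hf _ (inO z ltac:(rewrite /r in Hz'; lra)); split.
    have [p [pc pE Hp]] := C_der_to_slope D1.
    have -> : g' z = p (RtoC m + z) by rewrite pE.
    apply: (@C_der_slope g (fun w => p (RtoC m + w)) z).
      by apply: filter_imp filter_true => w _; rewrite /g Hp; ring.
    apply: (continuous_comp (U := C_UniformSpace) (V := C_UniformSpace) (fun w => RtoC m + w) p) => //.
    by apply: C_cont_plus; [exact: C_cont_const | exact: continuous_id].
  apply: (continuous_comp (U := C_UniformSpace) (V := C_UniformSpace) (fun w => RtoC m + w) f') => //.
  by apply: C_cont_plus; [exact: C_cont_const | exact: continuous_id].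
have acc : zeros_cluster g.
  move=> d d0; pose h := (Rmin (d / 2) (m / 2))%R.
  have h0 : (0 < h)%R by apply: Rmin_glb_lt; lra.
  have h1 := Rmin_l (d / 2) (m / 2); have h2 := Rmin_r (d / 2) (m / 2); rewrite -/h in h1 h2.
  exists (RtoC (- h)); split.
  - by move/RtoC_inj; lra.
  - by rewrite Cmod_R Rabs_Ropp Rabs_pos_eq; lra.
  - by rewrite /g -RtoC_plus; apply: below; lra.
have dz := disc_zero r0 Hg acc.
have near u : (Rabs (u - m) < r / 2)%R -> f (RtoC u) = 0.
  move=> Hu; have := dz (RtoC (u - m)); rewrite /g -RtoC_plus Cmod_R Rplus_comm => H.
  by rewrite -(H Hu); congr (f (RtoC _)); ring.
have [lt1|m1] := proj2 m01; last by apply: near; rewrite m1 Rminus_diag Rabs_R0; lra.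
pose h := (Rmin (r / 4) (1 - m))%R.
have h0 : (0 < h)%R by apply: Rmin_glb_lt; lra.
have h1 := Rmin_l (r / 4) (1 - m); have h2 := Rmin_r (r / 4) (1 - m); rewrite -/h in h1 h2.
have : E (m + h)%R.
  split=> [|u Hu]; first lra.
  have [um|um] := Rlt_le_dec u m; first by apply: below; lra.
  by apply: near; rewrite Rabs_pos_eq; lra.
move/Hm1; lra.
Qed.

(** * The identity theorem in several variables *)

Lemma fct_ballP (r : nat) (z y : 'I_r -> C) (e : posreal) :
  (forall k, (Cmod (y k - z k) < e)%R) -> @ball (fct_UniformSpace 'I_r C_UniformSpace) z e y.
Proof. by move=> H k; apply: C_ballP. Qed.

Notation Cn r := (fct_UniformSpace 'I_r C_UniformSpace).

Lemma set_coord_idem (r : nat) (z : 'I_r -> C) i u v : set_coord (set_coord z i u) i v = set_coord z i v.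
Proof. by apply: functional_extensionality => k; rewrite /set_coord; case: eqP. Qed.

Lemma set_coord_at (r : nat) (z : 'I_r -> C) i u : set_coord z i u i = u.
Proof. by rewrite /set_coord eqxx. Qed.

Lemma set_coord_id (r : nat) (z : 'I_r -> C) i : set_coord z i (z i) = z.
Proof. by apply: functional_extensionality => k; rewrite /set_coord; case: eqP => [->|]. Qed.

Lemma filter_fin (T : Type) (Fl : (T -> Prop) -> Prop) (FF : Filter Fl) (I : finType) (P : I -> T -> Prop) :
  (forall i, Fl (P i)) -> Fl (fun x => forall i, P i x).
Proof.
move=> H.
have G (s : seq I) : Fl (fun x => forall i, i \in s -> P i x).
  elim: s => [|j s IH]; first by apply: filter_imp filter_true.
  apply: filter_imp (filter_and _ _ (H j) IH) => x [h1 h2] i.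
  by rewrite inE => /orP [/eqP ->|/h2].
by apply: filter_imp (G (enum I)) => x Hx i; apply: Hx; rewrite mem_enum.
Qed.

Lemma cont_Cn (X : UniformSpace) r (g : X -> 'I_r -> C) x :
  (forall k, continuous (U := C_UniformSpace) (fun y => g y k) x) -> continuous (U := Cn r) g x.
Proof.
move=> H; apply/filterlim_locally => e.
have : locally x (fun y => forall k, (Cmod (g y k - g x k) < e)%R).
  by apply: filter_fin => k; have /C_continuousP := H k; apply; exact: cond_pos.
by apply: filter_imp => y Hy; apply: fct_ballP.
Qed.

Lemma coord_cont r (k : 'I_r) (z : 'I_r -> C) : continuous (T := Cn r) (U := C_UniformSpace) (fun y => y k) z.
Proof. by apply/filterlim_locally => e; exists e => y /(_ k). Qed.

Section Path.
Variables (r : nat) (U : ('I_r -> C) -> Prop) (F : ('I_r -> C) -> C) (dF : 'I_r -> ('I_r -> C) -> C).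
Hypothesis HU : open (T := Cn r) U.
Hypothesis HF : forall z, U z -> forall i,
  Cder (fun w : C => F (set_coord z i w)) (z i) (dF i z) /\ continuous (T := Cn r) (dF i) z.
Variable z : 'I_r -> C.

Definition ray (t : C) : 'I_r -> C := fun k => t * z k.

Definition ray_deriv (s : seq 'I_r) (t : C) : C := foldr (fun i c => z i * dF i (ray t) + c) 0 s.

Lemma ray_cont t : continuous (T := C_UniformSpace) (U := Cn r) ray t.
Proof.
by apply: cont_Cn => k; apply: C_cont_mult; [exact: continuous_id | exact: C_cont_const].
Qed.

Lemma ray_deriv_cont s t : U (ray t) -> continuous (T := C_UniformSpace) (ray_deriv s) t.
Proof.
move=> Ht; elim: s => [|i s IH] /=; first exact: C_cont_const.
apply: C_cont_plus => //; apply: C_cont_mult; first exact: C_cont_const.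
apply: (continuous_comp (U := C_UniformSpace) (V := Cn r) ray (dF i)); [exact: ray_cont | exact: (HF Ht i).2].
Qed.

(** A chain rule from jointly continuous partial derivatives. The coordinates are moved from [t0] to
    [u] one at a time: [hyb s u] has moved those in [s]. Each move changes [F] by the integral of
    one partial derivative over a segment, which supplies a slope continuous at [t0]. *)
Lemma ray_der t0 : U (ray t0) -> Cder (fun t => F (ray t)) t0 (ray_deriv (enum 'I_r) t0).
Proof.
move=> Ht0.
pose hyb (s : seq 'I_r) (u : C) : 'I_r -> C := fun i => if i \in s then u * z i else t0 * z i.
have hybE s : hyb s t0 = ray t0 by apply: functional_extensionality => i; rewrite /hyb /ray; case: ifP.
suff H s : uniq s -> exists G : C -> C, [/\ continuous (T := C_UniformSpace) G t0, G t0 = ray_deriv s t0 &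
    @locally C_UniformSpace t0 (fun u => F (hyb s u) - F (ray t0) = (u - t0) * G u)].
  have [G [Gc <- HG]] := H _ (enum_uniq 'I_r).
  apply: C_der_slope => //; apply: filter_imp HG => u <-; congr (F _ - _).
  by apply: functional_extensionality => i; rewrite /hyb mem_enum.
elim: s => [|i s IH] /=.
  move=> _; exists (fun _ => 0); split => //; first exact: C_cont_const.
  apply: filter_imp filter_true => u _.
  rewrite (_ : hyb [::] u = ray t0); first by ring.
  by apply: functional_extensionality => i; rewrite /hyb /ray.
move=> /andP [si us]; have [G [Gc G0 HG]] := IH us.
pose m (u : C) (t : R) := set_coord (hyb s u) i (t0 * z i + RtoC t * (u * z i - t0 * z i)).
have mc u t : continuous (T := prod_UniformSpace C_UniformSpace R_UniformSpace) (U := Cn r) (fun p => m p.1 p.2) (u, t).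
  have c1 : continuous (T := prod_UniformSpace C_UniformSpace R_UniformSpace) (U := C_UniformSpace) (fun p => p.1) (u, t).
    exact: continuous_fst.
  apply: cont_Cn => k; rewrite /m /set_coord /hyb; case: (k == i).
    apply: C_cont_plus; first exact: C_cont_const.
    apply: C_cont_mult; first exact/C_cont_RtoC/continuous_snd.
    by apply: C_cont_minus; [apply: C_cont_mult => //; exact: C_cont_const | exact: C_cont_const].
  by case: (k \in s); [apply: C_cont_mult => // |]; exact: C_cont_const.
have m0 t : m t0 t = ray t0.
  rewrite /m hybE -[RHS](set_coord_id (ray t0) i); congr set_coord; rewrite /ray; ring.
have mU : @locally C_UniformSpace t0 (fun u => forall t, (0 <= t <= 1)%R -> U (m u t)).
  apply: (@tube C_UniformSpace t0 (fun u t => U (m u t))) => t _.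
  by apply: (mc t0 t); apply: HU; rewrite /= m0.
pose H u := CInt (fun t => dF i (m u t)).
have dc u t : U (m u t) -> continuous (T := prod_UniformSpace C_UniformSpace R_UniformSpace) (U := C_UniformSpace) (fun p => dF i (m p.1 p.2)) (u, t).
  move=> Hu; apply: (continuous_comp (U := prod_UniformSpace C_UniformSpace R_UniformSpace) (V := Cn r) (fun p => m p.1 p.2) (dF i)); first exact: mc.
  exact: (HF Hu i).2.
have dct u t : U (m u t) -> continuous (fun t => dF i (m u t)) t.
  move=> Hu; apply: (@continuous_comp_2 _ C_UniformSpace R_UniformSpace C_UniformSpace (fun _ => u) (fun t => t) (fun u t => dF i (m u t))).
  - exact: continuous_const.
  - exact: continuous_id.
  - exact: dc.
have Hc : continuous (T := C_UniformSpace) H t0.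
  apply: (@CInt_cont C_UniformSpace (fun u t => dF i (m u t))).
    by move=> t Ht; apply: dc; rewrite m0.
  by apply: filter_imp mU => u Hu; apply: ex_CInt_cont => t /Hu; exact: dct.
exists (fun u => z i * H u + G u); split.
- by apply: C_cont_plus => //; apply: C_cont_mult => //; exact: C_cont_const.
- rewrite G0 /H; congr (_ * _ + _); rewrite -[RHS]CInt_const; apply: CInt_ext => t _; by rewrite m0.
apply: filter_imp (filter_and _ _ mU HG) => u [Hu HGu].
pose f w := F (set_coord (hyb s u) i w); pose f' w := dF i (set_coord (hyb s u) i w).
have D t : (0 <= t <= 1)%R -> Cder f (t0 * z i + RtoC t * (u * z i - t0 * z i)) (f' (t0 * z i + RtoC t * (u * z i - t0 * z i))).
  move=> /Hu Ut; have [D1 _] := HF Ut i; rewrite {2}/m set_coord_at in D1.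
  by apply: is_derive_ext D1 => w; rewrite /m set_coord_idem.
have Dc t : (0 <= t <= 1)%R -> continuous (T := C_UniformSpace) f' (t0 * z i + RtoC t * (u * z i - t0 * z i)).
  move=> /Hu Ut; have [_ D1] := HF Ut i.
  apply: (continuous_comp (U := C_UniformSpace) (V := Cn r) (fun w => set_coord (hyb s u) i w) (dF i)); last exact: D1.
  by apply: cont_Cn => k; rewrite /set_coord; case: (k == i); [exact: continuous_id | exact: C_cont_const].
have E := segment_int D Dc.
have e1 : hyb (i :: s) u = set_coord (hyb s u) i (u * z i).
  by apply: functional_extensionality => k; rewrite /hyb /set_coord inE; case: eqP => [->|].
have e2 : hyb s u = set_coord (hyb s u) i (t0 * z i).
  apply: functional_extensionality => k; rewrite /set_coord; case: eqP => [->|//].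
  by rewrite /hyb (negbTE si).
have -> : F (hyb (i :: s) u) - F (ray t0) = (f (u * z i) - f (t0 * z i)) + (F (hyb s u) - F (ray t0)).
  rewrite /f -e1 -e2; ring.
rewrite E HGu /H /f' /m; ring.
Qed.

(** On the complex line through 0 and [z] this is the theorem in one variable, with the segment from
    0 to 1. *)
Theorem hol_identity : (forall t, (0 <= t <= 1)%R -> U (ray (RtoC t))) ->
  locally (T := Cn r) (fun _ => RtoC 0) (fun y => F y = 0) -> F z = 0.
Proof.
move=> Hseg H0.
have E0 : ray 0 = fun _ => RtoC 0 by apply: functional_extensionality => k; rewrite /ray; ring.
have : @locally C_UniformSpace (RtoC 0) (fun t => F (ray t) = 0).
  by have := @ray_cont (RtoC 0); rewrite /continuous E0 => /(_ _ H0).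
move=> [dl Hdl].
have -> : z = ray (RtoC 1) by apply: functional_extensionality => k; rewrite /ray; ring.
apply: (@id_segment (fun t => U (ray t)) (fun t => F (ray t)) (ray_deriv (enum 'I_r)) dl) => //.
- by move=> t Ht; apply: ray_cont; apply: HU.
- by move=> t Ht; split; [exact: ray_der | exact: ray_deriv_cont].
- exact: cond_pos.
- move=> t Ht; apply: Hdl; apply: C_ballP.
  by rewrite (_ : RtoC t - 0 = RtoC t) ?Cmod_R ?Rabs_pos_eq; [lra|lra|ring].
Qed.

End Path.

Lemma hol_const r (U : ('I_r -> C) -> Prop) (c : C) : holomorphic_on U (fun _ => c).
Proof.
exists (fun _ _ => 0) => z _ i; split; last exact: C_cont_const.
exact: (@is_derive_const C_AbsRing C_NormedModule).
Qed.

Lemma hol_plus r (U : ('I_r -> C) -> Prop) F G : holomorphic_on U F -> holomorphic_on U G ->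
  holomorphic_on U (fun z => F z + G z).
Proof.
move=> [dF HF] [dG HG]; exists (fun i z => dF i z + dG i z) => z Uz i.
have [a1 a2] := HF z Uz i; have [b1 b2] := HG z Uz i; split; last exact: C_cont_plus.
exact: (@is_derive_plus C_AbsRing C_NormedModule).
Qed.

Lemma C_der_mult (f g : C -> C) z a b : Cder f z a -> Cder g z b ->
  Cder (fun w => f w * g w) z (a * g z + f z * b).
Proof.
move=> Df Dg; have fc := C_der_cont Df.
have [p [pc <- Hp]] := C_der_to_slope Df; have [q [qc <- Hq]] := C_der_to_slope Dg.
apply: (@C_der_slope _ (fun w => p w * g z + f w * q w)).
  apply: filter_imp filter_true => w _.
  have -> : f w * g w - f z * g z = (f w - f z) * g z + f w * (g w - g z) by ring.
  rewrite Hp Hq; ring.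
by apply: C_cont_plus; apply: C_cont_mult => //; exact: C_cont_const.
Qed.

(** Continuity of [F] is carried along because the partial derivatives of a product contain the
    factors themselves. *)
Definition holc r (U : ('I_r -> C) -> Prop) (F : ('I_r -> C) -> C) : Prop :=
  holomorphic_on U F /\ forall z, U z -> continuous (T := Cn r) (U := C_UniformSpace) F z.

Lemma holc_const r (U : ('I_r -> C) -> Prop) (c : C) : holc U (fun _ => c).
Proof. by split; [exact: hol_const | move=> z _; exact: C_cont_const]. Qed.

Lemma holc_plus r (U : ('I_r -> C) -> Prop) F G : holc U F -> holc U G -> holc U (fun z => F z + G z).
Proof.
move=> [HF Fc] [HG Gc]; split; first exact: hol_plus.
by move=> z Uz; apply: C_cont_plus; [exact: Fc | exact: Gc].
Qed.

Lemma holc_mult r (U : ('I_r -> C) -> Prop) F G : holc U F -> holc U G -> holc U (fun z => F z * G z).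
Proof.
move=> [[dF HF] Fc] [[dG HG] Gc]; split; last first.
  by move=> z Uz; apply: C_cont_mult; [exact: Fc | exact: Gc].
exists (fun i z => dF i z * G z + F z * dG i z) => z Uz i.
have [a1 a2] := HF z Uz i; have [b1 b2] := HG z Uz i.
have cF := Fc z Uz; have cG := Gc z Uz; split.
  have := C_der_mult a1 b1; by rewrite set_coord_id.
by apply: C_cont_plus; apply: C_cont_mult.
Qed.

Lemma hol_subset r (U V : ('I_r -> C) -> Prop) F : (forall z, V z -> U z) -> holomorphic_on U F -> holomorphic_on V F.
Proof. by move=> VU [dF HF]; exists dF => z /VU; exact: HF. Qed.

Lemma C_lim_unique (f : nat -> C) (a b : C) :
  filterlim f eventually (locally (T := C_UniformSpace) a) ->
  filterlim f eventually (locally (T := C_UniformSpace) b) -> a = b.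
Proof.
exact: (@filterlim_locally_unique nat R_AbsRing C_R_NormedModule eventually _ f).
Qed.

(** The intersection of the two domains is open and contains the segment, and near the origin both
    functions are the limit of the same series. *)
Lemma is_Li_unique r (n : 'I_r -> nat) z v v' : is_Li n z v -> is_Li n z v' -> v = v'.
Proof.
move=> [U [F [HU sU HF LF <-]]] [U' [F' [HU' sU' HF' LF' <-]]].
suff : F z + - F' z = 0.
  by move=> E; rewrite -(C_subrK (F z) (F' z)) /Cminus E Cplus_0_l.
have [dF H] : holomorphic_on (fun z => U z /\ U' z) (fun z => F z + - F' z).
  apply: hol_plus; first by apply: hol_subset HF => ? [].
  have [dG HG] : holomorphic_on (fun z => U z /\ U' z) F' by apply: hol_subset HF' => ? [].
  exists (fun i z => - dG i z) => y Uy i; have [a b] := HG y Uy i; split.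
    exact: (@is_derive_opp C_AbsRing C_NormedModule).
  exact: C_cont_opp.
have OO : open (T := Cn r) (fun z => U z /\ U' z) by apply: open_and.
refine (@hol_identity r _ (fun z => F z + - F' z) dF OO H z _ _) => [t Ht|]; first by split; [exact: sU | exact: sU'].
apply: filter_imp (filter_and _ _ LF LF') => y [a b].
rewrite (C_lim_unique a b); ring.
Qed.

(** * Convergence of the truncated sums *)

(* The head of a list belongs to the largest summation index, so the arguments
   of the iterated integral are the products of the prefixes. *)
Fixpoint wl (c : C) (l : seq (nat * C)) : seq (nat * C) :=
  if l is q :: l' then (q.1, c * q.2) :: wl (c * q.2) l' else [::].

(** Summation indices are positive, so [k] stands for the index [k + 1]. Hence an inner sum
    truncated at [k] is one over strictly smaller indices, and truncation at [k.+1] admits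
    equality. *)
Definition tm (n : nat) (y : C) (k : nat) : C := Cpow y k.+1 / Cpow (RtoC (INR k.+1)) n.

Fixpoint trS (l : seq (nat * C)) (N : nat) : C :=
  if l is q :: l' then csum (fun k => tm q.1 q.2 k * trS l' k) N else 1.

Definition small (y : C) : Prop := (Cmod y <= / 2)%R.

Definition rho (l : seq (nat * C)) (N : nat) : C := lam (wl 1 l) 1 - trS l N.

Lemma size_wl c l : size (wl c l) = size l.
Proof. by elim: l c => //= q l IH c; rewrite IH. Qed.

Lemma small_mult x y : small x -> small y -> small (x * y).
Proof.
rewrite /small Cmod_mult => Hx Hy; have := Cmod_ge_0 x; have := Cmod_ge_0 y; nra.
Qed.

Lemma small_real t y : (0 <= t <= 1)%R -> small y -> small (RtoC t * y).
Proof.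
rewrite /small Cmod_mult Cmod_R => Ht Hy; rewrite Rabs_pos_eq; last lra.
have := Cmod_ge_0 y; nra.
Qed.

Lemma small_slit y : small y -> slit y.
Proof.
move=> Hy t Ht E; have h : small (RtoC (t * 1) * y) by apply: small_real => //; lra.
have E2 : RtoC (t * 1) * y = 1 by rewrite -[LHS]Cplus_0_l -E; ring.
by move: h; rewrite /small E2 Cmod_1; lra.
Qed.

Lemma wl_small c l : (Cmod c <= 1)%R -> (forall q, List.In q l -> small q.2) ->
  forall q, List.In q (wl c l) -> small q.2.
Proof.
elim: l c => [|p l IH] c Hc Hl q //= [<- /=|].
  have := Hl p (or_introl erefl); rewrite /small Cmod_mult; have := Cmod_ge_0 c; have := Cmod_ge_0 p.2; nra.
apply: IH => [|r Hr]; last by apply: Hl; right.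
have := Hl p (or_introl erefl); rewrite /small Cmod_mult; have := Cmod_ge_0 c; have := Cmod_ge_0 p.2; nra.
Qed.

Lemma wl_scale c l : wl c l = [seq (q.1, c * q.2) | q <- wl 1 l].
Proof.
elim: l c => [|q l IH] c //=; rewrite Cmult_1_l IH [in RHS](IH q.2) -map_comp; congr (_ :: _).
by apply: eq_map => p /=; rewrite Cmult_assoc.
Qed.

Lemma ok_small l : (forall q, List.In q l -> small q.2) -> ok 1 l.
Proof. by move=> H; apply/List.Forall_forall => q /H; exact: small_slit. Qed.

Lemma ok_map c l : (forall q, List.In q l -> slit (c * q.2)) -> ok 1 [seq (q.1, c * q.2) | q <- l].
Proof.
elim: l => [|q l IH] H /=; first by constructor.
by constructor; [apply: H; left | apply: IH => p Hp; apply: H; right].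
Qed.

Lemma geo_half N : (forall k, 0 <= (/ 2) ^ k)%R /\ (csum (fun k => RtoC ((/ 2) ^ k.+1)) N = RtoC (1 - (/ 2) ^ N)).
Proof.
split; first by move=> k; apply: pow_le; lra.
elim: N => [|N IH]; first by rewrite /csum /=; congr RtoC; ring.
by rewrite csum_recr IH -RtoC_plus; congr RtoC; rewrite /=; lra.
Qed.

Lemma csum_bound (f : nat -> C) (g : nat -> R) N : (forall k, (k < N)%nat -> (Cmod (f k) <= g k)%R) ->
  (Cmod (csum f N) <= Re (csum (fun k => RtoC (g k)) N))%R.
Proof.
elim: N => [|N IH] H; first by rewrite /csum Cmod_0 /=; lra.
rewrite !csum_recr; apply: Rle_trans (Cmod_triangle _ _) _.
have h1 := IH (fun k Hk => H k (ltnW Hk)); have h2 := H N (ltnSn N).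
have -> : Re (csum (fun k => RtoC (g k)) N + RtoC (g N)) = (Re (csum (fun k => RtoC (g k)) N) + g N)%R by [].
lra.
Qed.

Lemma INRS_ge1 k : (1 <= INR k.+1)%R.
Proof. rewrite S_INR; have := pos_INR k; lra. Qed.

Lemma tm_bound n y k : (Cmod (tm n y k) <= Cmod y ^ k.+1)%R.
Proof.
have h := INRS_ge1 k.
have nz : Cpow (RtoC (INR k.+1)) n <> 0 by apply: Cpow_nz; move/RtoC_inj; lra.
rewrite /tm Cmod_div // !Cmod_pow Cmod_R Rabs_pos_eq; last lra.
have p1 : (1 <= INR k.+1 ^ n)%R by apply: pow_R1_Rle.
have p2 : (0 <= Cmod y ^ k.+1)%R by apply/pow_le/Cmod_ge_0.
apply/Rle_div_l; first lra.
nra.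
Qed.

Lemma trS_bound l N : (forall q, List.In q l -> small q.2) -> (Cmod (trS l N) <= 1)%R.
Proof.
elim: l N => [|q l IH] N H /=; first by rewrite Cmod_1; lra.
have B : (Re (csum (fun k => RtoC ((/ 2) ^ k.+1)) N) <= 1)%R.
  by have [h1 ->] := geo_half N; have := h1 N; rewrite /Re /=; lra.
apply: Rle_trans _ B; apply: csum_bound => k _.
rewrite Cmod_mult; have h1 := IH k (fun p Hp => H p (or_intror Hp)).
have h2 := tm_bound q.1 q.2 k; have h3 := H q (or_introl erefl).
have h4 : (Cmod q.2 ^ k.+1 <= (/ 2) ^ k.+1)%R.
  by apply: pow_incr; split; [exact: Cmod_ge_0 | exact: h3].
have := Cmod_ge_0 (trS l k); have := Cmod_ge_0 (tm q.1 q.2 k); nra.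
Qed.

Lemma cont0_bound (f : R -> C) M : continuous f 0%R ->
  (forall t, (0 < t <= 1)%R -> (Cmod (f t) <= M)%R) -> (Cmod (f 0%R) <= M)%R.
Proof.
move=> /C_continuousP Hc H; apply: Rnot_lt_le => lt.
have e0 : (0 < Cmod (f 0%R) - M)%R by lra.
have [d Hd] := Hc _ e0.
pose t := Rmin (d / 2) 1.
have d0 := cond_pos d.
have t0 : (0 < t)%R by apply: Rmin_glb_lt; lra.
have t1 : (t <= d / 2)%R by exact: Rmin_l.
have t2 : (t <= 1)%R by exact: Rmin_r.
have bt : ball 0%R d t.
  rewrite /ball /= /AbsRing_ball /abs /minus /plus /opp /= Ropp_0 Rplus_0_r Rabs_pos_eq; lra.
have h1 := Hd t bt; have h2 := H t (conj t0 t2).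
have := Cmod_triangle (f 0%R - f t) (f t); rewrite C_subrK.
have -> : f 0%R - f t = - (f t - f 0%R) by ring.
rewrite Cmod_opp; lra.
Qed.

Lemma csum_cext (f g : nat -> C) N : (forall k, f k = g k) -> csum f N = csum g N.
Proof. by move=> H; apply: csum_ext => k _. Qed.

Lemma CInt_csum (f : nat -> R -> C) N : (forall k t, continuous (f k) t) ->
  CInt (fun t => csum (fun k => f k t) N) = csum (fun k => CInt (f k)) N.
Proof.
move=> Hf; elim: N => [|N IH]; first exact: CInt_const.
rewrite csum_recr -IH -CInt_plus //.
  by apply: ex_CInt_cont => t _; apply: csum_cont => k _.
exact: ex_CInt_cont.
Qed.

Lemma CInt_pow (k : nat) : CInt (fun t => RtoC (t ^ k)) = / RtoC (INR k.+1).
Proof.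
have h : INR k.+1 <> 0%R by have := INRS_ge1 k; lra.
rewrite (@CInt_derive (fun t => RtoC (/ INR k.+1 * t ^ k.+1))).
- rewrite -RtoC_minus -RtoC_inv //; congr RtoC; rewrite pow1 pow_i; [ring | exact/ltP].
- move=> t _.
  apply: (R_der_eq (R_der_RtoC (is_derive_scal _ t (/ INR k.+1)%R _ (is_derive_pow (fun u => u) k.+1 t 1 (is_derive_id t))))).
  by congr RtoC; change (/ INR k.+1 * (INR k.+1 * 1 * t ^ k) = t ^ k)%R; field; exact: h.
- by move=> t _; apply: cont_pow; exact: continuous_id.
Qed.

Lemma ok_cont l t : ok 1 l -> (0 <= t <= 1)%R -> continuous (MK (kers l)) t.
Proof.
move=> H Ht; have E : t = (t * 1)%R by ring.
have /(ok_cdom (t * 1) l 0%R) H' := ok_scale H Ht; rewrite -E in H'.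
apply: (cont_on_slice (O := cdom [seq q.2 | q <- l]) (x := 0%R) (g := fun _ => MK (kers l))) => //.
by apply: cdom_MK => q Hq; apply: (List.in_map snd).
Qed.

(** The remainder of index [n.+1] is the integral over [t] of the remainder of index [n] at [t * y],
    divided by [t]. The factor [Cmod y] in the bound pays for this division. *)
Lemma rho_succ (l : seq (nat * C)) n N (K : R) : (0 <= K)%R -> (forall q, List.In q l -> small q.2) ->
  (forall y, small y -> (Cmod (rho ((n, y) :: l) N) <= K * Cmod y)%R) ->
  forall y, small y -> (Cmod (rho ((n.+1, y) :: l) N) <= K * Cmod y)%R.
Proof.
move=> K0 Hl H y Hy.
set r := size l.
pose L := wl 1 ((n, y) :: l).
have okL : ok 1 L.
  by apply/ok_small/wl_small => [|q [<-|]] //; [rewrite Cmod_1; lra | exact: Hl].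
pose f t := RtoC (t ^ r) * MK (kers L) t.
pose g t := csum (fun k => RtoC (t ^ k) * (tm n y k * trS l k)) N.
have fc t : (0 <= t <= 1)%R -> continuous f t.
  by move=> Ht; apply: C_cont_mult; [apply: cont_pow; exact: continuous_id | exact: ok_cont].
have gc' k t : continuous (fun t => RtoC (t ^ k) * (tm n y k * trS l k)) t.
  by apply: C_cont_mult; [apply: cont_pow; exact: continuous_id | exact: C_cont_const].
have gc t : continuous g t by apply: csum_cont => k _.
have -> : rho ((n.+1, y) :: l) N = CInt (fun t => f t - g t).
  rewrite CInt_minus; last by apply: ex_CInt_cont => t _.
    congr (_ - _).
      rewrite /lam pow1 Cmult_1_l /= size_map size_wl /Pint; apply: CInt_ext => t _.
      by rewrite Rmult_1_r /f /L /= size_map size_wl.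
    rewrite /= CInt_csum //; apply: csum_cext => k.
    rewrite (@CInt_ext _ (fun t => (tm n y k * trS l k) * RtoC (t ^ k))) => [|t _]; last by ring.
    rewrite CInt_mult; last by apply: ex_CInt_cont => t _; apply: cont_pow; exact: continuous_id.
    rewrite CInt_pow /tm (Cpow_S (RtoC (INR k.+1)) n); have h := INRS_ge1 k.
    have nz : RtoC (INR k.+1) <> 0 by move/RtoC_inj; lra.
    have nz2 : Cpow (RtoC (INR k.+1)) n <> 0 by exact: Cpow_nz.
    by field.
  by apply: ex_CInt_cont.
have B t : (0 < t <= 1)%R -> (Cmod (f t - g t) <= K * Cmod y)%R.
  move=> Ht; have t01 : (0 <= t <= 1)%R by lra.
  have tn : RtoC t <> 0 by move/RtoC_inj; lra.
  have E1 : RtoC t * (f t - g t) = rho ((n, RtoC t * y) :: l) N.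
    have -> : RtoC t * (f t - g t) = RtoC t * f t - RtoC t * g t by ring.
    rewrite /rho; congr (_ - _).
      have -> : wl 1 ((n, RtoC t * y) :: l) = [seq (q.1, RtoC t * q.2) | q <- L].
        rewrite /L /= (wl_scale (1 * (RtoC t * y))) (wl_scale (1 * y)) -map_comp; congr ((_, _) :: _); first by ring.
        by apply: eq_map => q /=; congr (_, _); ring.
      rewrite lam_dil.
        rewrite Rmult_1_r /lam /f /L /= size_wl -/r RtoC_mult; ring.
      apply: ok_map => p Hp; apply: small_slit; apply: small_real => //; move: Hp; apply: wl_small; first by rewrite Cmod_1; lra.
      by move=> s [<-|/Hl].
    rewrite /g /= -csum_scal; apply: csum_cext => k.
    by rewrite /tm /Cdiv Cpow_mult_l (Cpow_S (RtoC t)) RtoC_pow; ring.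
  have := H _ (small_real t01 Hy); rewrite -E1 !Cmod_mult Cmod_R Rabs_pos_eq; last lra.
  move=> h; apply: (Rmult_le_reg_l t); lra.
apply: CInt_bound; first by apply: ex_CInt_cont => t Ht; apply: C_cont_minus; [exact: fc | exact: gc].
move=> t Ht; have [t0|t0] := Req_dec t 0; last by apply: B; lra.
rewrite t0; apply: (cont0_bound (f := fun t => f t - g t)) => //.
by apply: C_cont_minus; [apply: fc; lra | exact: gc].
Qed.

Lemma abel (y : C) (g : nat -> C) N :
  (1 - y) * csum (fun k => Cpow y k.+1 * csum g k) N = y * csum (fun j => Cpow y j.+1 * g j) N - Cpow y N.+1 * csum g N.
Proof.
elim: N => [|N IH]; first by rewrite /csum; ring.
by rewrite !csum_recr Cmult_plus_distr_l IH (Cpow_S y N.+1); ring.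
Qed.

(** For outermost index 0, Abel summation gives the remainder as
    [(y * rho u N + y ^ N.+1 * S) / (1 - y)], where [u] has one entry less and [Cmod S <= 1]. As
    [1 / (1 - y)] is at most 2 in modulus, a constant [K] becomes [2 * K + 2]. *)
Fixpoint Kb (r : nat) : R := if r is r'.+1 then (2 * Kb r' + 2)%R else 0%R.

Lemma Kb_ge0 r : (0 <= Kb r)%R.
Proof. by elim: r => [|r IH] /=; lra. Qed.

Lemma one_minus_small y : small y -> 1 - y <> 0 /\ (Cmod (/ (1 - y)) <= 2)%R.
Proof.
move=> Hy; have h : (/ 2 <= Cmod (1 - y))%R.
  have := Cmod_triangle (1 - y) y; rewrite C_subrK Cmod_1; move: Hy; rewrite /small; lra.
have nz : 1 - y <> 0 by move=> E; rewrite E Cmod_0 in h; lra.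
split => //; rewrite Cmod_inv //; rewrite -[X in (_ <= X)%R]Rinv_inv; apply: Rinv_le_contravar; lra.
Qed.

Lemma rho_bound l n y N : small y -> (forall q, List.In q l -> small q.2) ->
  (Cmod (rho ((n, y) :: l) N) <= Kb (size l).+1 * (/ 2) ^ N * Cmod y)%R.
Proof.
have p2 : (0 <= (/ 2) ^ N)%R by apply: pow_le; lra.
elim: l n y => [|[n' y'] l IH] n y Hy Hl.
all: have K0 s : (0 <= Kb s * (/ 2) ^ N)%R by apply: Rmult_le_pos => //; exact: Kb_ge0.
all: elim: n y Hy => [|n IHn]; last by apply: rho_succ => //; exact: K0.
all: move=> y Hy; have [nz i2] := one_minus_small Hy; have y0 := Cmod_ge_0 y.
all: have yN : (Cmod (Cpow y N.+1) <= Cmod y * (/ 2) ^ N)%R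
  by (rewrite Cpow_S Cmod_mult Cmod_pow; apply: Rmult_le_compat_l => //; apply: pow_incr).
all: have i0 := Cmod_ge_0 (/ (1 - y)); have yN0 := Cmod_ge_0 (Cpow y N.+1).
  have -> : rho [:: (0%nat, y)] N = Cpow y N.+1 * / (1 - y).
    rewrite /rho [wl _ _]/= lam0 lam_nil /kw [trS _ _]/=.
    have -> : csum (fun k => tm 0 y k * 1) N = (y - Cpow y N.+1) * / (1 - y).
      elim: N {p2 K0 yN yN0} => [|N IH]; first by rewrite /csum /=; ring.
      rewrite csum_recr IH /tm (Cpow_S y N.+1) /Cdiv; change (Cpow _ 0) with (RtoC 1); field; repeat split; first [exact: nz | exact: C1_nz].
    by rewrite !Cmult_1_l Cmult_1_r /Cdiv; field.
  rewrite Cmod_mult [Kb _]/=; have := Rmult_le_compat _ _ _ _ yN0 i0 yN i2; lra.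
set u := (n', y * y') :: l; set l1 := (n', y') :: l.
have Hy' : small y' by apply: (Hl (n', y')); left.
have Hl' q : List.In q l -> small q.2 by move=> Hq; apply: Hl; right.
have iu := IH n' _ (small_mult Hy Hy') Hl'; rewrite -/u in iu.
have bl := trS_bound N Hl; rewrite -/l1 in bl.
have -> : rho ((0%nat, y) :: l1) N = (y * rho u N + Cpow y N.+1 * trS l1 N) * / (1 - y).
  have -> : rho ((0%nat, y) :: l1) N = y * / (1 - y) * lam (wl 1 u) 1 - csum (fun k => Cpow y k.+1 * trS l1 k) N.
    rewrite /rho [wl 1 (_ :: l1)]/= lam0 /kw [trS _ _]/=; congr (_ - _).
      have -> : wl 1 u = (n', 1 * y * y') :: wl (1 * y * y') l by rewrite /u /=; congr ((_, _) :: wl _ _); ring.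
      by rewrite !Cmult_1_l.
    apply: csum_cext => k; rewrite /tm; change (Cpow _ 0) with (RtoC 1); congr (_ * _); field; exact: C1_nz.
  have E : (1 - y) * csum (fun k => Cpow y k.+1 * trS l1 k) N = y * trS u N - Cpow y N.+1 * trS l1 N.
    rewrite [X in y * X](_ : _ = csum (fun j => Cpow y j.+1 * (tm n' y' j * trS l j)) N); last first.
      rewrite -[trS u N]/(csum (fun k => tm n' (y * y') k * trS l k) N).
      by apply: csum_cext => k; rewrite /tm /Cdiv Cpow_mult_l; ring.
    exact: abel.
  rewrite {1}(_ : csum (fun k => Cpow y k.+1 * trS l1 k) N = / (1 - y) * ((1 - y) * csum (fun k => Cpow y k.+1 * trS l1 k) N)).
    by rewrite E /rho; ring.
  by rewrite Cmult_assoc Cinv_l // Cmult_1_l.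
rewrite Cmod_mult; have t1 := Cmod_triangle (y * rho u N) (Cpow y N.+1 * trS l1 N); rewrite (Cmod_mult y (rho u N)) (Cmod_mult (Cpow y N.+1) (trS l1 N)) in t1; rewrite (Cmod_mult y y') in iu.
have r0 := Cmod_ge_0 (rho u N); have b0 := Cmod_ge_0 (trS l1 N); have y1 := Cmod_ge_0 y'.
have yy : (Cmod y * Cmod y' <= 1)%R by move: Hy Hy'; rewrite /small; nra.
have K1 := K0 (size l).+1.
have iu2 : (Cmod (rho u N) <= Kb (size l).+1 * (/ 2) ^ N)%R by nra.
set K := Kb (size l).+1 in iu2 K1 *; have -> : Kb (size l1).+1 = (2 * K + 2)%R by [].
have a1 : (Cmod y * Cmod (rho u N) <= Cmod y * (K * (/ 2) ^ N))%R by apply: Rmult_le_compat_l.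
have a2 : (Cmod (Cpow y N.+1) * Cmod (trS l1 N) <= Cmod y * (/ 2) ^ N)%R by nra.
have a3 := Cmod_ge_0 (y * rho u N + Cpow y N.+1 * trS l1 N).
have a4 : (Cmod (y * rho u N + Cpow y N.+1 * trS l1 N) <= Cmod y * (K * (/ 2) ^ N) + Cmod y * (/ 2) ^ N)%R by lra.
have := Rmult_le_compat _ _ _ _ a3 i0 a4 i2; lra.
Qed.

(** Convergence at the rate [(/ 2) ^ N], which holds for arguments of modulus at most 1/2. The
    explicit rate makes sums and products of limits elementary. *)
Definition gl (u : nat -> C) (v : C) : Prop :=
  exists K : R, (0 <= K)%R /\ forall N, (Cmod (v - u N) <= K * (/ 2) ^ N)%R.

Lemma gl_const c : gl (fun _ => c) c.
Proof.
exists 0%R; split; first lra.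
by move=> N; rewrite (_ : c - c = 0) ?Cmod_0; [lra | ring].
Qed.

Lemma gl_plus u v u' v' : gl u v -> gl u' v' -> gl (fun N => u N + u' N) (v + v').
Proof.
move=> [K [K0 H]] [K' [K0' H']]; exists (K + K')%R; split; first lra.
move=> N; rewrite (_ : v + v' - (u N + u' N) = (v - u N) + (v' - u' N)); last by ring.
apply: Rle_trans (Cmod_triangle _ _) _; have := H N; have := H' N; lra.
Qed.

Lemma gl_mult u v u' v' : gl u v -> gl u' v' -> gl (fun N => u N * u' N) (v * v').
Proof.
move=> [K [K0 H]] [K' [K0' H']].
have v0 := Cmod_ge_0 v; have v0' := Cmod_ge_0 v'.
exists (K * (Cmod v' + K') + Cmod v * K')%R; split; first nra.
move=> N; rewrite (_ : v * v' - u N * u' N = (v - u N) * u' N + v * (v' - u' N)); last by ring.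
apply: Rle_trans (Cmod_triangle _ _) _; rewrite !Cmod_mult.
have h := H N; have h' := H' N.
have p0 : (0 <= (/ 2) ^ N)%R by apply: pow_le; lra.
have p1 : ((/ 2) ^ N <= 1)%R by rewrite -[X in (_ <= X)%R](pow1 N); apply: pow_incr; lra.
have b : (Cmod (u' N) <= Cmod v' + K')%R.
  have := Cmod_triangle (- (v' - u' N)) v'; rewrite Cmod_opp (_ : - (v' - u' N) + v' = u' N); last by ring.
  nra.
have a0 := Cmod_ge_0 (v - u N); have a1 := Cmod_ge_0 (u' N); have a2 := Cmod_ge_0 (v' - u' N).
have c1 : (Cmod (v - u N) * Cmod (u' N) <= K * (/ 2) ^ N * (Cmod v' + K'))%R by apply: Rmult_le_compat.
have c2 : (Cmod v * Cmod (v' - u' N) <= Cmod v * (K' * (/ 2) ^ N))%R by apply: Rmult_le_compat_l.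
lra.
Qed.

Lemma gl_opp u v : gl u v -> gl (fun N => - u N) (- v).
Proof.
move=> [K [K0 H]]; exists K; split => // N.
by rewrite (_ : - v - - u N = - (v - u N)) ?Cmod_opp //; ring.
Qed.

Lemma half_pow_lim K e : (0 <= K)%R -> (0 < e)%R -> exists M, forall N, (M <= N)%coq_nat -> (K * (/ 2) ^ N < e)%R.
Proof.
move=> K0 e0; have h : (Rabs (/ 2) < 1)%R by rewrite Rabs_pos_eq; lra.
have e1 : (0 < e / (K + 1))%R by apply: Rdiv_lt_0_compat; lra.
have [M HM] := pow_lt_1_zero _ h _ e1.
exists M => N /HM; rewrite Rabs_pos_eq; last by apply: pow_le; lra.
move=> /Rlt_div_r h1.
have p0 : (0 <= (/ 2) ^ N)%R by apply: pow_le; lra.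
have := h1 ltac:(lra); nra.
Qed.

Lemma gl_filterlim u v : gl u v -> filterlim u eventually (locally (T := C_UniformSpace) v).
Proof.
move=> [K [K0 H]]; apply/filterlim_locally => e.
have [M HM] := half_pow_lim K0 (cond_pos e).
exists M => N HN; apply: C_ballP; rewrite (_ : u N - v = - (v - u N)); last by ring.
by rewrite Cmod_opp; apply: Rle_lt_trans (H N) (HM N HN).
Qed.

Lemma gl_zero v : gl (fun _ => 0) v -> v = 0.
Proof.
move=> /gl_filterlim H; apply: (C_lim_unique H); exact: (gl_filterlim (gl_const 0)).
Qed.

Lemma gl_ext u u' v : (forall N, u N = u' N) -> gl u v -> gl u' v.
Proof. by move=> E [K [K0 H]]; exists K; split => // N; rewrite -E. Qed.

Lemma gl_lam l : (forall q, List.In q l -> small q.2) -> gl (trS l) (lam (wl 1 l) 1).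
Proof.
case: l => [|[n y] l] H; first by rewrite /= lam_nil; exact: gl_const.
have Hy : small y by apply: (H (n, y)); left.
exists (Kb (size l).+1); split; first exact: Kb_ge0.
move=> N; have h := @rho_bound l n y N Hy (fun q Hq => H q (or_intror Hq)).
apply: Rle_trans h _; have p2 : (0 <= (/ 2) ^ N)%R by apply: pow_le; lra.
have K0 : (0 <= Kb (size l).+1 * (/ 2) ^ N)%R by apply: Rmult_le_pos => //; exact: Kb_ge0.
move: Hy; rewrite /small; nra.
Qed.

(** * The truncated sums of the definition as nested sums *)

HB.instance Definition _ := Monoid.isComLaw.Build C (RtoC 0) Cplus Cplus_assoc Cplus_comm Cplus_0_l.
HB.instance Definition _ := Monoid.isComLaw.Build C (RtoC 1) Cmult Cmult_assoc Cmult_comm Cmult_1_l.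
HB.instance Definition _ := Monoid.isMulLaw.Build C (RtoC 0) Cmult Cmult_0_l Cmult_0_r.
HB.instance Definition _ := Monoid.isAddLaw.Build C Cmult Cplus Cmult_plus_distr_r Cmult_plus_distr_l.

Definition rl (r : nat) (n : 'I_r -> nat) (y : 'I_r -> C) : seq (nat * C) :=
  [seq (n j, y j) | j <- rev (enum 'I_r)].

Lemma rlS r (n : 'I_r.+1 -> nat) y : rl n y = (n ord_max, y ord_max) ::
  rl (fun j => n (widen_ord (leqnSn r) j)) (fun j => y (widen_ord (leqnSn r) j)).
Proof. by rewrite /rl enum_ordSr rev_rcons /= -map_rev -map_comp. Qed.

Definition bounded_idx r M (N : nat) (k : {ffun 'I_r -> 'I_M.+1}) : bool := [forall i, (k i <= N)%nat].

Definition ext_idx r M (p : {ffun 'I_r -> 'I_M.+1} * 'I_M.+1) : {ffun 'I_r.+1 -> 'I_M.+1} :=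
  [ffun i => if unlift ord_max i is Some j then p.1 j else p.2].

Lemma widenE r (j : 'I_r) : widen_ord (leqnSn r) j = lift ord_max j.
Proof. by apply: val_inj; rewrite /= /bump leqNgt ltn_ord. Qed.

Lemma ext_idx_widen r M p (j : 'I_r) : @ext_idx r M p (widen_ord (leqnSn r) j) = p.1 j.
Proof. by rewrite ffunE widenE liftK. Qed.

Lemma ext_idx_max r M p : @ext_idx r M p ord_max = p.2.
Proof. by rewrite ffunE unlift_none. Qed.

Lemma ext_idx_bij r M : bijective (@ext_idx r M).
Proof.
exists (fun k : {ffun 'I_r.+1 -> 'I_M.+1} => ([ffun j : 'I_r => k (widen_ord (leqnSn r) j)] : {ffun 'I_r -> 'I_M.+1}, k ord_max)).
  move=> [f m]; rewrite ext_idx_max; congr (_, _); apply/ffunP => j.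
  by rewrite ffunE ext_idx_widen.
move=> k; apply/ffunP => i; rewrite ffunE; case: unliftP => [j ->|->] //=.
by rewrite ffunE widenE.
Qed.

Lemma ext_idx_incr r M (p : {ffun 'I_r -> 'I_M.+1} * 'I_M.+1) N :
  increasing_idx (ext_idx p) && bounded_idx N (ext_idx p)
  = ((0 < p.2)%nat && (p.2 <= N)%nat) && (increasing_idx p.1 && bounded_idx (p.2).-1 p.1).
Proof.
apply/idP/idP.
  move=> /andP [/andP [/forallP h0 /forallP h1] /forallP h2].
  have m0 := h0 ord_max; have mN := h2 ord_max; rewrite ext_idx_max in m0 mN.
  rewrite m0 mN /=; apply/andP; split; [apply/andP; split|].
  - by apply/forallP => j; have := h0 (widen_ord (leqnSn r) j); rewrite ext_idx_widen.
  - apply/forallP => j; apply/forallP => j'.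
    by have /forallP/(_ (widen_ord (leqnSn r) j')) := h1 (widen_ord (leqnSn r) j); rewrite !ext_idx_widen.
  - apply/forallP => j; have /forallP/(_ ord_max) := h1 (widen_ord (leqnSn r) j).
    by rewrite ext_idx_widen ext_idx_max /= ltn_ord /=; lia.
move=> /andP [/andP [m0 mN] /andP [/andP [/forallP h0 /forallP h1] /forallP h2]].
have wd (i : 'I_r.+1) : (exists j, i = widen_ord (leqnSn r) j) \/ i = ord_max.
  by case: (unliftP ord_max i) => [j ->|->]; [left; exists j; rewrite widenE | right].
apply/andP; split; [apply/andP; split|].
- by apply/forallP => i; case: (wd i) => [[j ->]|->]; rewrite ?ext_idx_widen ?ext_idx_max.
- apply/forallP => i; apply/forallP => i'; apply/implyP.
  case: (wd i) => [[j ->]|->]; case: (wd i') => [[j' ->]|->]; rewrite ?ext_idx_widen ?ext_idx_max /= => lt.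
  + by have /forallP/(_ j')/implyP := h1 j; apply.
  + by have := h2 j; lia.
  + by have := ltn_ord j'; lia.
  + by lia.
- apply/forallP => i; case: (wd i) => [[j ->]|->]; rewrite ?ext_idx_widen ?ext_idx_max //.
  by have := h2 j; lia.
Qed.

(** The range [M] of the index functions stays fixed, while the bound [N] on their values drops to
    one less than the largest index when that index is split off. *)
Lemma partial_trS r M N (n : 'I_r -> nat) (y : 'I_r -> C) : (N <= M)%nat ->
  \big[Cplus/RtoC 0]_(k : {ffun 'I_r -> 'I_M.+1} | increasing_idx k && bounded_idx N k)
    \big[Cmult/RtoC 1]_(i < r) (Cpow (y i) (k i) / Cpow (RtoC (INR (k i))) (n i)) = trS (rl n y) N.
Proof.
elim: r N n y => [|r IH] N n y NM.
  rewrite /rl enum_ord0 /= (big_pred1 [ffun i => ord0]).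
    by rewrite big_ord0.
  move=> k /=; transitivity true; last by apply/esym/eqP/ffunP => -[].
  by apply/andP; split; [apply/andP; split|]; apply/forallP => -[].
rewrite rlS (reindex (@ext_idx r M)); last exact/onW_bij/ext_idx_bij.
under eq_bigl => p do rewrite ext_idx_incr.
under eq_bigr => p _.
  rewrite big_ord_recr /= ext_idx_max.
  under eq_bigr => i _ do rewrite ext_idx_widen.
  over.
rewrite (eq_bigl (fun p : {ffun 'I_r -> 'I_M.+1} * 'I_M.+1 => predT p.2 && (((0 < p.2)%nat && (p.2 <= N)%nat) && (increasing_idx p.1 && bounded_idx (p.2).-1 p.1)))) //.
pose Q (m : 'I_M.+1) (f : {ffun 'I_r -> 'I_M.+1}) := increasing_idx f && bounded_idx m.-1 f.
pose w (m : 'I_M.+1) := Cpow (y ord_max) m / Cpow (RtoC (INR m)) (n ord_max).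
pose v (f : {ffun 'I_r -> 'I_M.+1}) := \big[Cmult/RtoC 1]_(i < r) (Cpow (y (widen_ord (leqnSn r) i)) (f i) / Cpow (RtoC (INR (f i))) (n (widen_ord (leqnSn r) i))).
transitivity (\big[Cplus/RtoC 0]_(m : 'I_M.+1 | (0 < m)%nat && (m <= N)%nat) \big[Cplus/RtoC 0]_(f | Q m f) (v f * w m)).
  rewrite pair_big_dep /=.
  rewrite (reindex (fun p : {ffun 'I_r -> 'I_M.+1} * 'I_M.+1 => (p.2, p.1))) //=.
  by exists (fun p => (p.2, p.1)) => [[]|[]].
transitivity (\big[Cplus/RtoC 0]_(m : 'I_M.+1 | (0 < m)%nat && (m <= N)%nat)
    (w m * trS (rl (fun j => n (widen_ord (leqnSn r) j)) (fun j => y (widen_ord (leqnSn r) j))) m.-1)).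
  apply: eq_bigr => m /andP [m0 mN]; rewrite -big_distrl /= Cmult_comm; congr (_ * _).
  by apply: IH; lia.
rewrite big_mkcond /= big_ord_recl /= Cplus_0_l.
set T := trS (rl _ _).
rewrite -[RHS]/(csum (fun k => tm (n ord_max) (y ord_max) k * T k) N).
transitivity (csum (fun k => if (k < N)%nat then tm (n ord_max) (y ord_max) k * T k else RtoC 0) M).
  by rewrite -big_csum; apply: eq_bigr => m _; rewrite /w /= /bump /= add1n.
rewrite -(subnKC NM); elim: (M - N)%nat => [|j IHj].
  by rewrite addn0; apply: csum_ext => k ->.
by rewrite addnS csum_recr IHj ltnNge leq_addr /= Cplus_0_r.
Qed.

Lemma Li_partialE r N (n : 'I_r -> nat) (y : 'I_r -> C) : Li_partial n y N = trS (rl n y) N.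
Proof.
rewrite -(partial_trS n y (leqnn N)); apply: eq_bigl => k.
by rewrite (_ : bounded_idx N k = true) ?andbT //; apply/forallP => i; rewrite -ltnS.
Qed.

Lemma series_small r (n : 'I_r -> nat) (y : 'I_r -> C) : (forall i, small (y i)) ->
  is_Li_series n y (lam (wl 1 (rl n y)) 1).
Proof.
move=> H; apply: (filterlim_ext (trS (rl n y))) => [N|]; first by rewrite Li_partialE.
by apply: gl_filterlim; apply: gl_lam => q Hq; move: Hq => /List.in_map_iff [j [<- _]]; exact: H.
Qed.

(** * Holomorphy in the arguments *)

Lemma cont_bigprod (X : UniformSpace) (I : finType) (P : pred I) (f : I -> X -> C) x :
  (forall i, continuous (U := C_UniformSpace) (f i) x) -> continuous (U := C_UniformSpace) (fun y => \big[Cmult/RtoC 1]_(i | P i) f i y) x.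
Proof.
move=> H; elim: (index_enum I) => [|i s IH].
  by apply: (continuous_ext (fun _ => RtoC 1)) => [y|]; [rewrite big_nil | exact: C_cont_const].
apply: (continuous_ext (fun y => if P i then f i y * \big[Cmult/RtoC 1]_(i <- s | P i) f i y else \big[Cmult/RtoC 1]_(i <- s | P i) f i y)) => [y|].
  by rewrite big_cons.
by case: (P i) => //; apply: C_cont_mult.
Qed.

(** Half-open version of [zprod]: products over adjacent ranges concatenate, and an empty range
    gives 1. *)
Definition zp (d : nat) (z : 'I_d -> C) (i j : nat) : C := \big[Cmult/RtoC 1]_(k < d | (i <= k < j)%nat) z k.

Lemma zprodE d (z : 'I_d -> C) i j : zprod z i j = zp z i j.+1.
Proof. by apply: eq_bigl => k; rewrite ltnS. Qed.

Lemma zp_nil d (z : 'I_d -> C) i : zp z i i = 1.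
Proof. by apply: big_pred0 => k; apply/negbTE/negP; lia. Qed.

Lemma zp_cat d (z : 'I_d -> C) i j k : (i <= j <= k)%nat -> zp z i j * zp z j k = zp z i k.
Proof.
move=> H; rewrite [RHS](bigID (fun m : 'I_d => (m < j)%nat)) /=.
by congr (_ * _); apply: eq_bigl => m; apply/idP/idP; lia.
Qed.

(** The partial derivative of [zp] in the coordinate [i]. As [zp] is affine in each coordinate, it
    is also the exact slope. *)
Definition zc d (i : 'I_d) (a b : nat) (z : 'I_d -> C) : C :=
  if (a <= i < b)%nat then \big[Cmult/RtoC 1]_(k < d | (a <= k < b)%nat && (k != i)) z k else 0.

Lemma zp_set d (z : 'I_d -> C) i u a b : zp (set_coord z i u) a b - zp z a b = (u - z i) * zc i a b z.
Proof.
rewrite /zc; case: ifP => H.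
  have E w : zp w a b = w i * \big[Cmult/RtoC 1]_(k < d | (a <= k < b)%nat && (k != i)) w k by apply: bigD1.
  have E2 : \big[Cmult/RtoC 1]_(k < d | (a <= k < b)%nat && (k != i)) set_coord z i u k
      = \big[Cmult/RtoC 1]_(k < d | (a <= k < b)%nat && (k != i)) z k.
    by apply: eq_bigr => k /andP [_ /negbTE ki]; rewrite /set_coord ki.
  by rewrite !E E2 set_coord_at; ring.
rewrite (_ : zp (set_coord z i u) a b = zp z a b); first by ring.
apply: eq_bigr => k Hk; rewrite /set_coord; case: eqP => // E.
by rewrite -E Hk in H.
Qed.

Lemma zp_cont d a b (z : 'I_d -> C) : continuous (T := Cn d) (U := C_UniformSpace) (fun z => zp z a b) z.
Proof. by apply: cont_bigprod => k; exact: coord_cont. Qed.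

Lemma zc_cont d i a b (z : 'I_d -> C) : continuous (T := Cn d) (U := C_UniformSpace) (zc i a b) z.
Proof.
case E: (a <= i < b)%nat.
  apply: (continuous_ext (fun z : Cn d => \big[Cmult/RtoC 1]_(k < d | (a <= k < b)%nat && (k != i)) z k)) => [y|].
    by rewrite /zc E.
  by apply: cont_bigprod => k; exact: coord_cont.
by apply: (continuous_ext (fun _ => RtoC 0)) => [y|]; [rewrite /zc E | exact: C_cont_const].
Qed.

Definition ev d (Q : seq (nat * (nat * nat))) (z : 'I_d -> C) : seq (nat * C) :=
  [seq (q.1, zp z q.2.1 q.2.2) | q <- Q].

Definition dom d (Q : seq (nat * (nat * nat))) (z : 'I_d -> C) : Prop :=
  forall q, List.In q Q -> slit (zp z q.2.1 q.2.2).

Lemma set_coord_cont d (z : 'I_d -> C) i u : continuous (T := C_UniformSpace) (U := Cn d) (fun w => set_coord z i w) u.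
Proof.
by apply: cont_Cn => k; rewrite /set_coord; case: (k == i); [exact: continuous_id | exact: C_cont_const].
Qed.

Section Holo.
Variables (d : nat) (Q : seq (nat * (nat * nat))).

Let L : seq (nat * (Cn d -> C)) := [seq (q.1, fun z : Cn d => zp z q.2.1 q.2.2) | q <- Q].
Let ws := [seq q.2 | q <- L].

Lemma dom_kdom (z : Cn d) : dom Q z -> kdom (fun _ : Cn d => True) ws (z, 1%R).
Proof.
move=> H; split => //=; apply/List.Forall_forall => w /List.in_map_iff [p [<- /List.in_map_iff [q [<- Hq]]]] /=.
exact: H.
Qed.

Lemma kdom_dom (z : Cn d) : kdom (fun _ : Cn d => True) ws (z, 1%R) -> dom Q z.
Proof.
move=> [_ /= /List.Forall_forall H] q Hq; apply: (H (fun z : Cn d => zp z q.2.1 q.2.2)).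
by apply/List.in_map_iff; exists (q.1, fun z : Cn d => zp z q.2.1 q.2.2); split => //; apply/List.in_map_iff; exists q.
Qed.

Lemma ws_cont : List.Forall (fun w : Cn d -> C => forall x, True -> continuous (T := Cn d) (U := C_UniformSpace) w x) ws.
Proof.
apply/List.Forall_forall => w /List.in_map_iff [p [<- /List.in_map_iff [q [<- Hq]]]] x _ /=.
exact: zp_cont.
Qed.

Lemma dom_open : open (T := Cn d) (dom Q).
Proof.
move=> z /dom_kdom Hz.
have [e He] := (@kdom_star (Cn d) (fun _ => True) ws (@open_true _) ws_cont).1 _ Hz.
exists e => y Hy; apply: kdom_dom; apply: He; split => //=; exact: ball_center.
Qed.

Lemma lam_ev_cont z : dom Q z -> continuous (T := Cn d) (U := C_UniformSpace) (fun z => lam (ev Q z) 1) z.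
Proof.
move=> /dom_kdom Hz.
have H := @lam_cont (Cn d) (fun _ => True) L (@open_true _) _.
have {}H : cont_on (kdom (fun _ : Cn d => True) ws) (fun x => lam (evw L x)).
  by apply: H => q /List.in_map_iff [p [<- Hp]] x _ /=; exact: zp_cont.
apply: (continuous_ext (fun z : Cn d => lam (evw L z) 1)) => [y|].
  by rewrite /evw /L -map_comp.
apply: (@continuous_comp_2 (Cn d) (Cn d) R_UniformSpace C_UniformSpace (fun x => x) (fun _ => 1%R) (fun x s => lam (evw L x) s)).
- exact: continuous_id.
- exact: continuous_const.
- exact: H.
Qed.

(** Pairs of points: the slope [G] of [lam] between two points that differ in one coordinate is
    continuous in the pair, and on the diagonal it is the partial derivative. This gives its
    existence and its joint continuity together. *)
Let X2 := prod_UniformSpace (Cn d) (Cn d).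
Let w1 (q : nat * (nat * nat)) : X2 -> C := fun p => zp p.1 q.2.1 q.2.2.
Let w2 (q : nat * (nat * nat)) : X2 -> C := fun p => zp p.2 q.2.1 q.2.2.
Let ws2 : seq (X2 -> C) := [seq w1 q | q <- Q] ++ [seq w2 q | q <- Q].
Let O2 := kdom (fun _ : X2 => True) ws2.
Let dk (i : 'I_d) (q : nat * (nat * nat)) : X2 -> R -> C :=
  fun p s => zc i q.2.1 q.2.2 p.2 * (/ (1 - RtoC s * w1 q p) * / (1 - RtoC s * w2 q p)).
Let L2 (i : 'I_d) : seq (nat * ((X2 -> R -> C) * (X2 -> R -> C) * (X2 -> R -> C))) :=
  [seq (q.1, (fun p s => kw (w1 q p) s, fun p s => kw (w2 q p) s, dk i q)) | q <- Q].
Let G (i : 'I_d) (p : X2) : C := DK [seq (q.1, (q.2.1.1 p, q.2.1.2 p, q.2.2 p)) | q <- L2 i] 1.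

Lemma w1_cont q (x : X2) : continuous (T := X2) (U := C_UniformSpace) (w1 q) x.
Proof. by apply: (continuous_comp (U := X2) (V := Cn d) fst (fun z => zp z q.2.1 q.2.2)); [exact: continuous_fst | exact: zp_cont]. Qed.

Lemma w2_cont q (x : X2) : continuous (T := X2) (U := C_UniformSpace) (w2 q) x.
Proof. by apply: (continuous_comp (U := X2) (V := Cn d) snd (fun z => zp z q.2.1 q.2.2)); [exact: continuous_snd | exact: zp_cont]. Qed.

Lemma ws2_cont : List.Forall (fun w : X2 -> C => forall x, True -> continuous (T := X2) (U := C_UniformSpace) w x) ws2.
Proof.
apply/List.Forall_forall => w /In_cat [] /List.in_map_iff [q [<- _]] x _; [exact: w1_cont | exact: w2_cont].
Qed.

Lemma O2_star : star O2.
Proof. exact: (kdom_star (@open_true _) ws2_cont). Qed.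

Lemma O2_dom (z z' : Cn d) : dom Q z -> dom Q z' -> O2 ((z, z'), 1%R).
Proof.
move=> H H'; split => //=; apply/List.Forall_forall => w /In_cat [] /List.in_map_iff [q [<- Hq]] /=; [exact: H | exact: H'].
Qed.

Lemma L2_cont i : List.Forall (fun q => [/\ cont_on O2 q.2.1.1, cont_on O2 q.2.1.2 & cont_on O2 q.2.2]) (L2 i).
Proof.
apply/List.Forall_forall => q' /List.in_map_iff [q [<- Hq]] /=.
have i1 : List.In (w1 q) ws2 by apply/In_cat; left; apply: List.in_map.
have i2 : List.In (w2 q) ws2 by apply/In_cat; right; apply: List.in_map.
split; [exact: (kw_cont ws2_cont i1) | exact: (kw_cont ws2_cont i2) |].
apply: cont_on_mult; last by apply: cont_on_mult; exact: (kdom_den_cont ws2_cont).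
apply: (@kdom_cont X2 (fun _ => True) ws2 (fun p : X2 => zc i q.2.1 q.2.2 p.2)) => x _.
by apply: (continuous_comp (U := X2) (V := Cn d) snd (zc i q.2.1 q.2.2)); [exact: continuous_snd | exact: zc_cont].
Qed.

Lemma G_cont i (p : X2) : O2 (p, 1%R) -> continuous (T := X2) (U := C_UniformSpace) (G i) p.
Proof.
move=> Hp.
have H := @DK_cont X2 O2 O2_star (L2 i) (L2_cont i).
apply: (@continuous_comp_2 X2 X2 R_UniformSpace C_UniformSpace (fun x => x) (fun _ => 1%R) (fun p s => DK [seq (q.1, (q.2.1.1 p, q.2.1.2 p, q.2.2 p)) | q <- L2 i] s)).
- exact: continuous_id.
- exact: continuous_const.
- exact: H.
Qed.

Lemma G_slope i (z : Cn d) u : dom Q (set_coord z i u) -> dom Q z ->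
  lam (ev Q (set_coord z i u)) 1 - lam (ev Q z) 1 = (u - z i) * G i (set_coord z i u, z).
Proof.
move=> H H'; have HO := O2_dom H H'; rewrite /lam !pow1 !Cmult_1_l.
rewrite /G -(@MK_sub X2 O2 O2_star (L2 i) (u - z i) (set_coord z i u, z) (L2_cont i) _ 1%R HO).
  by congr (MK _ _ - MK _ _); rewrite /kers /ev /L2 -!map_comp.
apply/List.Forall_forall => q' /List.in_map_iff [q [<- Hq]] /= s [_ /= /List.Forall_forall Hs].
have /slit_den n1 : slit_on s (w1 q (set_coord z i u, z)) by apply: Hs; apply/In_cat; left; apply: List.in_map.
have /slit_den n2 : slit_on s (w2 q (set_coord z i u, z)) by apply: Hs; apply/In_cat; right; apply: List.in_map.
rewrite /dk /= Cmult_assoc -zp_set /kw; rewrite /w1 /w2 /= in n1 n2 *; field; by split.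
Qed.

Lemma holc_lam : holc (dom Q) (fun z : 'I_d -> C => lam (ev Q z) 1).
Proof.
split; last exact: lam_ev_cont.
exists (fun i z => G i (z, z)) => z Hz i; split; last first.
  apply: (@continuous_comp_2 (Cn d) (Cn d) (Cn d) C_UniformSpace (fun x => x) (fun x => x) (fun x y => G i (x, y))).
  - exact: continuous_id.
  - exact: continuous_id.
  - by apply: (continuous_ext (G i)) => [[? ?]//|]; apply: G_cont; apply: O2_dom.
have E : G i (z, z) = (fun w => G i (set_coord z i w, z)) (z i) by rewrite set_coord_id.
rewrite E; apply: (@C_der_slope (fun w => lam (ev Q (set_coord z i w)) 1) (fun w => G i (set_coord z i w, z)) (z i)).
  have nb : @locally C_UniformSpace (z i) (fun w => dom Q (set_coord z i w)).
    have := @set_coord_cont d z i (z i); rewrite /continuous set_coord_id => /(_ _ (dom_open Hz)).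
    by [].
  by apply: filter_imp nb => w Hw; rewrite [in lam (ev Q (set_coord z i (z i)))]set_coord_id; apply: G_slope.
apply: (@continuous_comp_2 C_UniformSpace (Cn d) (Cn d) C_UniformSpace (fun w => set_coord z i w) (fun _ => z) (fun x y => G i (x, y))).
- exact: set_coord_cont.
- exact: continuous_const.
- rewrite set_coord_id; by apply: (continuous_ext (G i)) => [[? ?]//|]; apply: G_cont; apply: O2_dom.
Qed.

End Holo.

Lemma zp_scale d (z : 'I_d -> C) t a b : (0 <= t <= 1)%R ->
  exists c, (0 <= c <= 1)%R /\ zp (fun i => RtoC t * z i) a b = RtoC c * zp z a b.
Proof.
move=> Ht; rewrite /zp; elim/big_rec2: _ => [|k x y _ [c [Hc ->]]].
  by exists 1%R; split; [lra | ring].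
by exists (t * c)%R; split; [nra | rewrite RtoC_mult; ring].
Qed.

Lemma slit_real c w : (0 <= c <= 1)%R -> slit w -> slit (RtoC c * w).
Proof.
move=> Hc Hw t Ht; have := Hw (t * c)%R ltac:(nra).
by rewrite (_ : RtoC (t * c * 1) * w = RtoC (t * 1) * (RtoC c * w)) // !Rmult_1_r RtoC_mult; ring.
Qed.

Lemma dom_star d Q (z : 'I_d -> C) t : (0 <= t <= 1)%R -> dom Q z -> dom Q (fun i => RtoC t * z i).
Proof.
by move=> Ht H q Hq; have [c [Hc ->]] := zp_scale z q.2.1 q.2.2 Ht; apply: slit_real => //; exact: H.
Qed.

Lemma wl_rl r (n : 'I_r -> nat) (y : 'I_r -> C) c :
  wl c (rl n y) = [seq (n j, c * zp y j r) | j <- rev (enum 'I_r)].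
Proof.
elim: r n y c => [|r IH] n y c; first by rewrite /rl enum_ord0.
rewrite rlS [wl _ _]/= IH enum_ordSr rev_rcons /= -map_rev -map_comp.
have zr (j : nat) : (j <= r)%nat -> zp y j r.+1 = zp (fun j => y (widen_ord (leqnSn r) j)) j r * y ord_max.
  move=> jr; rewrite /zp big_mkcond big_ord_recr /= jr ltnSn /= -big_mkcond; congr (_ * _).
  by apply: eq_bigl => k; rewrite /= ltn_ord; apply/idP/idP; have := ltn_ord k; lia.
congr ((_, _) :: _); first by rewrite zr // zp_nil; ring.
by apply: eq_map => j /=; congr (_, _); rewrite (zr j) ?(ltnW (ltn_ord j)) //; ring.
Qed.

Lemma near0_small r : locally (T := Cn r) (fun _ => RtoC 0) (fun y => forall i, small (y i)).
Proof.
have e0 : (0 < / 4)%R by lra.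
exists (mkposreal _ e0) => y Hy i; have := C_ballW (Hy i); rewrite /small /=.
by rewrite (_ : y i - 0 = y i); [lra | ring].
Qed.

Lemma is_Li_lam r (n : 'I_r -> nat) (z : 'I_r -> C) : (forall j : 'I_r, slit (zp z j r)) ->
  is_Li n z (lam (wl 1 (rl n z)) 1).
Proof.
move=> H; pose Q := [seq (n j, (nat_of_ord j, r)) | j <- rev (enum 'I_r)].
have E y : wl 1 (rl n y) = ev Q y.
  by rewrite wl_rl /ev /Q -map_comp; apply: eq_map => j /=; congr (_, _); ring.
have HQ : dom Q z by move=> q /List.in_map_iff [j [<- _]] /=; exact: H.
exists (dom Q), (fun y => lam (ev Q y) 1); split.
- exact: dom_open.
- by move=> t Ht; apply: dom_star.
- by have [] := @holc_lam r Q.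
- by apply: filter_imp (@near0_small r) => y Hy; rewrite -E; exact: series_small.
- by rewrite E.
Qed.

Lemma LiE r (n : 'I_r -> nat) (z : 'I_r -> C) : (forall j : 'I_r, slit (zp z j r)) ->
  Li n z = lam (wl 1 (rl n z)) 1.
Proof.
move=> H; have H1 := is_Li_lam n H; apply: is_Li_unique H1.
by apply: (@epsilon_spec _ (inhabits (RtoC 0)) (is_Li n z)); exists (lam (wl 1 (rl n z)) 1); exact: is_Li_lam.
Qed.

(** * Merging neighbouring arguments *)

Section Slots.
Variable d : nat.
Implicit Types (A B m : seq (slot d)) (z : 'I_d -> C).

(* The slots of [B] are consecutive and cover the positions [lo, ..., hi - 1];
   [dseg] is the same for slots listed from right to left. *)
Fixpoint seg (lo hi : nat) (B : seq (slot d)) : bool :=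
  if B is a :: B' then [&& (slot_fst a == lo :> nat), (lo <= slot_lst a)%nat, (0 < slot_exp a)%nat
    & seg (slot_lst a).+1 hi B'] else lo == hi.

Fixpoint dseg (lo hi : nat) (A : seq (slot d)) : bool :=
  if A is a :: A' then [&& ((slot_lst a).+1 == hi), (slot_fst a <= slot_lst a)%nat, (0 < slot_exp a)%nat
    & dseg lo (slot_fst a) A'] else lo == hi.

Lemma seg_le lo hi B : seg lo hi B -> (lo <= hi)%nat.
Proof. by elim: B lo => [|a B IH] lo /=; [move/eqP->|move=> /and4P [_ h1 _ /IH]; lia]. Qed.

Lemma dseg_le lo hi A : dseg lo hi A -> (lo <= hi)%nat.
Proof. by elim: A hi => [|a A IH] hi /=; [move/eqP->|move=> /and4P [/eqP <- h1 _ /IH]; lia]. Qed.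

Lemma seg_rcons lo hi B a : seg lo (slot_fst a) B -> (slot_fst a <= slot_lst a)%nat -> (0 < slot_exp a)%nat ->
  (slot_lst a).+1 = hi -> seg lo hi (rcons B a).
Proof.
move=> H h1 h2 h3; elim: B lo H => [|b B IH] lo /=.
  by move=> /eqP ->; rewrite eqxx h1 h2 h3 eqxx.
by move=> /and4P [-> -> -> /IH].
Qed.

Lemma dseg_rcons lo hi A a : dseg (slot_lst a).+1 hi A -> (slot_fst a <= slot_lst a)%nat -> (0 < slot_exp a)%nat ->
  slot_fst a = lo :> nat -> dseg lo hi (rcons A a).
Proof.
move=> H h1 h2 h3; elim: A hi H => [|b A IH] hi /=.
  by move=> /eqP <-; rewrite eqxx h1 h2 h3 eqxx.
by move=> /and4P [-> -> -> /IH].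
Qed.

Lemma dseg_rev lo hi A : dseg lo hi A -> seg lo hi (rev A).
Proof.
elim: A hi => [|a A IH] hi //= /and4P [/eqP h0 h1 h2 /IH h3].
by rewrite rev_cons; apply: seg_rcons h3 h1 h2 h0.
Qed.

Lemma seg_rev lo hi B : seg lo hi B -> dseg lo hi (rev B).
Proof.
elim: B lo => [|a B IH] lo //= /and4P [/eqP h0 h1 h2 /IH h3].
by rewrite rev_cons; apply: (dseg_rcons h3 _ h2 h0); rewrite h0.
Qed.

Definition evS z B : seq (nat * C) := [seq (slot_exp a, zp z (slot_fst a) (slot_lst a).+1) | a <- B].

Definition lamS z B : C := lam (wl 1 (evS z B)) 1.

Definition wtS B : nat := sumn (map (@slot_exp d) B).

Lemma wl_seg z lo mid hi B : seg mid hi B -> (lo <= mid)%nat ->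
  wl (zp z lo mid) (evS z B) = [seq (slot_exp a, zp z lo (slot_lst a).+1) | a <- B].
Proof.
elim: B mid => [|a B IH] mid //= /and4P [/eqP -> h1 _ h2] h3.
by rewrite zp_cat; [rewrite (IH (slot_lst a).+1) //; lia | lia].
Qed.

Lemma wl_dseg z lo mid hi A : dseg lo mid A -> (mid <= hi)%nat ->
  wl (zp z mid hi) (evS z A) = [seq (slot_exp a, zp z (slot_fst a) hi) | a <- A].
Proof.
elim: A mid => [|a A IH] mid //= /and4P [/eqP <- h1 _ h2] h3.
by rewrite Cmult_comm zp_cat; [rewrite (IH (slot_fst a)) //; lia | lia].
Qed.

Lemma lamS_seg z lo hi B : seg lo hi B -> lamS z B = lam [seq (slot_exp a, zp z lo (slot_lst a).+1) | a <- B] 1.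
Proof. by move=> H; rewrite /lamS -(zp_nil z lo) (wl_seg z H). Qed.

Lemma lamS_dseg z lo hi A : dseg lo hi A -> lamS z A = lam [seq (slot_exp a, zp z (slot_fst a) hi) | a <- A] 1.
Proof. by move=> H; rewrite /lamS -(zp_nil z hi) (wl_dseg z H). Qed.

Definition mrg (a : slot d) m : seq (slot d) :=
  if m is b :: m' then Slot (slot_exp a + slot_exp b) (slot_fst b) (slot_lst a) :: m' else [:: a].

(** All ways of merging runs of neighbours: the first slot either stays alone or joins the first
    slot of a merged tail. An empty tail offers nothing to join. *)
Fixpoint merges A : seq (seq (slot d)) :=
  if A is a :: A' then [seq a :: m | m <- merges A'] ++ (if A' is [::] then [::] else [seq mrg a m | m <- merges A'])
  else [:: [::]].

Lemma merges_spec A lo hi m : dseg lo hi A -> List.In m (merges A) ->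
  [/\ dseg lo hi m, wtS m = wtS A, (size m <= size A)%nat & (A <> [::] -> m <> [::])].
Proof.
elim: A hi m => [|a A IH] hi m.
  by move=> H [<-|[]].
rewrite [dseg _ _ _]/= => /and4P [h0 h1 h2 h3] /In_cat [].
  case/List.in_map_iff => m' [<- /(IH _ _ h3) [k1 k2 k3 k4]]; split => //=.
  - by rewrite h0 h1 h2 k1.
  - by rewrite /wtS /= -!/(wtS _) k2.
case: A IH h3 => [|b A] IH h3 //.
case/List.in_map_iff => m' [<- /(IH _ _ h3) [k1 k2 k3 k4]].
case: m' k1 k2 k3 k4 => [|c m'] k1 k2 k3 k4; first by case: k4.
move: k1 => /= /and4P [/eqP g0 g1 g2 g3]; split => //=.
- by rewrite h0 g3 /=; apply/andP; split; [lia | apply/andP; split => //; lia].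
- by rewrite /wtS /= -!/(wtS _) in k2 *; lia.
- by rewrite /= in k3 *; lia.
Qed.

Lemma merges_head A : exists pm, merges A = A :: pm /\
  forall lo hi m, dseg lo hi A -> List.In m pm -> (size m < size A)%nat.
Proof.
elim: A => [|a A [pm [E H]]]; first by exists [::].
rewrite [merges _]/= E; exists ([seq a :: m | m <- pm] ++ (if A is [::] then [::] else [seq mrg a m | m <- A :: pm])).
split => // lo hi m; rewrite [dseg _ _ _]/= => /and4P [_ _ _ h3] /In_cat [].
  by case/List.in_map_iff => m' [<- /(H _ _ _ h3)].
case: A E H h3 => [|b A] E H h3 // Hm.
have {}Hm : List.In m [seq mrg a m | m <- merges (b :: A)] by rewrite E.
case/List.in_map_iff: Hm => m' [<-] /(merges_spec h3) [_ _ k3 k4].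
by case: m' k3 k4 => [|c m'] k3 k4; [case: k4 | rewrite /= in k3 *].
Qed.

(** The sum over weakly decreasing indices: each equality of neighbouring indices adds two exponents
    and multiplies two arguments, which is a merge. *)
Definition FL z A : C := \big[Cplus/RtoC 0]_(m <- merges A) lamS z m.

End Slots.

(** * The antipode relation for truncated sums *)

Fixpoint trF (l : seq (nat * C)) (N : nat) : C :=
  if l is q :: l' then csum (fun k => tm q.1 q.2 k * trF l' k.+1) N else 1.

Lemma csum_big (T : Type) (l : seq T) (f : nat -> C) (g : T -> nat -> C) N :
  csum (fun k => f k * \big[Cplus/RtoC 0]_(m <- l) g m k) N = \big[Cplus/RtoC 0]_(m <- l) csum (fun k => f k * g m k) N.
Proof.
elim: l => [|m l IH].
  by rewrite big_nil; apply: csum_zero => k _; rewrite big_nil; ring.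
by rewrite big_cons -IH -csum_add; apply: csum_cext => k; rewrite big_cons; ring.
Qed.

Lemma eq_big_In (T : Type) (l : seq T) (f g : T -> C) : (forall m, List.In m l -> f m = g m) ->
  \big[Cplus/RtoC 0]_(m <- l) f m = \big[Cplus/RtoC 0]_(m <- l) g m.
Proof.
elim: l => [|m l IH] H; first by rewrite !big_nil.
by rewrite !big_cons H; [rewrite IH // => k Hk; apply: H; right | left].
Qed.

Lemma big_add (T : Type) (l : seq T) (f g : T -> C) :
  \big[Cplus/RtoC 0]_(m <- l) f m + \big[Cplus/RtoC 0]_(m <- l) g m = \big[Cplus/RtoC 0]_(m <- l) (f m + g m).
Proof. by elim: l => [|m l IH]; rewrite ?big_nil ?big_cons -?IH; ring. Qed.

Lemma Cm1 : RtoC (-1) = - RtoC 1.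
Proof. by rewrite -RtoC_opp. Qed.

Lemma tm_mul n n' y y' k : tm (n + n') (y' * y) k = tm n y k * tm n' y' k.
Proof.
have h := INRS_ge1 k; have nz : RtoC (INR k.+1) <> 0 by move/RtoC_inj; lra.
have n1 : Cpow (RtoC (INR k.+1)) n <> 0 by exact: Cpow_nz.
have n2 : Cpow (RtoC (INR k.+1)) n' <> 0 by exact: Cpow_nz.
rewrite /tm (Cpow_add_r _ n n') Cpow_mult_l.
move: (Cpow y k.+1) (Cpow y' k.+1) n1 n2 => a b; move: (Cpow _ n) (Cpow _ n') => u v n1 n2.
by field; split.
Qed.

(** The inner sum up to [k.+1] is split into its part up to [k], where the new slot stays alone, and
    its last summand, where the indices coincide and the slot merges. *)
Lemma trF_merges d (z : 'I_d -> C) lo hi A N : dseg lo hi A ->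
  trF (evS z A) N = \big[Cplus/RtoC 0]_(m <- merges A) trS (evS z m) N.
Proof.
elim: A hi N => [|a A IH] hi N; first by rewrite /= big_seq1.
rewrite [dseg _ _ _]/= => /and4P [h0 h1 h2 h3].
have E : trF (evS z (a :: A)) N = csum (fun k => tm (slot_exp a) (zp z (slot_fst a) (slot_lst a).+1) k *
    \big[Cplus/RtoC 0]_(m <- merges A) trS (evS z m) k.+1) N.
  by apply: csum_cext => k; rewrite -(IH _ _ h3).
rewrite E csum_big.
case: A h3 {E IH} => [|b A] h3; first by rewrite /= !big_seq1.
have -> : merges (a :: b :: A) = [seq a :: m | m <- merges (b :: A)] ++ [seq mrg a m | m <- merges (b :: A)] by [].
have HM0 m := @merges_spec _ _ _ _ m h3; move: (merges (b :: A)) HM0 => M HM.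
transitivity (\big[Cplus/RtoC 0]_(m <- M) trS (evS z (a :: m)) N + \big[Cplus/RtoC 0]_(m <- M) trS (evS z (mrg a m)) N).
  2: by rewrite big_cat !big_map.
rewrite big_add; apply: eq_big_In => m /HM [k1 _ _ k4].
case: m k1 k4 => [|c m] k1 k4; first by case: k4.
move: k1 => /= /and4P [/eqP g0 g1 g2 g3].
rewrite -csum_add; apply: csum_cext => k.
rewrite csum_recr -(zp_cat z (i := slot_fst c) (j := slot_fst a) (k := (slot_lst a).+1)); last by lia.
by rewrite tm_mul g0; ring.
Qed.

(* [sum_i (-1)^i F (rev (take i B) ++ A) * S (drop i B)]. *)
Fixpoint conv (T : Type) (F S : seq T -> C) (A B : seq T) : C :=
  if B is b :: B' then F A * S B - conv F S (b :: A) B' else F A.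

Lemma conv_map (T T' : Type) (h : T -> T') F S A B :
  conv F S (map h A) (map h B) = conv (fun l => F (map h l)) (fun l => S (map h l)) A B.
Proof. by elim: B A => [|b B IH] A //=; rewrite -IH. Qed.

Notation tconv N := (conv (fun l => trF l N) (fun l => trS l N)).

(** Raising [N] adds [tm * trS B N] to the strict factor and [tm * trF A N.+1] to the non-strict
    one. These increments cancel between consecutive terms, and only the boundary term remains; for
    empty [A] it is 0. *)
Lemma conv_step N A B : tconv N.+1 A B = tconv N A B + (trF A N.+1 - trF A N) * trS B N.
Proof.
elim: B A => [|b B IH] A; first by rewrite /=; ring.
have E1 : trS (b :: B) N.+1 = trS (b :: B) N + tm b.1 b.2 N * trS B N by [].
have E2 : trF (b :: A) N.+1 = trF (b :: A) N + tm b.1 b.2 N * trF A N.+1 by [].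
rewrite -[LHS]/(trF A N.+1 * trS (b :: B) N.+1 - tconv N.+1 (b :: A) B).
rewrite -[tconv N A (b :: B)]/(trF A N * trS (b :: B) N - tconv N (b :: A) B).
rewrite IH E1 E2; ring.
Qed.

(* The antipode relation between strict and non-strict truncated sums. *)
Lemma conv_zero N b B : tconv N [::] (b :: B) = 0.
Proof.
have c0 a A B' : tconv 0 (a :: A) B' = 0.
  elim: B' a A => [|b' B' IH] a A; first by [].
  rewrite -[LHS]/(trF (a :: A) 0 * trS (b' :: B') 0 - tconv 0 (b' :: a :: A) B') IH.
  by rewrite /= /csum; ring.
elim: N => [|N IH].
  rewrite -[LHS]/(1 * trS (b :: B) 0 - tconv 0 [:: b] B) c0.
  by rewrite /= /csum; ring.
by rewrite conv_step IH /=; ring.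
Qed.

(** * The antipode relation on the domain *)

Section Domain.
Variable d : nat.
Implicit Types (A B m : seq (slot d)) (z : 'I_d -> C).

(** Unlike [Li_domain] this set contains the origin and is star-shaped about it, as the identity
    theorem requires. *)
Definition Udom z : Prop := forall p : 'I_d * 'I_d, (p.1 <= p.2)%nat -> slit (zp z p.1 p.2.+1).

Lemma Udom_slit z a b : Udom z -> (a < b <= d)%nat -> slit (zp z a b).
Proof.
case: b => // b H /andP [ab bd]; have ad : (a < d)%nat by lia.
exact: (H (Ordinal ad, Ordinal bd)).
Qed.

Lemma Udom_open : open (T := Cn d) Udom.
Proof.
move=> z Hz; apply: filter_fin => p.
have [le|nle] : (p.1 <= p.2)%nat \/ ~ (p.1 <= p.2)%nat by case: leqP; [left | right].
  2: by apply: filter_imp filter_true => y _ /nle.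
have Hd : dom [:: (0%nat, (nat_of_ord p.1, (nat_of_ord p.2).+1))] z by move=> q [<-|[]]; exact: Hz.
by apply: filter_imp (dom_open Hd) => y Hy _; apply: (Hy (0%nat, (nat_of_ord p.1, (nat_of_ord p.2).+1))); left.
Qed.

Lemma Udom_star z t : (0 <= t <= 1)%R -> Udom z -> Udom (fun i => RtoC t * z i).
Proof.
by move=> Ht H p Hp; have [c [Hc ->]] := zp_scale z p.1 p.2.+1 Ht; apply: slit_real => //; exact: H.
Qed.

Lemma holc_ext (U : ('I_d -> C) -> Prop) F G : (forall z, F z = G z) -> holc U F -> holc U G.
Proof. by move=> /functional_extensionality ->. Qed.

Lemma holc_Udom Q : (forall q, List.In q Q -> (q.2.1 < q.2.2 <= d)%nat) -> holc Udom (fun z : 'I_d -> C => lam (ev Q z) 1).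
Proof.
move=> HQ; have sub z : Udom z -> dom Q z by move=> Hz q /HQ; exact: Udom_slit.
have [H1 H2] := @holc_lam d Q; split; first by apply: hol_subset H1.
by move=> z /sub; exact: H2.
Qed.

Lemma holc_seg lo hi B : seg lo hi B -> holc Udom (fun z => lamS z B).
Proof.
move=> H; apply: (holc_ext (F := fun z => lam (ev [seq (slot_exp a, (lo, (slot_lst a).+1)) | a <- B] z) 1)) => [z|].
  by rewrite (lamS_seg z H) /ev -map_comp.
apply: holc_Udom.
have {H} : exists2 mid, (lo <= mid)%nat & seg mid hi B by exists lo.
elim: B => [|a B IH] [mid h0] //= /and4P [/eqP h1 h2 h3 h4] q [<- /=|].
  by have := ltn_ord (slot_lst a); lia.
by apply: IH; exists (slot_lst a).+1; [lia | exact: h4].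
Qed.

Lemma dseg_bound lo hi A : dseg lo hi A -> A <> [::] -> (hi <= d)%nat.
Proof. by case: A => [|a A] //= /and4P [/eqP <- _ _ _] _; exact: ltn_ord. Qed.

Lemma dseg_entries lo mid hi A : dseg lo mid A -> (mid <= hi <= d)%nat ->
  forall a, List.In a A -> (slot_fst a < hi <= d)%nat.
Proof.
elim: A mid => [|a A IH] mid //= /and4P [/eqP h1 h2 h3 h4] h5 b [<-|].
  by lia.
by apply: (IH (slot_fst a) h4); lia.
Qed.

Lemma holc_dseg lo hi A : dseg lo hi A -> holc Udom (fun z => lamS z A).
Proof.
move=> H; apply: (holc_ext (F := fun z => lam (ev [seq (slot_exp a, (nat_of_ord (slot_fst a), hi)) | a <- A] z) 1)) => [z|].
  by rewrite (lamS_dseg z H) /ev -map_comp.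
apply: holc_Udom => q; case/List.in_map_iff => a [<- Ha] /=.
have An : A <> [::] by move=> E; rewrite E in Ha.
by apply: (dseg_entries H) Ha; rewrite leqnn (dseg_bound H An).
Qed.

Lemma holc_big (T : Type) (l : seq T) (f : T -> ('I_d -> C) -> C) : (forall t, List.In t l -> holc Udom (f t)) ->
  holc Udom (fun z => \big[Cplus/RtoC 0]_(t <- l) f t z).
Proof.
elim: l => [|t l IH] H.
  by apply: (holc_ext (F := fun _ => RtoC 0)) => [z|]; [rewrite big_nil | exact: holc_const].
apply: (holc_ext (F := fun z => f t z + \big[Cplus/RtoC 0]_(t <- l) f t z)) => [z|]; first by rewrite big_cons.
by apply: holc_plus; [apply: H; left | apply: IH => k Hk; apply: H; right].
Qed.

Lemma holc_FL lo hi A : dseg lo hi A -> holc Udom (fun z => FL z A).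
Proof.
by move=> H; apply: holc_big => m /(merges_spec H) [h _ _ _]; exact: holc_dseg h.
Qed.

Lemma dseg_cons lo mid a A : dseg lo mid A -> slot_fst a = mid :> nat -> (mid <= slot_lst a)%nat -> (0 < slot_exp a)%nat ->
  dseg lo (slot_lst a).+1 (a :: A).
Proof. by move=> H E h1 h2; rewrite /= eqxx E h1 h2. Qed.

Lemma holc_conv lo mid hi A B : dseg lo mid A -> seg mid hi B -> holc Udom (fun z => conv (FL z) (lamS z) A B).
Proof.
elim: B lo mid A => [|b B IH] lo mid A HA HB; first exact: holc_FL HA.
have := HB => /= /and4P [/eqP h0 h1 h2 h3].
apply: (holc_ext (F := fun z => FL z A * lamS z (b :: B) + RtoC (-1) * conv (FL z) (lamS z) (b :: A) B)) => [z|].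
  by rewrite Cm1 /=; move: (conv _ _ _ _) => x; ring.
apply: holc_plus; first by apply: holc_mult; [exact: holc_FL HA | exact: holc_seg HB].
by apply: holc_mult; [exact: holc_const | apply: (IH lo _ (b :: A)) h3; exact: dseg_cons HA h0 h1 h2].
Qed.

Lemma zp_small z (a b : 'I_d) : (a <= b)%nat -> (forall i, small (z i)) -> small (zp z a b.+1).
Proof.
move=> ab Hz; rewrite /zp (bigD1 a) /=; last by rewrite leqnn ltnS.
have : (Cmod (\big[Cmult/RtoC 1]_(i < d | ((a <= i < b.+1)%nat) && (i != a)) z i) <= 1)%R.
  elim/big_rec: _ => [|i x _ Hx]; first by rewrite Cmod_1; lra.
  rewrite Cmod_mult; have := Hz i; rewrite /small; have := Cmod_ge_0 (z i); have := Cmod_ge_0 x; nra.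
have := Hz a; rewrite /small Cmod_mult; have := Cmod_ge_0 (z a).
move: (Cmod (\big[_/_]_(_ < _ | _) _)) => x; nra.
Qed.

Lemma evS_small z B : (forall i, small (z i)) -> (forall a, List.In a B -> (slot_fst a <= slot_lst a)%nat) ->
  forall q, List.In q (evS z B) -> small q.2.
Proof. by move=> Hz H q; case/List.in_map_iff => a [<- /H Ha] /=; exact: zp_small. Qed.

Lemma seg_valid lo hi B a : seg lo hi B -> List.In a B -> (slot_fst a <= slot_lst a)%nat.
Proof.
elim: B lo => [|b B IH] lo //= /and4P [/eqP h0 h1 _ h3] [<-|]; [by rewrite h0 | exact: IH h3].
Qed.

Lemma dseg_valid lo hi A a : dseg lo hi A -> List.In a A -> (slot_fst a <= slot_lst a)%nat.
Proof.
by elim: A hi => [|b A IH] hi //= /and4P [h0 h1 _ h3] [<-|] //; exact: IH h3.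
Qed.

Lemma gl_big (T : Type) (l : seq T) (u : T -> nat -> C) (v : T -> C) : (forall t, List.In t l -> gl (u t) (v t)) ->
  gl (fun N => \big[Cplus/RtoC 0]_(t <- l) u t N) (\big[Cplus/RtoC 0]_(t <- l) v t).
Proof.
elim: l => [|t l IH] H.
  by rewrite big_nil; apply: (gl_ext (u := fun _ => RtoC 0)) => [N|]; [rewrite big_nil | exact: gl_const].
rewrite big_cons; apply: (gl_ext (u := fun N => u t N + \big[Cplus/RtoC 0]_(t <- l) u t N)) => [N|]; first by rewrite big_cons.
by apply: gl_plus; [apply: H; left | apply: IH => k Hk; apply: H; right].
Qed.

Lemma gl_conv z lo mid hi A B : (forall i, small (z i)) -> dseg lo mid A -> seg mid hi B ->
  gl (fun N => conv (fun l => trF (evS z l) N) (fun l => trS (evS z l) N) A B) (conv (FL z) (lamS z) A B).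
Proof.
move=> Hz; elim: B lo mid A => [|b B IH] lo mid A HA HB.
all: have FA : gl (fun N => trF (evS z A) N) (FL z A)
  by (apply: (gl_ext (u := fun N => \big[Cplus/RtoC 0]_(m <- merges A) trS (evS z m) N)) => [N|];
    [by rewrite (trF_merges z N HA) | apply: gl_big => m /(merges_spec HA) [h _ _ _];
     apply: gl_lam; apply: evS_small => // a; exact: dseg_valid h]).
  exact: FA.
have := HB => /= /and4P [/eqP h0 h1 h2 h3].
apply: gl_plus.
  apply: gl_mult => //; apply: gl_lam; apply: evS_small => // a; exact: seg_valid HB.
by apply: gl_opp; apply: (IH lo _ (b :: A)) h3; exact: dseg_cons HA h0 h1 h2.
Qed.

(** For small arguments both kinds of truncated sums converge and the relation is the limit of
    [conv_zero]. The left-hand side is holomorphic on [Udom], so it vanishes there altogether. *)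
Lemma conv0_domain z lo hi b B : Udom z -> seg lo hi (b :: B) -> conv (FL z) (lamS z) [::] (b :: B) = 0.
Proof.
move=> Hz HB; have HA : dseg lo lo ([::] : seq (slot d)) by rewrite /= eqxx.
have [[dF HF] _] := holc_conv HA HB.
apply: (@hol_identity d Udom (fun z => conv (FL z) (lamS z) [::] (b :: B)) dF Udom_open HF z) => [t Ht|].
  exact: Udom_star.
apply: filter_imp (@near0_small d) => y Hy; apply: gl_zero.
apply: (gl_ext _ (gl_conv Hy HA HB)) => N.
pose h (a : slot d) := (slot_exp a, zp y (slot_fst a) (slot_lst a).+1).
transitivity (conv (fun l => trF l N) (fun l => trS l N) [::] (map h (b :: B))); last exact: conv_zero.
by symmetry; exact: (conv_map h (fun l => trF l N) (fun l => trS l N) [::] (b :: B)).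
Qed.

End Domain.

Lemma mem_In (T : eqType) (s : seq T) x : x \in s -> List.In x s.
Proof. by elim: s => [|y s IH] //; rewrite inE => /orP [/eqP ->|/IH]; [left | right]. Qed.

Lemma big_mulr (T : Type) (l : seq T) (f : T -> C) c :
  (\big[Cplus/RtoC 0]_(m <- l) f m) * c = \big[Cplus/RtoC 0]_(m <- l) (f m * c).
Proof. by elim: l => [|m l IH]; rewrite ?big_nil ?big_cons -?IH; ring. Qed.

(** * The integer span *)

Section Spans.
Variable d : nat.
Implicit Types (A B b m : seq (slot d)) (z : 'I_d -> C) (t : term d).

Lemma npos_zp z i j : Li_domain z -> (i < j <= d)%nat -> npos (zp z i j).
Proof.
case: j => // j Hz /andP [ij jd]; have id : (i < d)%nat by lia.
have := Hz (Ordinal id) (Ordinal jd) ij; by rewrite zprodE.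
Qed.

Lemma Li_domain_Udom z : Li_domain z -> Udom z.
Proof.
move=> Hz p Hp; apply: npos_slit; last lra.
by apply: npos_zp => //; have := ltn_ord p.2; lia.
Qed.

Lemma wtS_cons (a : slot d) B : wtS (a :: B) = (slot_exp a + wtS B)%nat.
Proof. by []. Qed.

Lemma wtS_cat A B : wtS (A ++ B) = (wtS A + wtS B)%nat.
Proof. by rewrite /wtS map_cat sumn_cat. Qed.

Lemma wtS_rev B : wtS (rev B) = wtS B.
Proof. by rewrite /wtS map_rev sumn_rev. Qed.

Lemma block_rl b z : rl (block_exp (b := b)) (block_arg (b := b) z) = evS z (rev b).
Proof.
rewrite /rl /evS !map_rev; congr rev.
transitivity [seq (slot_exp a, zp z (slot_fst a) (slot_lst a).+1) | a <- map (tnth (in_tuple b)) (enum 'I_(size b))].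
  2: by rewrite map_tnth_enum.
rewrite -map_comp; apply: eq_map => k /=.
by rewrite /block_exp /block_arg zprodE.
Qed.

Lemma block_is_Li b lo hi z : seg lo hi b -> Li_domain z ->
  is_Li (block_exp (b := b)) (block_arg (b := b) z) (lamS z (rev b))
  /\ Li (block_exp (b := b)) (block_arg (b := b) z) = lamS z (rev b).
Proof.
move=> Hb Hz; have Hr := seg_rev Hb.
suff S (j : 'I_(size b)) : slit (zp (block_arg (b := b) z) j (size b)).
  rewrite /lamS -block_rl; split; [exact: is_Li_lam | exact: LiE].
have E1 := wl_rl (block_exp (b := b)) (block_arg (b := b) z) 1.
have E2 : wl 1 (evS z (rev b)) = [seq (slot_exp a, zp z (slot_fst a) hi) | a <- rev b].
  by rewrite -(zp_nil z hi) (wl_dseg z Hr).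
rewrite block_rl E2 in E1.
have : List.In (block_exp j, 1 * zp (block_arg (b := b) z) j (size b)) [seq (slot_exp a, zp z (slot_fst a) hi) | a <- rev b].
  rewrite E1; apply: (List.in_map (fun j => (block_exp j, 1 * zp (block_arg (b := b) z) j (size b)))).
  by apply: mem_In; rewrite mem_rev mem_enum.
rewrite Cmult_1_l; case/List.in_map_iff => a [[_ <-] Ha].
apply: Udom_slit; first exact: Li_domain_Udom.
have bn : rev b <> [::] by move=> E; rewrite E in Ha.
by apply: (dseg_entries Hr _ Ha); rewrite leqnn (dseg_bound Hr bn).
Qed.

Definition comb (l : seq (Z * term d)) z : C := \big[Cplus/RtoC 0]_(p <- l) (RtoC (IZR p.1) * term_val p.2 z).

Lemma comb_nil z : comb [::] z = 0.
Proof. by rewrite /comb big_nil. Qed.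

Lemma comb_cons p l z : comb (p :: l) z = RtoC (IZR p.1) * term_val p.2 z + comb l z.
Proof. by rewrite /comb big_cons. Qed.

Lemma comb_cat l l' z : comb (l ++ l') z = comb l z + comb l' z.
Proof.
elim: l => [|p l IH]; first by rewrite comb_nil cat0s; ring.
by rewrite cat_cons !comb_cons IH; ring.
Qed.

(** The slots of a block are adjacent, with gaps only between blocks. The partial products inside a
    block are then again some [z_{i,j}], so its [Li] is defined on the whole domain. *)
Fixpoint blk (lo : nat) (bs : seq (seq (slot d))) : Prop :=
  if bs is b :: bs' then b <> [::] /\ exists lo' hi, [/\ (lo <= lo')%nat, seg lo' hi b & blk hi bs'] else True.

Definition good (lo lob D w : nat) (t : term d) : Prop :=
  [/\ blk lo (blocks t), (size (flatten (blocks t)) <= D)%nat,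
      (\sum_(i < d) beta_idx t i + wtS (flatten (blocks t)) = w)%nat
    & forall i : 'I_d, (i < lob)%nat -> beta_idx t i = 0%nat].

(* The blocks start at position [lo] or later, and the Bernoulli functions
   [beta_k (z_{i,d})] with [k > 0] have [i >= lob]. *)
Definition Span (lo lob D w : nat) (f : ('I_d -> C) -> C) : Prop :=
  exists l : seq (Z * term d), (forall c t, List.In (c, t) l -> good lo lob D w t)
    /\ forall z, Li_domain z -> f z = comb l z.

Lemma blk_le lo lo' bs : (lo' <= lo)%nat -> blk lo bs -> blk lo' bs.
Proof.
case: bs => [|b bs] //= H [bn [l1 [h1 [h2 h3 h4]]]]; split => //; exists l1, h1; split => //; exact: leq_trans h2.
Qed.

Lemma Span_le lo lob D w f lo' lob' D' w' g : Span lo lob D w f -> (lo' <= lo)%nat -> (lob' <= lob)%nat ->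
  (D <= D')%nat -> w = w' -> (forall z, Li_domain z -> f z = g z) -> Span lo' lob' D' w' g.
Proof.
move=> [l [H E]] h1 h2 h3 <- fg; exists l; split; last by move=> z Hz; rewrite -fg // E.
move=> c t /H [g1 g2 g3 g4]; split => //; [exact: blk_le g1 | exact: leq_trans h3 | ].
by move=> i Hi; apply: g4; exact: leq_trans h2.
Qed.

Lemma Span0 lo lob D w : Span lo lob D w (fun _ => RtoC 0).
Proof. by exists [::]; split => // z _; rewrite comb_nil. Qed.

Lemma Span_add lo lob D w f g : Span lo lob D w f -> Span lo lob D w g -> Span lo lob D w (fun z => f z + g z).
Proof.
move=> [l [H E]] [l' [H' E']]; exists (l ++ l'); split; last by move=> z Hz; rewrite comb_cat E // E'.
by move=> c t /In_cat [/H|/H'].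
Qed.

Lemma Span_scal lo lob D w (c : Z) f : Span lo lob D w f -> Span lo lob D w (fun z => RtoC (IZR c) * f z).
Proof.
move=> [l [H E]]; exists [seq ((c * p.1)%Z, p.2) | p <- l]; split.
  by move=> c' t Ht; case/List.in_map_iff: Ht => -[c1 t1] [[_ <-] /H].
move=> z Hz; rewrite E //; elim: l {H E} => [|p l IH]; first by rewrite comb_nil; ring.
by rewrite map_cons !comb_cons -IH /= mult_IZR RtoC_mult; ring.
Qed.

Lemma Span_opp lo lob D w f : Span lo lob D w f -> Span lo lob D w (fun z => - f z).
Proof.
move=> H; apply: (Span_le (Span_scal (-1) H)) => // z _.
by change (IZR (-1)) with (-1)%R; rewrite Cm1; ring.
Qed.

Lemma Span_big (T : Type) (l : seq T) (f : T -> ('I_d -> C) -> C) lo lob D w :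
  (forall k, List.In k l -> Span lo lob D w (f k)) -> Span lo lob D w (fun z => \big[Cplus/RtoC 0]_(k <- l) f k z).
Proof.
elim: l => [|k l IH] H.
  by apply: (Span_le (Span0 lo lob D w)) => // z _; rewrite big_nil.
apply: (Span_le (Span_add (H k (or_introl erefl)) (IH (fun k Hk => H k (or_intror Hk))))) => // z _.
by rewrite big_cons.
Qed.

Lemma Span_csum (f : nat -> ('I_d -> C) -> C) N lo lob D w :
  (forall k, (k < N)%nat -> Span lo lob D w (f k)) -> Span lo lob D w (fun z => csum (fun k => f k z) N).
Proof.
elim: N => [|N IH] H; first exact: Span0.
by apply: Span_add; [apply: IH => k Hk; apply: H; exact: ltnW | exact: H].
Qed.

Lemma beta0 x : beta 0 x = 1.
Proof.
rewrite /beta BP0; change (Cpow two_pi_i 0) with (RtoC 1); change (INR 0`!) with 1%R.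
by field; exact: C1_nz.
Qed.

Lemma Span1 lo lob : Span lo lob 0 0 (fun _ => RtoC 1).
Proof.
exists [:: (1%Z, Term (fun _ => 0%nat) [::])]; split.
  by move=> c t [[_ <-]|//]; split => //=; rewrite big1.
move=> z _; rewrite comb_cons comb_nil /term_val /= big_nil big1; first by ring.
by move=> i _; exact: beta0.
Qed.

Lemma Span_block lo hi lob D w b f : seg lo hi b -> b <> [::] -> Span hi lob D w f ->
  Span lo lob (size b + D) (wtS b + w) (fun z => Li (block_exp (b := b)) (block_arg (b := b) z) * f z).
Proof.
move=> Hb bn [l [H E]]; exists [seq (p.1, Term (beta_idx p.2) (b :: blocks p.2)) | p <- l]; split.
  move=> c t Ht; case/List.in_map_iff: Ht => -[c1 t1] [[_ <-] /H [g1 g2 g3 g4]]; split => //=.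
  - by split => //; exists lo, hi; split.
  - by rewrite size_cat leq_add2l.
  - by rewrite wtS_cat -g3 addnCA.
move=> z Hz; rewrite E //; elim: l {H E} => [|p l IH]; first by rewrite !comb_nil; ring.
rewrite map_cons !comb_cons -IH /= /term_val /= big_cons.
by apply: (_ : forall u r x y c : C, u * (r * (x * y) + c) = r * (x * (u * y)) + u * c); move=> *; ring.
Qed.

Lemma lamS_nil z : lamS z [::] = 1.
Proof. exact: lam_nil. Qed.

Lemma Span_lam lo hi lob D w m f : dseg lo hi m -> Span hi lob D w f ->
  Span lo lob (size m + D) (wtS m + w) (fun z => lamS z m * f z).
Proof.
case: m => [|a m] Hm Hf.
  move: Hm => /= /eqP ->; apply: (Span_le Hf) => // z _; rewrite lamS_nil; ring.
have Hr := dseg_rev Hm.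
have rn : rev (a :: m) <> [::] by move/(congr1 size); rewrite size_rev.
apply: (Span_le (Span_block Hr rn Hf)) => //; [by rewrite size_rev | by rewrite wtS_rev | move=> z Hz].
by have [_ ->] := block_is_Li Hr Hz; rewrite revK.
Qed.

Lemma Span_F lo hi lob D w A f : dseg lo hi A -> Span hi lob D w f ->
  Span lo lob (size A + D) (wtS A + w) (fun z => FL z A * f z).
Proof.
move=> HA Hf.
have H : Span lo lob (size A + D) (wtS A + w) (fun z => \big[Cplus/RtoC 0]_(m <- merges A) (lamS z m * f z)).
  apply: Span_big => m /(merges_spec HA) [h1 h2 h3 _].
  by apply: (Span_le (Span_lam h1 Hf)) => //; [rewrite leq_add2r | rewrite h2].
by apply: (Span_le H) => // z _; rewrite /FL big_mulr.
Qed.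

(** A term has room for one Bernoulli index at each position, so position [i0] must still be free in
    [f]; the bound [lob] keeps track of this. *)
Lemma Span_beta (i0 : 'I_d) lo lob D w a f : (i0 < lob)%nat -> Span lo lob D w f ->
  Span lo i0 D (a + w) (fun z => beta a (zp z i0 d) * f z).
Proof.
move=> i0l [l [H E]].
exists [seq (p.1, Term (fun i => if i == i0 then a else beta_idx p.2 i) (blocks p.2)) | p <- l]; split.
  move=> c t Ht; case/List.in_map_iff: Ht => -[c1 t1] [[_ <-] /H [g1 g2 g3 g4]]; split => //=.
    rewrite -g3 (bigD1 i0) //= eqxx [in RHS](bigD1 i0) //= g4 //.
    rewrite (eq_bigr (beta_idx t1)); first by lia.
    by move=> i /negbTE ->.
  move=> i ii0; case: eqP => [e|_]; first by rewrite e ltnn in ii0.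
  by apply: g4; exact: ltn_trans i0l.
have zE z : zprod z i0 d.-1 = zp z i0 d by rewrite zprodE; congr zp; have := ltn_ord i0; lia.
move=> z Hz; rewrite E //.
elim: l H {E} => [|[c t] l IH] H; first by rewrite !comb_nil; ring.
rewrite map_cons !comb_cons -IH; last by move=> c' t' Ht; apply: (H c' t'); right.
have [_ _ _ g4] := H c t (or_introl erefl).
rewrite /term_val /= (bigD1 i0) //= g4 // beta0 [in RHS](bigD1 i0) //= eqxx zE.
have -> : \big[Cmult/RtoC 1]_(i < d | i != i0) beta (if i == i0 then a else beta_idx t i) (zprod z i d.-1)
   = \big[Cmult/RtoC 1]_(i < d | i != i0) beta (beta_idx t i) (zprod z i d.-1).
  by apply: eq_bigr => i /negbTE ->.
move: (\big[_/_]_(i < d | _) _) (\big[_/_]_(b0 <- _) _) => x y; ring.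
Qed.

Definition SpanDecP n := forall B lo hi lob D w f, (size B <= n)%nat -> seg lo hi B -> Span hi lob D w f ->
  Span lo lob (size B + D) (wtS B + w) (fun z => lamS z B * f z).

Lemma Span_conv n B A lo mid hi lob D w f : SpanDecP n -> (size B <= n)%nat -> dseg lo mid A -> seg mid hi B ->
  Span hi lob D w f ->
  Span lo lob (size A + size B + D) (wtS A + wtS B + w) (fun z => conv (FL z) (lamS z) A B * f z).
Proof.
move=> Q; elim: B A lo mid => [|b B IH] A lo mid Bn HA HB Hf.
  move: HB => /= /eqP E; rewrite -E in Hf.
  by apply: (Span_le (Span_F HA Hf)) => //; rewrite ?addn0 ?wtS_nil // /wtS /= addn0.
have := HB => /= /and4P [/eqP h0 h1 h2 h3].
have S1 := Span_F HA (Q _ _ _ _ _ _ _ Bn HB Hf).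
have S2 := IH (b :: A) lo _ (ltnW Bn) (dseg_cons HA h0 h1 h2) h3 Hf.
apply: (Span_le (Span_add S1 (Span_opp (Span_le S2 (leqnn _) (leqnn _) _ _ (fun z _ => erefl))))) => //=.
all: rewrite ?wtS_cons; try lia.
by move=> z _; ring.
Qed.

(** Slots in increasing order make [lamS] a polylogarithm with its arguments reversed, which is no
    admissible factor. The antipode relation solves for it: the other terms are non-strict sums over
    reversed prefixes, which are combinations of admissible blocks, times the same kind of function
    for shorter lists. *)
Lemma Span_Dec n : SpanDecP n.
Proof.
elim: n => [|n Q] [|b B] lo hi lob D w f Bn HB Hf //.
1,2: by move: HB => /= /eqP ->; apply: (Span_le Hf) => // z _; rewrite lamS_nil; ring.
have := HB => /= /and4P [/eqP h0 h1 h2 h3].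
have H0 : dseg lo lo ([::] : seq (slot d)) by rewrite /= eqxx.
have := Span_conv Q Bn (dseg_cons H0 h0 h1 h2) h3 Hf.
move=> S; apply: (Span_le S) => //; first by rewrite !wtS_cons /= /wtS /= addn0.
move=> z /Li_domain_Udom Hz.
have := conv0_domain Hz HB.
rewrite -[conv _ _ _ _]/(FL z [::] * lamS z (b :: B) - conv (FL z) (lamS z) [:: b] B).
have -> : FL z [::] = 1 by rewrite /FL /= big_seq1 lamS_nil.
move=> E; congr (_ * _); rewrite -[LHS]Cplus_0_l -E; ring.
Qed.

Lemma Span_dec B lo hi lob D w f : seg lo hi B -> Span hi lob D w f ->
  Span lo lob (size B + D) (wtS B + w) (fun z => lamS z B * f z).
Proof. exact: (Span_Dec (leqnn _)). Qed.

Definition Zsgn n : Z := if odd n then (-1)%Z else 1%Z.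

Lemma sgnZ n : sgn n = RtoC (IZR (Zsgn n)).
Proof.
elim: n => [|n IH]; first by [].
rewrite sgnS IH /Zsgn /=; case: (odd n) => /=; last by rewrite -RtoC_opp.
by rewrite -RtoC_opp; congr RtoC; lra.
Qed.

Lemma Span_sgn lo lob D w n f : Span lo lob D w f -> Span lo lob D w (fun z => sgn n * f z).
Proof. by move=> H; rewrite sgnZ; exact: Span_scal. Qed.

(** * Expansions and inverted arguments in the span *)

Definition fl (a : slot d) := (slot_fst a, slot_lst a).
Definition pos (a : slot d) := (0 < slot_exp a)%nat.
Definition bump (a : slot d) l := Slot (slot_exp a + l) (slot_fst a) (slot_lst a).

Lemma seg_sim lo hi B B' : seg lo hi B -> map fl B' = map fl B -> all pos B' -> seg lo hi B'.
Proof.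
elim: B B' lo => [|a B IH] [|a' B'] lo //= /and4P [h0 h1 h2 h3] [e1 e2 e3] /andP [p1 p2].
by rewrite e1 e2 h0 h1 (p1 : (0 < slot_exp a')%nat) IH.
Qed.

Lemma seg_pos lo hi B : seg lo hi B -> all pos B.
Proof. by elim: B lo => [|a B IH] lo //= /and4P [_ _ h2 /IH ->]; rewrite andbT. Qed.

(** The functional [psi] is arbitrary, because the recursion moves the treated entries into it.
    Raising exponents changes neither the depth nor the positions of the slots. *)
Lemma Span_SE (wv : ('I_d -> C) -> slot d -> C) B k (psi : ('I_d -> C) -> seq (nat * C) -> C) lo lob D w :
  (forall z a l, wv z (bump a l) = wv z a) -> all pos B ->
  (forall B', map fl B' = map fl B -> all pos B' -> wtS B' = (wtS B + k)%nat ->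
     Span lo lob D w (fun z => psi z [seq (slot_exp a, wv z a) | a <- B'])) ->
  Span lo lob D w (fun z => SE [seq (slot_exp a, wv z a) | a <- B] (psi z) k).
Proof.
move=> Hw; elim: B k psi => [|a B IH] k psi pB H.
  by case: k H => [|k] H; [exact: (H [::]) | exact: Span0].
move: pB => /= /andP [pa pB].
apply: (@Span_csum (fun l z => gc (slot_exp a) l * SE [seq (slot_exp a, wv z a) | a <- B]
   (fun M => psi z (((slot_exp a + l)%nat, wv z a) :: M)) (k - l))) => l lk.
apply: Span_scal; apply: (IH (k - l)%nat (fun z M => psi z (((slot_exp a + l)%nat, wv z a) :: M)) pB) => B' e1 e2 e3.
apply: (Span_le (H (bump a l :: B') _ _ _)) => //.
- by rewrite /= e1.
- by rewrite /= e2 andbT /pos /=; move: pa; rewrite /pos; lia.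
- by rewrite !wtS_cons e3 /=; lia.
- by move=> z _ /=; rewrite Hw.
Qed.

(* [Li] of the inverted arguments, up to sign: for consecutive slots the partial
   products of the inverses are the [/ z_{i,d}]. *)
Definition NL z B : C := sgn (wtS B) * lam (rev [seq (slot_exp a, / zp z (slot_fst a) d) | a <- B]) 1.

Definition ZL z B : C := csum (fun i => lamS z (take i B) * NL z (drop i B)) (size B).+1.

(** The data to which [key] is applied, with full product [T = zp z lo d]. *)
Definition mkE lo B z : seq elt :=
  [seq (slot_exp a, zp z lo (slot_lst a).+1, / zp z (slot_fst a) d) | a <- B].

Lemma seg_split lo hi B i : seg lo hi B -> exists mid, seg lo mid (take i B) /\ seg mid hi (drop i B).
Proof.
elim: B lo i => [|a B IH] lo [|i] //= H; first by exists lo; rewrite eqxx.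
- by exists lo; rewrite eqxx.
- by exists lo; rewrite eqxx.
- by move: H => /and4P [h0 h1 h2 /(IH _ i) [mid [h3 h4]]]; exists mid; rewrite h0 h1 h2 h3.
Qed.

Lemma al_mkE lo B z i : al (take i (mkE lo B z)) = [seq (slot_exp a, zp z lo (slot_lst a).+1) | a <- take i B].
Proof. by rewrite /al /mkE -map_take -map_comp. Qed.

Lemma bl_mkE lo B z i : bl (drop i (mkE lo B z)) = rev [seq (slot_exp a, / zp z (slot_fst a) d) | a <- drop i B].
Proof. by rewrite /bl /mkE -map_drop -map_comp. Qed.

Lemma wt_mkE lo B z i : wt (drop i (mkE lo B z)) = wtS (drop i B).
Proof. by rewrite /wt /mkE -map_drop -map_comp. Qed.

Lemma Zs_mkE lo hi B z : seg lo hi B -> Zs (mkE lo B z) = ZL z B.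
Proof.
move=> HB; rewrite /Zs /ZL size_map; apply: csum_cext => i.
have [mid [H1 _]] := seg_split i HB.
by rewrite al_mkE bl_mkE wt_mkE (lamS_seg z H1).
Qed.

Lemma wfE_mkE lo B z : Li_domain z -> seg lo d B -> B <> [::] -> wfE (zp z lo d) (mkE lo B z).
Proof.
move=> Hz HB Bn.
have lod : (lo < d)%nat.
  by case: B HB Bn => [|a B] //= /and4P [/eqP <- _ _ _] _; exact: ltn_ord.
have T0 : npos (zp z lo d) by apply: npos_zp => //; lia.
split => //; first by case: B {HB} Bn.
  rewrite -(zp_nil z lo); have : (lo <= lo)%nat by [].
  move: HB; move: {1 3 6}lo => mid HB; elim: B mid HB {Bn} => [|a B IH] mid /=; first by move=> /eqP ->.
  move=> /and4P [/eqP h0 h1 h2 h3] lm; split; last by apply: IH; [exact: h3 | lia].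
  have md : (mid < d)%nat by rewrite -h0; exact: ltn_ord.
  rewrite h0; have E : zp z lo mid * zp z mid d = zp z lo d by apply: zp_cat; lia.
  have n0 := npos_neq0 T0; rewrite -E in n0 *.
  have n1 : zp z lo mid <> 0 by move=> e; apply: n0; rewrite e; ring.
  have n2 : zp z mid d <> 0 by move=> e; apply: n0; rewrite e; ring.
  by field; split.
move=> q Hq; case/List.in_map_iff: Hq => a [<- Ha] /=; split.
  apply: npos_zp => //; have := ltn_ord (slot_lst a).
  suff : (lo <= slot_lst a)%nat by lia.
  elim: B lo HB Ha {Bn lod T0} => [|b B IH] lo //= /and4P [/eqP h0 h1 _ h3] [<-|/(IH _ h3)] //; lia.
by apply/npos_inv/npos_zp => //; have := ltn_ord (slot_fst a); lia.
Qed.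

Definition SpanNP n := forall B lo, (size B <= n)%nat -> seg lo d B -> Span lo lo (size B) (wtS B) (fun z => NL z B).

(** The slot [i] disappears: its exponent is distributed over the Bernoulli index and the
    expansions, so the depth drops by one. The left factor is covered by [Span_dec]. The right one
    is an [NL] starting behind slot [i]; its Bernoulli functions sit there, so position [lo] is free
    for the new one. *)
Lemma Span_Rterm n B lo i : SpanNP n -> (size B <= n.+1)%nat -> seg lo d B -> (i < size B)%nat ->
  Span lo lo (size B).-1 (wtS B) (fun z =>
    Cv (fun k => beta k (zp z lo d)) (nth (0%nat, RtoC 0, RtoC 0) (mkE lo B z) i).1.1 (SEs (al (take i (mkE lo B z))) 1)
    (fun k => sgn (wt (drop i.+1 (mkE lo B z))) * SEs (bl (drop i.+1 (mkE lo B z))) 1 k)).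
Proof.
move=> P Bn HB iB.
have [a0 _] : exists a0 : slot d, True by case: B iB {Bn HB} => [|a B] // _; exists a.
set a := nth a0 B i.
have [mid [H1 H2]] := seg_split i HB.
have dE : drop i B = a :: drop i.+1 B by rewrite (drop_nth a0).
rewrite dE in H2; have := H2 => /= /and4P [/eqP h0 h1 h2 h3].
set Tk := take i B in H1; set Dr := drop i.+1 B in dE h3.
have wB : wtS B = (wtS Tk + slot_exp a + wtS Dr)%nat by rewrite -{1}(cat_take_drop i B) wtS_cat dE wtS_cons addnA.
have sT : size Tk = i by rewrite size_takel // ltnW.
have sD : size Dr = (size B - i.+1)%nat by rewrite size_drop.
have lom := seg_le H1.
have lod : (lo < d)%nat by have := ltn_ord (slot_fst a); lia.
pose lo' := Ordinal lod.
pose N := slot_exp a.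
apply: (@Span_le lo lo (size B).-1 (wtS B) (fun z => csum (fun k1 => csum (fun k2 =>
   beta (N - k1 - k2)%nat (zp z lo d) * sgn k2 * (SE [seq (slot_exp a, zp z lo (slot_lst a).+1) | a <- Tk] (fun M => lam M 1) k1
    * (sgn (wtS Dr) * SE [seq (slot_exp a, / zp z (slot_fst a) d) | a <- rev Dr] (fun M => lam M 1) k2))) (N.+1 - k1)) N.+1)) => //; last first.
  move=> z _; rewrite al_mkE bl_mkE wt_mkE /mkE (nth_map a0) // map_rev.
  by [].
apply: Span_csum => k1 k1N; apply: Span_csum => k2 k2N.
have SR : Span (slot_lst a).+1 (slot_lst a).+1 (size Dr) (wtS Dr + k2)
    (fun z => SE [seq (slot_exp a, / zp z (slot_fst a) d) | a <- rev Dr] (fun M => lam M 1) k2).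
  apply: (@Span_SE (fun z a => / zp z (slot_fst a) d) (rev Dr) k2 (fun _ M => lam M 1)) => //.
    by rewrite all_rev; exact: seg_pos h3.
  move=> B' e1 e2 e3.
  have S' : seg (slot_lst a).+1 d (rev B').
    by apply: (seg_sim h3); [rewrite map_rev e1 map_rev revK | rewrite all_rev].
  have sz : size (rev B') = size Dr.
    by rewrite size_rev -(size_map fl) e1 size_map size_rev.
  have szn : (size (rev B') <= n)%nat by rewrite sz sD; lia.
  apply: (Span_le (Span_sgn (wtS (rev B')) (P _ _ szn S'))) => //; first by rewrite sz.
    by rewrite wtS_rev e3 wtS_rev.
  by move=> z _; rewrite /NL Cmult_assoc sgn_sq Cmult_1_l -map_rev revK.
have SL : Span lo (slot_lst a).+1 (size Tk + size Dr) (wtS Tk + k1 + (wtS Dr + k2))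
   (fun z => SE [seq (slot_exp a, zp z lo (slot_lst a).+1) | a <- Tk] (fun M => lam M 1) k1 *
     SE [seq (slot_exp a, / zp z (slot_fst a) d) | a <- rev Dr] (fun M => lam M 1) k2).
  pose X z := SE [seq (slot_exp a, / zp z (slot_fst a) d) | a <- rev Dr] (fun M => lam M 1) k2.
  have SX := @Span_SE (fun z a => zp z lo (slot_lst a).+1) Tk k1 (fun z M => X z * lam M 1) lo (slot_lst a).+1
    (size Tk + size Dr) (wtS Tk + k1 + (wtS Dr + k2)) (fun _ _ _ => erefl) (seg_pos H1).
  apply: (Span_le (SX _)) => //; last by move=> z _; rewrite SE_scal Cmult_comm.
  move=> B' e1 e2 e3; have S' := seg_sim H1 e1 e2.
  have SR' : Span mid (slot_lst a).+1 (size Dr) (wtS Dr + k2) X.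
    by apply: (Span_le SR) => //; lia.
  apply: (Span_le (Span_dec S' SR')) => //.
  - by rewrite -(size_map fl) e1 size_map.
  - by rewrite e3.
  - by move=> z _; rewrite (lamS_seg z S') Cmult_comm.
have lt : (lo' < (slot_lst a).+1)%nat by rewrite /=; lia.
apply: (Span_le (Span_beta (N - k1 - k2)%nat lt (Span_sgn k2 (Span_sgn (wtS Dr) SL)))) => //.
- by rewrite sT sD; lia.
- by rewrite wB -/N; lia.
- by move=> z _; rewrite /=; ring.
Qed.

Lemma Span_Z n B lo : SpanNP n -> (size B <= n.+1)%nat -> seg lo d B -> B <> [::] ->
  Span lo lo (size B).-1 (wtS B) (fun z => ZL z B).
Proof.
move=> P Bn HB B0.
have S := Span_csum (fun i Hi => @Span_Rterm n B lo i P Bn HB Hi).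
apply: (Span_le (Span_opp S)) => // z Hz.
have HW := wfE_mkE Hz HB B0.
rewrite -(Zs_mkE z HB) (key HW) /Rs; congr (- _); rewrite size_map; apply: csum_cext => i.
have [_ _ HT _] := HW.
rewrite /Cv; apply: csum_cext => k1; apply: csum_cext => k2.
by rewrite (bt_beta _ HT).
Qed.

(* [sum_i (-1)^i FL (rev (take i B) ++ A) * ZL (drop i B)], with [Z] of the empty
   list read as [1]. *)
Fixpoint MM z A B : C := if B is b :: B' then FL z A * ZL z (b :: B') - MM z (b :: A) B' else FL z A.

Lemma NL_nil z : NL z [::] = 1.
Proof. by rewrite /NL /= lam_nil; change (sgn (wtS [::])) with (RtoC 1); ring. Qed.

Lemma MM_conv z A B : MM z A B =
  csum (fun i => conv (FL z) (lamS z) A (take i B) * NL z (drop i B)) (size B).+1.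
Proof.
elim: B A => [|b B IH] A; first by rewrite csum_recr /csum /= NL_nil; ring.
rewrite -[LHS]/(FL z A * ZL z (b :: B) - MM z (b :: A) B) IH /ZL !(csum_recl _ (size (b :: B))).
rewrite [take 0 _]/= [drop 0 _]/= lamS_nil.
set c1 := csum _ _; set c2 := csum _ _; set c3 := csum _ _.
have -> : c3 = FL z A * c1 - c2.
  have E k : conv (FL z) (lamS z) A (take k.+1 (b :: B)) * NL z (drop k.+1 (b :: B))
     = FL z A * (lamS z (take k.+1 (b :: B)) * NL z (drop k.+1 (b :: B)))
       + RtoC (-1) * (conv (FL z) (lamS z) (b :: A) (take k B) * NL z (drop k B)).
    rewrite Cm1 [take _ _]/= [drop _ _]/=.
    rewrite -[conv _ _ A _]/(FL z A * lamS z (b :: take k B) - conv (FL z) (lamS z) (b :: A) (take k B)); ring.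
  by rewrite /c3 (csum_cext _ E) csum_add !csum_scal -/c1 -/c2 Cm1; ring.
by rewrite -[conv _ _ _ _]/(FL z A); ring.
Qed.

(** After exchanging the sums, the coefficient of [NL z (drop i B)] is the antipode sum over
    [take i B], which vanishes unless [i = 0]. *)
Lemma MM_N lo hi B z : Udom z -> seg lo hi B -> MM z [::] B = NL z B.
Proof.
move=> Hz HB; rewrite MM_conv csum_recl csum_zero => [|k Hk].
  rewrite take0 drop0 -[conv _ _ _ _]/(FL z [::]) /FL /= big_seq1 lamS_nil; ring.
have [mid [H1 _]] := seg_split k.+1 HB.
case: B HB H1 Hk => [|b B] // HB H1 Hk.
by rewrite [take _ _]/= in H1 *; rewrite (conv0_domain Hz H1); ring.
Qed.

(** The subtracted term is the last one, the only one without a factor [ZL]; every other term loses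
    one in depth through [ZL]. *)
Lemma Span_MM n B A lo mid : (forall B lo, (size B <= n)%nat -> seg lo d B -> B <> [::] ->
    Span lo lo (size B).-1 (wtS B) (fun z => ZL z B)) ->
  (size B <= n)%nat -> dseg lo mid A -> seg mid d B ->
  Span lo lo (size A + size B).-1 (wtS A + wtS B) (fun z => MM z A B - sgn (size B) * FL z (catrev B A)).
Proof.
move=> HZ; elim: B A mid => [|b B IH] A mid Bn HA HB.
  apply: (Span_le (Span0 lo lo 0 (wtS A + wtS ([::] : seq (slot d))))) => // z _ /=.
  by change (sgn 0) with (RtoC 1); ring.
have := HB => /= /and4P [/eqP h0 h1 h2 h3].
have bn : b :: B <> [::] by [].
have S1 := Span_F HA (HZ (b :: B) mid Bn HB bn).
have S2 := IH (b :: A) _ (ltnW Bn) (dseg_cons HA h0 h1 h2) h3.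
have lm := dseg_le HA.
have S1' : Span lo lo (size A + size B) (wtS A + wtS (b :: B)) (fun z => FL z A * ZL z (b :: B)) by apply: (Span_le S1).
have S2' : Span lo lo (size A + size B) (wtS A + wtS (b :: B)) (fun z => MM z (b :: A) B - sgn (size B) * FL z (catrev B (b :: A))).
  by apply: (Span_le S2) => //; rewrite ?wtS_cons /=; lia.
apply: (Span_le (Span_add S1' (Span_opp S2'))) => //; first by rewrite /=; lia.
by move=> z _; rewrite sgnS; ring.
Qed.

(** Depth at most [n] for [NL] gives [n.+1] for [ZL], since the Bernoulli side only contains [NL] of
    proper tails; by [MM_N] this gives [n.+1] for [NL]. *)
Lemma Span_N n : SpanNP n.
Proof.
elim: n => [|n P] B lo Bn HB.
  case: B Bn HB => // _ _; apply: (Span_le (Span1 lo lo)) => // z _; by rewrite NL_nil.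
have H0 : dseg lo lo ([::] : seq (slot d)) by rewrite /= eqxx.
have S := Span_MM (fun B' l => @Span_Z n B' l P) Bn H0 HB.
have S2 := Span_sgn (size B) (Span_F (seg_rev HB) (Span1 d lo)).
have S' : Span lo lo (size B) (wtS B) (fun z => MM z [::] B - sgn (size B) * FL z (catrev B [::])).
  by apply: (Span_le S) => //; rewrite /=; lia.
have S2' : Span lo lo (size B) (wtS B) (fun z => sgn (size B) * (FL z (rev B) * RtoC 1)).
  by apply: (Span_le S2) => //; rewrite ?size_rev ?wtS_rev ?addn0.
apply: (Span_le (Span_add S' S2')) => // z /Li_domain_Udom Hz.
rewrite -(MM_N Hz HB) /rev; move: (MM z [::] B) (sgn _) (FL z _) => x y u; ring.
Qed.

(** * From spans to the terms of the statement, and the decomposition of [PLi] *)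

Definition before (a a' : slot d) : bool := (slot_lst a < slot_fst a')%nat.

Lemma seg_sorted lo hi b X : seg lo hi b -> path.sorted before X -> all (fun a => hi <= slot_fst a)%nat X ->
  path.sorted before (b ++ X) /\ all (fun a => lo <= slot_fst a)%nat (b ++ X).
Proof.
elim: b lo => [|a b IH] lo.
  by move=> /= /eqP ->.
rewrite [seg _ _ _]/= => /and4P [/eqP h0 h1 h2 h3] sX aX.
have [s1 a1] := IH _ h3 sX aX; rewrite cat_cons.
split; last first.
  rewrite /= h0 leqnn /=; apply: sub_all a1 => x; lia.
by case: (b ++ X) s1 a1 => [|x Y] //= s1 /andP [a1 _]; rewrite s1 andbT /before; lia.
Qed.

Lemma blk_shape lo bs : blk lo bs ->
  [/\ path.sorted before (flatten bs), all (fun a => lo <= slot_fst a)%nat (flatten bs),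
      all (fun a => (0 < slot_exp a)%nat && (slot_fst a <= slot_lst a)%nat) (flatten bs),
      all (fun b => 0 < size b)%nat bs
    & forall b, List.In b bs -> exists lo hi, seg lo hi b].
Proof.
elim: bs lo => [|b bs IH] lo; first by move=> _; split.
move=> [bn [l1 [h1 [h2 h3 /IH [k1 k2 k3 k4 k5]]]]].
have [s1 a1] := seg_sorted h3 k1 k2.
split => //=.
- by apply: sub_all a1 => x; lia.
- rewrite all_cat k3 andbT; elim: b l1 h3 {bn s1 a1 h2} => [|a b IHb] l1 //= /and4P [/eqP g0 g1 g2 /IHb ->].
  by rewrite g0 g1 g2.
- by rewrite k4 andbT; case: b bn {h3 s1 a1}.
- by move=> b' [<-|/k5] //; exists l1, h1.
Qed.

Lemma Span_Lspace D w f : Span 0 0 D w f -> in_Lspace D w f.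
Proof.
move=> [l [H E]]; exists l; split => // c t /H [g1 g2 g3 _].
have [k1 _ k3 k4 k5] := blk_shape g1.
split; first by split => //; rewrite -g3 /wtS sumnE big_map.
move=> b /k5 [lo [hi Hb]] z Hz; exists (lamS z (rev b)).
by have [] := block_is_Li Hb Hz.
Qed.

Lemma zp1 z (i : 'I_d) : zp z i i.+1 = z i.
Proof. by rewrite /zp (big_pred1 i) // => k; apply/idP/eqP => [H|->]; [apply: val_inj => /=; lia | rewrite leqnn /=]. Qed.

Lemma zp_inv z i j : Li_domain z -> zp (fun k => / z k) i j = / zp z i j.
Proof.
move=> Hz; suff [-> _] : zp (fun k => / z k) i j = / zp z i j /\ zp z i j <> 0 by [].
rewrite /zp; elim/big_rec2: _ => [|k x y _ [-> y0]].
  by split; [field; exact: C1_nz | exact: C1_nz].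
have zk : z k <> 0 by apply: npos_neq0; rewrite -zp1; apply: npos_zp => //; rewrite leqnn /= ltn_ord.
by split; [field; split | exact: Cmult_neq_0].
Qed.

Definition unit_slots (n : 'I_d -> nat) : seq (slot d) := [seq Slot (n i) i i | i <- enum 'I_d].

Lemma unit_slots_seg (n : 'I_d -> nat) : (forall i, (0 < n i)%nat) -> seg 0 d (unit_slots n).
Proof.
move=> hn; suff H (s : seq 'I_d) lo : (lo <= d)%nat -> map val s = seq.iota lo (d - lo) ->
    seg lo d [seq Slot (n i) i i | i <- s].
  by apply: H => //; rewrite subn0; exact: val_enum_ord.
elim: s lo => [|i s IH] lo lod.
  by move/(congr1 size); rewrite size_iota /= => e; apply/eqP; lia.
case E : (d - lo)%nat => [|k] //= [e1 e2].
rewrite e1 eqxx leqnn hn /=; apply: IH; first by rewrite -e1; exact: ltn_ord.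
by rewrite e2; congr (seq.iota _ _); lia.
Qed.

Lemma evS_unit z (n : 'I_d -> nat) : evS z (rev (unit_slots n)) = rl n z.
Proof.
by rewrite /evS /rl !map_rev; congr rev; rewrite -map_comp; apply: eq_map => i /=; rewrite zp1.
Qed.

(** [NL] already contains [sgn |n|], and [sgn (|n| - d) = sgn |n| * sgn d]. The subtraction in the
    exponent is a true one, because all [n i] are positive. *)
Lemma PLi_decomp (n : 'I_d -> nat) z : (forall i, (0 < n i)%nat) -> Li_domain z ->
  PLi n z = lamS z (rev (unit_slots n)) - sgn d * NL z (unit_slots n).
Proof.
move=> hn Hz.
have wU : wtS (unit_slots n) = (\sum_(i < d) n i)%nat.
  by rewrite /wtS /unit_slots -map_comp sumnE big_map big_enum.
have dS : (d <= \sum_(i < d) n i)%nat.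
  rewrite -[X in (X <= _)%nat]card_ord -sum1_card; apply: leq_sum => i _; exact: hn.
have E1 : Li n z = lamS z (rev (unit_slots n)).
  rewrite /lamS evS_unit; apply: LiE => j; apply: Udom_slit; first exact: Li_domain_Udom.
  by rewrite ltn_ord leqnn.
have E2 : Li n (fun i => / z i) = lam (rev [seq (slot_exp a, / zp z (slot_fst a) d) | a <- unit_slots n]) 1.
  rewrite LiE.
    rewrite wl_rl /unit_slots -map_comp -map_rev; congr lam; apply: eq_map => j /=.
    by rewrite zp_inv // Cmult_1_l.
  by move=> j; rewrite zp_inv //; apply: npos_slit; [apply/npos_inv/npos_zp => //; rewrite ltn_ord leqnn | lra].
rewrite /PLi E1 E2 /NL wU -/(sgn _); congr (_ - _).
have -> : sgn (\sum_(i < d) n i) = sgn (\sum_(i < d) n i - d) * sgn d by rewrite -sgnD subnK.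
by rewrite -[LHS]Cmult_1_l -(sgn_sq d); ring.
Qed.

Lemma Span_proper A lo hi : dseg lo hi A -> A <> [::] ->
  Span lo lo (size A).-1 (wtS A) (fun z => FL z A - lamS z A).
Proof.
move=> HA An; have [pm [E Hpm]] := merges_head A.
have S : Span lo lo (size A).-1 (wtS A) (fun z => \big[Cplus/RtoC 0]_(m <- pm) lamS z m).
  apply: Span_big => m Hm; have sm := Hpm _ _ _ HA Hm.
  have Hm' : List.In m (merges A) by rewrite E; right.
  have [h1 h2 _ _] := merges_spec HA Hm'.
  apply: (Span_le (Span_lam h1 (Span1 hi lo))) => //.
  - by lia.
  - by rewrite addn0.
  - by move=> z _; ring.
by apply: (Span_le S) => // z _; rewrite /FL E big_cons; ring.
Qed.

End Spans.

Theorem theorem2p5 (d : nat) (hd : (0 < d)%nat) (n : 'I_d -> nat)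
    (hn : forall i : 'I_d, (0 < n i)%nat) :
  in_Lspace (d - 1)%nat (\sum_(i < d) n i)%nat (fun z : 'I_d -> C => PLi n z).
Proof.
pose B := unit_slots n.
have HB : seg 0 d B by exact: unit_slots_seg.
have sB : size B = d by rewrite size_map size_enum_ord.
have wB : wtS B = (\sum_(i < d) n i)%nat by rewrite /wtS /B /unit_slots -map_comp sumnE big_map big_enum.
have H0 : dseg 0 0 ([::] : seq (slot d)) by [].
have S1 := Span_MM (fun B' l => @Span_Z d d B' l (@Span_N d d)) (leqW (eq_leq sB)) H0 HB.
have rn : rev B <> [::] by move/(congr1 size); rewrite size_rev sB /=; lia.
have S2 := Span_proper (seg_rev HB) rn.
have S1' : Span 0 0 (d - 1) (\sum_(i < d) n i)
    (fun z => sgn d * (MM z [::] B - sgn (size B) * FL z (catrev B [::]))).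
  by apply: Span_sgn; apply: (Span_le S1) => //; rewrite /= sB subn1.
have S2' : Span 0 0 (d - 1) (\sum_(i < d) n i) (fun z => FL z (rev B) - lamS z (rev B)).
  by apply: (Span_le S2) => //; rewrite ?size_rev ?wtS_rev ?sB ?subn1.
apply: Span_Lspace.
(* [FL z (rev B)], the only part of full depth besides [PLi] itself, cancels between the two
   summands because [sgn d * sgn d = 1]. *)
apply: (Span_le (Span_opp (Span_add S1' S2'))) => // z Hz.
rewrite (PLi_decomp hn Hz) -/B (MM_N (Li_domain_Udom Hz) HB) sB -/(rev B).
have -> : sgn d * (NL z B - sgn d * FL z (rev B)) = sgn d * NL z B - sgn d * sgn d * FL z (rev B) by ring.
rewrite sgn_sq; ring.
Qed.
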